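(* Let $K$ be a field and let $\Lambda=K\mathcal{Q}/I$ be a $(D,A)$-stacked monomial algebra with $D>2$, $A>1$ and $D\neq 2A$. Let $\hat{E}(\Lambda)$ be the Ext algebra of $\Lambda$ with the hat-degree grading. Then $\hat{E}(\Lambda)$ is a Koszul algebra.
   Context: $\mathcal{Q}$ is a finite quiver, $I$ is an admissible ideal of $K\mathcal{Q}$ generated by length homogeneous elements, and $\Lambda = K\mathcal{Q}/I$ is finite-dimensional with the length grading $\Lambda = \Lambda_0\oplus\Lambda_1\oplus\cdots$; $\mathfrak{r}=\Lambda_1\oplus\Lambda_2\oplus\cdots$ is the graded Jacobson radical and $\Lambda_0\cong\Lambda/\mathfrak{r}$ is a graded right $\Lambda$-module with minimal graded projective resolution $(P^n,d^n)$. The Ext algebra is $E(\Lambda)=\bigoplus_{n\geqslant 0}\operatorname{Ext}^n_\Lambda(\Lambda_0,\Lambda_0)$ with the Yoneda product. Definition: $\Lambda$ is a $(D,A)$-stacked algebra ($D\geqslant 2$, $A\geqslant 1$ integers) if, for all $0\leqslant n\leqslant \operatorname{gldim}\Lambda$, $P^n$ is generated in degree $\delta(n)$, where $\delta(0)=0$, $\delta(1)=1$, $\delta(n)=\frac{n}{2}D$ for $n\geqslant 2$ even, and $\delta(n)=\frac{n-1}{2}D+A$ for $n\geqslant 3$ odd. It is a $(D,A)$-stacked monomial algebra if moreover $I$ is generated by paths. Hat-degree grading on $E(\Lambda)$: $\hat{E}(\Lambda)=\bigoplus_{n\geqslant 0}\hat{E}(\Lambda)_n$ with $\hat{E}(\Lambda)_0=\operatorname{Ext}^0_\Lambda(\Lambda_0,\Lambda_0)$,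 $\hat{E}(\Lambda)_1=\operatorname{Ext}^1_\Lambda(\Lambda_0,\Lambda_0)\oplus\operatorname{Ext}^2_\Lambda(\Lambda_0,\Lambda_0)\oplus\operatorname{Ext}^3_\Lambda(\Lambda_0,\Lambda_0)$, $\hat{E}(\Lambda)_n=\operatorname{Ext}^{2n}_\Lambda(\Lambda_0,\Lambda_0)\oplus\operatorname{Ext}^{2n+1}_\Lambda(\Lambda_0,\Lambda_0)$ for $n\geqslant 2$. (If $\operatorname{gldim}\Lambda<4$ then $\hat{E}(\Lambda)_n=0$ for $n\geqslant 2$. If $\operatorname{gldim}\Lambda\geqslant 4$ it is known that $A\mid D$ for a $(D,A)$-stacked monomial algebra, so $D\neq A+1$. In both cases this is an algebra grading.) A graded algebra $B=\bigoplus_{n\geqslant 0}B_n$ with $B_0$ a finite product of copies of $K$ is Koszul if $B_0$ has a linear resolution, i.e. the $n$th projective in a minimal graded projective resolution of $B_0$ over $B$ is generated in degree $n$ for all $n$. *)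

(* Defs.v *)
From HB Require Import structures.
From mathcomp Require Import all_boot all_order all_algebra finmap.
From mathcomp.multinomials Require Import monalg.

Set Implicit Arguments.
Unset Strict Implicit.
Unset Printing Implicit Defensive.

Import GRing.Theory.

Local Open Scope ring_scope.

(* The vertex set is nonempty because [nzRingType] excludes the zero ring. *)
Record quiver := Quiver {
  vert : finType;
  arr : finType;
  qsrc : arr -> vert;
  qtgt : arr -> vert;
  vert_gt0 : (0 < #|vert|)%N
}.

Section Paths.
Variable Q : quiver.

Fixpoint walk (v : vert Q) (s : seq (arr Q)) : bool :=
  if s is a :: s' then (qsrc a == v) && walk (qtgt a) s' else true.

(* A path is its starting vertex with its arrows listed from left to right, in
   the order in which they are travelled; (v, [::]) is the trivial path at v. *)
Record qpath := QPath {
  pval : vert Q * seq (arr Q);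
  pval_walk : walk pval.1 pval.2
}.

HB.instance Definition _ := [isSub for pval].
HB.instance Definition _ := [Choice of qpath by <:].

Definition pstart (p : qpath) : vert Q := (pval p).1.
Definition parrows (p : qpath) : seq (arr Q) := (pval p).2.
Definition pend (p : qpath) : vert Q := last (pstart p) (map (@qtgt Q) (parrows p)).
Definition plen (p : qpath) : nat := size (parrows p).

Definition ptriv (v : vert Q) : qpath := @QPath (v, [::]) isT.

Lemma walk_cat v s1 s2 :
  walk v (s1 ++ s2) = walk v s1 && walk (last v (map (@qtgt Q) s1)) s2.
Proof. by elim: s1 v => //= a s1 IH v; rewrite IH andbA. Qed.

(* [None] stands for the zero product of two paths that do not compose. *)
Definition pcat (p q : qpath) : option qpath :=
  if pend p == pstart q then insub (pstart p, parrows p ++ parrows q) : option qpath else None.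

Lemma pcatP (p q : qpath) : pend p = pstart q ->
  exists2 r, pcat p q = Some r & val r = (pstart p, parrows p ++ parrows q).
Proof.
move=> e; rewrite /pcat e eqxx; case: insubP => [r _ rE|]; first by exists r.
by rewrite /= walk_cat (valP p) /= -/(pend p) e (valP q).
Qed.

Lemma pend_cat p q r : pend p = pstart q ->
  val r = (pstart p, parrows p ++ parrows q) ->
  (pstart r = pstart p) * (pend r = pend q).
Proof.
move=> e rE; split; first by rewrite /pstart rE.
rewrite {1}/pend /pstart /parrows rE /= map_cat last_cat.
by rewrite -/(pend p) e.
Qed.

Lemma pcatA p q r :
  obind (fun s => pcat s r) (pcat p q) = obind (pcat p) (pcat q r).
Proof.
have [e1|n1] := eqVneq (pend p) (pstart q); last first.
  rewrite [pcat p q]/pcat (negPf n1) /=.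
  have [e2|n2] := eqVneq (pend q) (pstart r).
    have [s -> sE] := pcatP e2.
    by rewrite /= /pcat (pend_cat e2 sE) (negPf n1).
  by rewrite [pcat q r]/pcat (negPf n2).
have [s -> sE] := pcatP e1; have sp := pend_cat e1 sE.
have [e2|n2] := eqVneq (pend q) (pstart r); last first.
  by rewrite [pcat q r]/pcat (negPf n2) /= /pcat sp (negPf n2).
have [t -> tE] := pcatP e2; have tp := pend_cat e2 tE => /=.
have [|u -> uE] := @pcatP s r; first by rewrite sp.
have [|w -> wE] := @pcatP p t; first by rewrite tp.
congr Some; apply: val_inj; rewrite uE wE sp.
by rewrite /parrows sE tE /= catA.
Qed.

Lemma pcat_trivl p : pcat (ptriv (pstart p)) p = Some p.
Proof.
have [|r -> rE] := @pcatP (ptriv (pstart p)) p; first by [].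
by congr Some; apply: val_inj; rewrite rE [RHS]surjective_pairing.
Qed.

Lemma pcat_trivr p : pcat p (ptriv (pend p)) = Some p.
Proof.
have [|r -> rE] := @pcatP p (ptriv (pend p)); first by [].
by congr Some; apply: val_inj; rewrite rE /= cats0 [RHS]surjective_pairing.
Qed.

End Paths.

Definition path_algebra (K : fieldType) (Q : quiver) : Type := {malg K[qpath Q]}.

HB.instance Definition _ (K : fieldType) (Q : quiver) :=
  GRing.Lmodule.copy (path_algebra K Q) {malg K[qpath Q]}.

(* Locked, as unification is otherwise prone to unfold the finite maps. *)
HB.lock Definition path_elt (K : fieldType) (Q : quiver) (p : qpath Q) :
  path_algebra K Q := << p >>.
Arguments path_elt {K Q} p.

Definition path_mul (K : fieldType) (Q : quiver) (p q : qpath Q) : path_algebra K Q :=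
  oapp path_elt 0 (pcat p q).

HB.lock Definition pa_mul (K : fieldType) (Q : quiver) (f g : path_algebra K Q) :
    path_algebra K Q :=
  \sum_(p <- msupp f) \sum_(q <- msupp g) (f@_p * g@_q) *: path_mul K p q.

Section PathAlgebra.
Variables (K : fieldType) (Q : quiver).
Local Notation KQ := (path_algebra K Q).
Local Notation pmul := (@path_mul K Q).
Local Notation pa_mul := (@pa_mul K Q).

Definition pa_one : KQ := \sum_v path_elt (ptriv v).

Lemma coef_path (p q : qpath Q) : (path_elt p : KQ)@_q = (p == q)%:R.
Proof. rewrite path_elt.unlock; exact: (@mcoeffU (qpath Q) K p 1 q). Qed.

Lemma coefZ c (f : KQ) p : (c *: f)@_p = c * f@_p.
Proof. exact: (@mcoeffZ (qpath Q) K c f p). Qed.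

Lemma suppZ c (f : KQ) : (msupp (c *: f) `<=` msupp f)%fset.
Proof. exact: (@msuppZ_le (qpath Q) K c f). Qed.

Lemma path_algebraE (f : KQ) : f = \sum_(p <- msupp f) f@_p *: path_elt p.
Proof.
rewrite {1}(monalgE f); apply: eq_bigr => p _.
apply/malgP => q; rewrite [RHS]coefZ [X in _ = _ * X]coef_path [RHS]mulr_natr.
exact: (@mcoeffU (qpath Q) K p f@_p q).
Qed.

Let pa_mulw (f g : KQ) (d e : {fset qpath Q}) :
  (msupp f `<=` d)%fset -> (msupp g `<=` e)%fset ->
  pa_mul f g = \sum_(p <- d) \sum_(q <- e) (f@_p * g@_q) *: pmul p q.
Proof.
move=> fd ge; rewrite pa_mul.unlock.
rewrite (big_fset_incl _ fd) /=; last first.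
  move=> p _ /mcoeff_outdom p0; apply: big1 => q _.
  by rewrite p0 mul0r scale0r.
apply: eq_bigr => p _; apply: (big_fset_incl _ ge) => q _ /mcoeff_outdom q0.
by rewrite q0 mulr0 scale0r.
Qed.

Let pa_mulDl : left_distributive pa_mul +%R.
Proof.
move=> f1 f2 g; pose d := (msupp f1 `|` msupp f2 `|` msupp (f1 + f2))%fset.
have sd p : [|| p \in msupp f1, p \in msupp f2 | p \in msupp (f1 + f2)] -> p \in d.
  by rewrite !inE orbA.
rewrite !(@pa_mulw _ _ d (msupp g)) ?fsubset_refl //;
  try by apply/fsubsetP => p pf; apply: sd; rewrite pf ?orbT.
rewrite -big_split; apply: eq_bigr => p _ /=; rewrite -big_split.
by apply: eq_bigr => q _ /=; rewrite mcoeffD mulrDl scalerDl.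
Qed.

Let pa_mulDr : right_distributive pa_mul +%R.
Proof.
move=> g f1 f2; pose d := (msupp f1 `|` msupp f2 `|` msupp (f1 + f2))%fset.
have sd p : [|| p \in msupp f1, p \in msupp f2 | p \in msupp (f1 + f2)] -> p \in d.
  by rewrite !inE orbA.
rewrite !(@pa_mulw _ _ (msupp g) d) ?fsubset_refl //;
  try by apply/fsubsetP => p pf; apply: sd; rewrite pf ?orbT.
rewrite -big_split; apply: eq_bigr => p _ /=; rewrite -big_split.
by apply: eq_bigr => q _ /=; rewrite mcoeffD mulrDr scalerDl.
Qed.

Let pa_scaleAl c (f g : KQ) : c *: pa_mul f g = pa_mul (c *: f) g.
Proof.
rewrite (pa_mulw (fsubset_refl (msupp f)) (fsubset_refl (msupp g)))
  (pa_mulw (suppZ c f) (fsubset_refl (msupp g))).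
rewrite scaler_sumr; apply: eq_bigr => p _; rewrite scaler_sumr.
by apply: eq_bigr => q _; rewrite scalerA coefZ mulrA.
Qed.

Let pa_scaleAr c (f g : KQ) : c *: pa_mul f g = pa_mul f (c *: g).
Proof.
rewrite (pa_mulw (fsubset_refl (msupp f)) (fsubset_refl (msupp g)))
  (pa_mulw (fsubset_refl (msupp f)) (suppZ c g)).
rewrite scaler_sumr; apply: eq_bigr => p _; rewrite scaler_sumr.
by apply: eq_bigr => q _; rewrite scalerA coefZ mulrCA.
Qed.

Let pa_mul0l f : pa_mul 0 f = 0.
Proof. by rewrite pa_mul.unlock msupp0 big_seq_fset0. Qed.

Let pa_mul0r f : pa_mul f 0 = 0.
Proof. by rewrite pa_mul.unlock big1 // => p _; rewrite msupp0 big_seq_fset0. Qed.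

Let pa_mul_suml (I : Type) (s : seq I) (F : I -> KQ) g :
  pa_mul (\sum_(i <- s) F i) g = \sum_(i <- s) pa_mul (F i) g.
Proof. exact: (big_morph (pa_mul^~ g) (fun x y => pa_mulDl x y g) (pa_mul0l g)). Qed.

Let pa_mul_sumr (I : Type) (s : seq I) (F : I -> KQ) g :
  pa_mul g (\sum_(i <- s) F i) = \sum_(i <- s) pa_mul g (F i).
Proof. exact: (big_morph (pa_mul g) (pa_mulDr g) (pa_mul0r g)). Qed.

Let pa_mul_path p q : pa_mul (path_elt p) (path_elt q) = pmul p q.
Proof.
have sp r : (msupp (path_elt r : KQ) `<=` [fset r])%fset.
  by rewrite path_elt.unlock msuppU_le.
rewrite (pa_mulw (sp p) (sp q)).
by rewrite !big_seq_fset1 !coef_path !eqxx mul1r scale1r.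
Qed.

Let pmulA p q r : pa_mul (pmul p q) (path_elt r) = pa_mul (path_elt p) (pmul q r).
Proof.
have := pcatA p q r; rewrite /path_mul.
case: (pcat p q) => [s|]; case: (pcat q r) => [t|] /= e.
- apply: etrans (pa_mul_path s r) _; apply: etrans (esym (pa_mul_path p t)).
  by rewrite /path_mul e.
- by apply: etrans (pa_mul_path s r) _; rewrite pa_mul0r /path_mul e.
- by apply: etrans _ (esym (pa_mul_path p t)); rewrite pa_mul0l /path_mul -e.
- by rewrite pa_mul0l pa_mul0r.
Qed.

Let pa_mul_ind (F G : KQ -> KQ) :
  (forall f g, F (f + g) = F f + F g) -> (forall f g, G (f + g) = G f + G g) ->
  (forall c f, F (c *: f) = c *: F f) -> (forall c f, G (c *: f) = c *: G f) ->
  (forall p, F (path_elt p) = G (path_elt p)) -> forall f, F f = G f.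
Proof.
move=> FD GD FZ GZ FG f; rewrite (path_algebraE f).
have F0 : F 0 = 0 by have := FZ 0 0; rewrite !scale0r.
have G0 : G 0 = 0 by have := GZ 0 0; rewrite !scale0r.
rewrite (big_morph F FD F0) (big_morph G GD G0).
by apply: eq_bigr => p _; rewrite FZ GZ FG.
Qed.

Let pa_mulA : associative pa_mul.
Proof.
move=> f g h.
apply: (pa_mul_ind (F := fun f => pa_mul f (pa_mul g h))
                   (G := fun f => pa_mul (pa_mul f g) h)) => {f}
  [f1 f2|f1 f2|c f|c f|p]; rewrite ?pa_mulDl -?pa_scaleAl //.
apply: (pa_mul_ind (F := fun g => pa_mul (path_elt p) (pa_mul g h))
                   (G := fun g => pa_mul (pa_mul (path_elt p) g) h)) => {g}
  [f1 f2|f1 f2|c f|c f|q].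
- by rewrite pa_mulDl pa_mulDr.
- by rewrite pa_mulDr pa_mulDl.
- by rewrite -pa_scaleAl -pa_scaleAr.
- by rewrite -pa_scaleAr -pa_scaleAl.
rewrite pa_mul_path.
apply: (pa_mul_ind (F := fun h => pa_mul (path_elt p) (pa_mul (path_elt q) h))
                   (G := fun h => pa_mul (pmul p q) h)) => {h}
  [f1 f2|f1 f2|c f|c f|r]; rewrite ?pa_mulDr -?pa_scaleAr //.
by rewrite pa_mul_path pmulA.
Qed.

Let pa_mul1l : left_id pa_one pa_mul.
Proof.
apply: (pa_mul_ind (F := pa_mul pa_one) (G := id)) => [f g|//|c f|//|p].
- by rewrite pa_mulDr.
- by rewrite -pa_scaleAr.
rewrite pa_mul_suml (bigD1 (pstart p)) //= big1 => [|v vp].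
  by rewrite addr0 pa_mul_path /path_mul pcat_trivl.
by rewrite pa_mul_path /path_mul /pcat /= /pend /= (negPf vp).
Qed.

Let pa_mul1r : right_id pa_one pa_mul.
Proof.
apply: (pa_mul_ind (F := pa_mul^~ pa_one) (G := id)) => [f g|//|c f|//|p].
- by rewrite pa_mulDl.
- by rewrite -pa_scaleAl.
rewrite pa_mul_sumr (bigD1 (pend p)) //= big1 => [|v vp].
  by rewrite addr0 pa_mul_path /path_mul pcat_trivr.
by rewrite pa_mul_path /path_mul /pcat /pstart /= eq_sym (negPf vp).
Qed.

Let pa_one_neq0 : pa_one != 0.
Proof.
have /card_gt0P[v _] := vert_gt0 Q.
apply/eqP => /(congr1 (mcoeff (ptriv v))); rewrite raddf_sum mcoeff0 /=.
rewrite (bigD1 v) //= coef_path eqxx big1 => [/eqP|w wv].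
  by rewrite addr0 oner_eq0.
rewrite coef_path; case: eqP => // /(congr1 (@pstart Q)) /eqP.
by rewrite /pstart /= (negPf wv).
Qed.

HB.instance Definition _ := GRing.Zmodule_isNzRing.Build KQ
  pa_mulA pa_mul1l pa_mul1r pa_mulDl pa_mulDr pa_one_neq0.
HB.instance Definition _ := GRing.Lmodule_isLalgebra.Build K KQ pa_scaleAl.
HB.instance Definition _ := GRing.Lalgebra_isAlgebra.Build K KQ pa_scaleAr.

Lemma path_eltM p q : path_elt p * path_elt q = oapp path_elt 0 (pcat p q).
Proof. exact: pa_mul_path. Qed.

End PathAlgebra.

(* The additive submonoid generated by S; it is a subspace, ideal or submodule
   as soon as S is stable under the corresponding multiplications. *)
Definition sums (V : zmodType) (S : V -> Prop) (x : V) : Prop :=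
  exists2 s : seq V, (forall y, y \in s -> S y) & x = \sum_(y <- s) y.

Definition ideal_gen (R : pzRingType) (S : R -> Prop) : R -> Prop :=
  sums (fun x => exists a s b, S s /\ x = a * s * b).

Definition ideal_mul (R : pzRingType) (I J : R -> Prop) : R -> Prop :=
  sums (fun x => exists a b, [/\ I a, J b & x = a * b]).

Definition ideal_pow (R : pzRingType) (I : R -> Prop) (m : nat) : R -> Prop :=
  iter m (ideal_mul I) (fun _ => True).

Section BoundQuiver.
Variables (K : fieldType) (Q : quiver).

Definition arrow_ideal : path_algebra K Q -> Prop :=
  ideal_gen (fun x => exists2 p : qpath Q, plen p = 1%N & x = path_elt p).

Definition admissible (I : path_algebra K Q -> Prop) : Prop :=
  (exists2 m, (2 <= m)%N & forall x, ideal_pow arrow_ideal m x -> I x)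
  /\ (forall x, I x -> ideal_pow arrow_ideal 2 x).

Definition path_ideal (rho : qpath Q -> Prop) : path_algebra K Q -> Prop :=
  ideal_gen (fun x => exists2 p, rho p & x = path_elt p).

Definition path_degree (n : nat) : path_algebra K Q -> Prop :=
  sums (fun x => exists c p, plen p = n /\ x = c *: path_elt p).

(* L, with its projection pi, is the quotient of KQ by I. *)
Definition is_quotient (I : path_algebra K Q -> Prop) (L : algType K)
    (pi : {lrmorphism path_algebra K Q -> L}) : Prop :=
  (forall y, exists x, pi x = y) /\ (forall x, pi x = 0 <-> I x).

Definition length_grading (L : algType K)
    (pi : {lrmorphism path_algebra K Q -> L}) (n : nat) (y : L) : Prop :=
  exists2 x, path_degree n x & y = pi x.

End BoundQuiver.

Arguments path_ideal K {Q} rho.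

Definition direct_sum (T : eqType) (V : zmodType) (V_ : T -> V -> Prop) : Prop :=
  [/\ forall i, V_ i 0,
      forall i x y, V_ i x -> V_ i y -> V_ i (x - y),
      forall x, exists (s : seq T) (f : T -> V),
        [/\ uniq s, forall i, V_ i (f i) & x = \sum_(i <- s) f i]
    & forall (s : seq T) (f : T -> V), uniq s -> (forall i, V_ i (f i)) ->
        \sum_(i <- s) f i = 0 -> forall i, i \in s -> f i = 0].

(* Right B-modules are left modules over the converse ring B^c; for b : B and m
   in such a module, the product m . b is written b *: m. *)
Section Graded.
Variables (K : fieldType) (B : algType K) (gr : nat -> B -> Prop).

Definition graded_algebra : Prop :=
  [/\ direct_sum gr,
      forall n (c : K) x, gr n x -> gr n (c *: x),
      gr 0 1
    & forall m n x y, gr m x -> gr n y -> gr (m + n) (x * y)].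

Definition positive_part : B -> Prop :=
  sums (fun x => exists2 n, (0 < n)%N & gr n x).

Definition graded_module (M : lmodType B^c) (M_ : int -> M -> Prop) : Prop :=
  direct_sum M_ /\
  forall i j m (b : B), M_ i m -> gr j b -> M_ (i + j%:Z) ((b : B^c) *: m).

Definition generated_in_degree (M : lmodType B^c) (M_ : int -> M -> Prop)
    (d : int) : Prop :=
  forall x, sums (fun y => exists m (b : B^c), M_ d m /\ y = b *: m) x.

Definition mod_positive (M : lmodType B^c) : M -> Prop :=
  sums (fun y => exists m (b : B), positive_part b /\ y = (b : B^c) *: m).

(* S, with q, is the quotient of the right module B by its positive part. *)
Definition is_degree0_module (S : lmodType B^c) (q : {linear B^c^o -> S}) : Prop :=
  (forall s, exists b, q b = s) /\ (forall b, q b = 0 <-> positive_part b).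

Definition concentrated0 (S : lmodType B^c) (i : int) (s : S) : Prop :=
  i = 0 \/ s = 0.

End Graded.

Arguments concentrated0 {K B} S.

Definition projective (R : pzRingType) (P : lmodType R) : Prop :=
  forall (M N : lmodType R) (g : {linear M -> N}) (f : {linear P -> N}),
    (forall y, exists x, g x = y) ->
    exists h : {linear P -> M}, forall x, g (h x) = f x.

Record resolution (R : pzRingType) (M : lmodType R) := Resolution {
  res_obj :> nat -> lmodType R;
  res_d : forall n, {linear res_obj n.+1 -> res_obj n};
  res_eps : {linear res_obj 0 -> M};
  res_proj : forall n, projective (res_obj n);
  res_eps_surj : forall y, exists x, res_eps x = y;
  res_exact0 : forall x, res_eps x = 0 <-> exists y, res_d 0 y = x;
  res_exact : forall n x, res_d n x = 0 <-> exists y, res_d n.+1 y = x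
}.

Definition projdim_lt (R : pzRingType) (M : lmodType R) (n : nat) : Prop :=
  exists P : resolution M, forall m, (n <= m)%N -> forall x : P m, x = 0.

(* n is at most the supremum of the projective dimensions of the modules. *)
Definition le_gldim (R : pzRingType) (n : nat) : Prop :=
  exists M : lmodType R, ~ projdim_lt M n.

(* A graded projective module is a graded module whose underlying module is
   projective, hence the resolution P is an ordinary one with extra gradings. *)
Record minimal_graded (K : fieldType) (B : algType K) (gr : nat -> B -> Prop)
    (S : lmodType B^c) (S_ : int -> S -> Prop) (P : resolution S)
    (P_ : forall n, int -> P n -> Prop) : Prop := MinimalGraded {
  mg_graded : forall n, graded_module gr (P_ n);
  mg_d : forall n i x, P_ n.+1 i x -> P_ n i (res_d P n x);
  mg_eps : forall i x, P_ 0 i x -> S_ i (res_eps P x);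
  mg_min : forall n x, mod_positive gr (res_d P n x)
}.

Definition is_finite_product (K : fieldType) (B : algType K)
    (B0 : B -> Prop) : Prop :=
  exists (m : nat) (phi : {linear {ffun 'I_m -> K^o} -> B}),
    [/\ injective phi,
        forall x, B0 x <-> exists f, phi f = x,
        phi [ffun=> 1] = 1
      & forall f g : {ffun 'I_m -> K^o}, phi [ffun i => f i * g i] = phi f * phi g].

Definition koszul (K : fieldType) (B : algType K) (gr : nat -> B -> Prop) : Prop :=
  [/\ graded_algebra gr,
      is_finite_product (gr 0)
    & exists (S : lmodType B^c) (q : {linear B^c^o -> S}) (P : resolution S)
             (P_ : forall n, int -> P n -> Prop),
        [/\ is_degree0_module gr q,
            minimal_graded gr (concentrated0 S) P_
          & forall n, generated_in_degree (P_ n) n%:Z]].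

Section ExtAlgebra.
Variables (K : fieldType) (B : algType K) (S : lmodType B^c) (P : resolution S).

Definition cocycle (n : nat) (f : {linear P n -> S}) : Prop :=
  forall x, f (res_d P n x) = 0.

Definition coboundary (n : nat) : {linear P n -> S} -> Prop :=
  match n return {linear P n -> S} -> Prop with
  | 0 => fun f => forall x, f x = 0
  | n'.+1 => fun f => exists g : {linear P n' -> S}, forall x, f x = g (res_d P n' x)
  end.

Definition chain_lift (n : nat) (f : {linear P n -> S})
    (F : forall i, {linear P (i + n)%N -> P i}) : Prop :=
  (forall x, res_eps P (F 0%N x) = f x) /\
  (forall i x, F i (res_d P (i + n)%N x) = res_d P i (F i.+1 x)).

Variables (E : algType K) (cls : forall n, {linear P n -> S} -> E).

Definition ext_degree (n : nat) (x : E) : Prop :=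
  exists2 f : {linear P n -> S}, cocycle f & x = cls f.

(* E is the Ext algebra of S: for each n the map [cls] from n-cocycles to E
   induces an isomorphism from Ext^n(S, S) = H^n(Hom_B(P, S)) onto [ext_degree n],
   E is the direct sum of these subspaces, and its product is the Yoneda
   product. The scalar c acts on S as c *: 1 in B, and K acts on Hom_B(P n, S)
   through S; the values of [cls] away from cocycles are irrelevant. *)
Record is_ext_algebra : Prop := IsExtAlgebra {
  ext_linear : forall n (c : K) (f g h : {linear P n -> S}),
    cocycle f -> cocycle g ->
    (forall x, h x = ((c *: 1 : B) : B^c) *: f x + g x) ->
    cls h = c *: cls f + cls g;
  ext_kernel : forall n (f : {linear P n -> S}),
    cocycle f -> (cls f = 0 <-> coboundary f);
  ext_direct : direct_sum ext_degree;
  ext_one : cls (res_eps P) = 1;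
  ext_mul : forall m n (g : {linear P m -> S}) (f : {linear P n -> S})
      (F : forall i, {linear P (i + n)%N -> P i}) (gF : {linear P (m + n)%N -> S}),
    cocycle g -> cocycle f -> chain_lift f F ->
    (forall x, gF x = g (F m x)) ->
    cls g * cls f = cls gF
}.

End ExtAlgebra.

Definition hat_grading (K : fieldType) (E : algType K) (E_ : nat -> E -> Prop)
    (n : nat) (x : E) : Prop :=
  match n with
  | 0 => E_ 0%N x
  | 1 => exists x1 x2 x3, [/\ E_ 1%N x1, E_ 2 x2, E_ 3 x3 & x = x1 + x2 + x3]
  | _ => exists x0 x1, [/\ E_ n.*2 x0, E_ n.*2.+1 x1 & x = x0 + x1]
  end.

Definition delta (D A n : nat) : nat :=
  match n with
  | 0 => 0
  | 1 => 1
  | _ => if odd n then (n./2 * D + A)%N else (n./2 * D)%N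
  end.

Definition stacked (K : fieldType) (L : algType K) (S : lmodType L^c)
    (P : resolution S) (P_ : forall n, int -> P n -> Prop) (D A : nat) : Prop :=
  [/\ (2 <= D)%N, (1 <= A)%N
    & forall n, le_gldim L^c n -> generated_in_degree (P_ n) (delta D A n)%:Z].

(* Main.v *)
(* The n-chains of Anick and Bardzell span a resolution of Lambda_0 over the monomial
   algebra Lambda. Comparing it with the stacked resolution P shows that they all have
   length delta(n), and that the dual cocycles form a basis of E(Lambda), in which the
   product of two elements is given by the concatenation of chains if that is a chain,
   and is 0 otherwise. For n >= 2 the n-chains are exactly the walks of length delta(n)
   whose factors of length D starting at the multiples of A are zero, and A | D if n >= 4.
   As D > 2, A > 1 and D <> 2A, comparing lengths shows that a product of elements of
   positive degree vanishes unless both degrees are at least 2 and not both are odd;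
   moreover an element of degree at least 4 factors uniquely as one of degree 2 times
   another. Hence E(Lambda) is generated by the chains of degree 1, 2 and 3, of hat-degree
   1, subject to quadratic relations only: zero products, and t r = r' t' with r, r' of
   degree 2 and t, t' of degree 3. Oriented from t r to r' t', these relations are a
   quadratic Groebner basis, so that the Anick resolution over E(Lambda) is linear. *)

Require Import Defs.
From HB Require Import structures.
From mathcomp Require Import all_boot all_order all_algebra finmap.
From mathcomp.multinomials Require Import monalg.
From mathcomp Require Import boolp zify.

Set Implicit Arguments.
Unset Strict Implicit.
Unset Printing Implicit Defensive.

Import GRing.Theory.

Local Open Scope ring_scope.

(** * Comparison of projective resolutions *)

(** One construction serves both algebras: the Anick resolution is built for any algebra with a
    basis closed under products up to 0. It is used for Lambda with the nonzero paths as letters,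
    and for the Ext algebra with the chains of degree at most 3. Instead of a term order,
    [anick_data] asks that corrections never meet and that the correction of a normal form be
    normal, so that reduction stops after one step. The given resolution [P] is compared with the
    chain resolution [X] by chain maps in both directions, without an isomorphism. Minimality enters
    through one fact: an endomorphism of [X] lifting the identity is the identity modulo the
    radical. It keeps the degrees of all chains within the global dimension, fixes their lengths,
    and makes their duals a basis of Ext. After that only lengths matter: whenever a configuration
    of zero factors yields a chain, its length is known, and this locates the zero factors. The
    excluded values [D = 2], [A = 1] and [D = 2 * A] are those at which the lengths of the factors
    of an unwanted product would add up. *)

Lemma dependent_choice (A : nat -> Type) (inv : forall n, A n -> Prop)
    (step : forall n, A n -> A n.+1 -> Prop) :
  (exists a, inv 0 a) ->
  (forall n a, inv n a -> exists2 b, step n a b & inv n.+1 b) ->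
  exists f : forall n, A n, (forall n, inv n (f n)) /\ forall n, step n (f n) (f n.+1).
Proof.
move=> /cid[a0 i0] st.
have st' n (a : {a | inv n a}) : {b : {b | inv n.+1 b} | step n (sval a) (sval b)}.
  by have /cid2[b sb ib] := st n _ (svalP a); exists (exist _ b ib).
pose g := nat_rect (fun n => {a | inv n a}) (exist _ a0 i0) (fun n a => sval (st' n a)).
exists (fun n => sval (g n)); split=> n; first exact: svalP (g n).
exact: (svalP (st' n (g n))).
Qed.

Definition mk_linear (R : pzRingType) (M N : lmodType R) (f : M -> N)
    (fl : linear f) : {linear M -> N} :=
  HB.pack f (GRing.isLinear.Build R M N *:%R f fl).

Section Kernel.
Variables (R : pzRingType) (M N : lmodType R) (h : {linear M -> N}).

Record kernel := Kernel { kval : M; kvalP : h kval == 0 }.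
HB.instance Definition _ := [isSub for kval].
HB.instance Definition _ := [Choice of kernel by <:].

Fact kernel_submod : submod_closed [pred x | h x == 0].
Proof.
split=> [|a x y]; rewrite !inE ?linear0 // linearP.
by move=> /eqP-> /eqP->; rewrite scaler0 addr0.
Qed.

HB.instance Definition _ :=
  GRing.SubChoice_isSubLmodule.Build R M [pred x | h x == 0] kernel kernel_submod.

End Kernel.

(** Projectivity lifts only along surjections, so [f] and [g] are first corestricted to the kernel
    of [h], onto which exactness makes [g] surjective. *)
Lemma projective_lift (R : pzRingType) (P M N O : lmodType R)
    (g : {linear M -> N}) (h : {linear N -> O}) (f : {linear P -> N}) :
  projective P -> (forall y, h y = 0 <-> exists x, g x = y) ->
  (forall x, h (f x) = 0) -> exists k : {linear P -> M}, forall x, g (k x) = f x.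
Proof.
move=> pP ex hf.
have hg x : h (g x) == 0 by apply/eqP/ex; exists x.
have hf' x : h (f x) == 0 by apply/eqP.
have lg : linear (fun x => Kernel (hg x)).
  by move=> a x y; apply: val_inj; exact: (linearP g).
have lf : linear (fun x => Kernel (hf' x)).
  by move=> a x y; apply: val_inj; exact: (linearP f).
have [|k kE] := pP _ _ (mk_linear lg) (mk_linear lf).
  move=> y; have [x gx] := (ex (val y)).1 (eqP (kvalP y)).
  by exists x; apply: val_inj.
by exists k => x; have := congr1 val (kE x).
Qed.

Section Comparison.
Variables (R : pzRingType) (M : lmodType R).

Definition res_cycle (P : resolution M) (n : nat) : P n -> Prop :=
  match n return P n -> Prop with
  | 0 => fun y => res_eps P y = 0
  | n'.+1 => fun y => res_d P n' y = 0
  end.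

Lemma res_cycleP (P : resolution M) n (y : P n) :
  res_cycle y <-> exists x, res_d P n x = y.
Proof. case: n y => [|n] y; [exact: res_exact0 | exact: res_exact]. Qed.

Lemma res_cycle_d (P : resolution M) n (x : P n.+1) : res_cycle (res_d P n x).
Proof. by apply/res_cycleP; exists x. Qed.

Lemma res_dd (P : resolution M) n (x : P n.+2) : res_d P n (res_d P n.+1 x) = 0.
Proof. exact: (res_cycle_d x). Qed.

Lemma resolution_lift (X : lmodType R) (P : resolution M) n (f : {linear X -> P n}) :
  projective X -> (forall x, res_cycle (f x)) ->
  exists k : {linear X -> P n.+1}, forall x, res_d P n (k x) = f x.
Proof.
case: n f => [|n] f pX fc.
  by apply: (@projective_lift _ _ _ _ _ _ (res_eps P)) => // y; apply: res_exact0.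
by apply: (@projective_lift _ _ _ _ _ _ (res_d P n)) => // y; apply: res_exact.
Qed.

Lemma comparison_map (P P' : resolution M) :
  exists f : forall n, {linear P n -> P' n},
    (forall x, res_eps P' (f 0 x) = res_eps P x) /\
    (forall n x, res_d P' n (f n.+1 x) = f n (res_d P n x)).
Proof.
have [f0 f0E] := @res_proj _ _ P 0 _ _ _ (res_eps P) (@res_eps_surj _ _ P').
(* The invariant carries the cycle condition that the next lift requires, together with the
   augmentation equation, which concerns degree 0 alone. *)
pose inv n (f : {linear P n -> P' n}) :=
  (forall x, res_cycle (f (res_d P n x))) /\
  match n return (P n -> P' n) -> Prop with
  | 0 => fun f => forall x, res_eps P' (f x) = res_eps P x
  | _ => fun _ => True
  end f.
have [||f [fi fE]] := @dependent_choice _ inv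
  (fun n f g => forall x, res_d P' n (g x) = f (res_d P n x)).
- by exists f0; split=> // x /=; rewrite f0E (res_cycle_d x).
- move=> n f [fc _].
  have [g gE] := @resolution_lift _ P' n (f \o res_d P n) (@res_proj _ _ P n.+1) fc.
  exists g => //; split=> // x /=; by rewrite gE /= res_dd linear0.
by exists f; split=> [|n x]; [exact: (fi 0).2 | exact: fE].
Qed.

Lemma null_homotopy (P P' : resolution M) (f : forall n, {linear P n -> P' n}) :
  (forall x, res_eps P' (f 0 x) = 0) ->
  (forall n x, res_d P' n (f n.+1 x) = f n (res_d P n x)) ->
  exists h : forall n, {linear P n -> P' n.+1},
    (forall x, res_d P' 0 (h 0 x) = f 0 x) /\
    (forall n x, res_d P' n.+1 (h n.+1 x) = f n.+1 x - h n (res_d P n x)).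
Proof.
move=> fe fd.
have [h0 h0E] := @resolution_lift _ P' 0 (f 0) (@res_proj _ _ P 0) fe.
pose inv n (h : {linear P n -> P' n.+1}) :=
  (forall x, res_d P' n (h (res_d P n x)) = f n (res_d P n x)) /\
  match n return (P n -> P' n.+1) -> Prop with
  | 0 => fun h => forall x, res_d P' 0 (h x) = f 0 x
  | _ => fun _ => True
  end h.
have [||h [hi hE]] := @dependent_choice _ inv
  (fun n h k => forall x, res_d P' n.+1 (k x) = f n.+1 x - h (res_d P n x)).
- by exists h0.
- move=> n h [hd _]; pose g : {linear P n.+1 -> P' n.+1} := f n.+1 \- (h \o res_d P n).
  have [x|k kE] := @resolution_lift _ P' n.+1 g (@res_proj _ _ P n.+1).
    by apply/eqP; rewrite linearB /= fd hd subrr.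
  exists k => //; split=> // x; by rewrite kE /= res_dd linear0 subr0.
by exists h; split=> [|n x]; [exact: (hi 0).2 | exact: hE].
Qed.

End Comparison.

(** * The Anick resolution *)

(* Right modules over B are left modules over B^c. *)
Notation "m '<|' b" := ((b : (_)^c) *: m) (at level 40, left associativity, only parsing).

(** Common interface for the nonzero paths of Lambda and the chains of its Ext algebra; [T] may be
    infinite, because the Ext algebra can be infinite-dimensional. By [bmul_eq_triv] the nontrivial
    basis elements span a two-sided ideal. *)
Record path_basis (K : fieldType) (B : algType K) (V : finType) (T : choiceType) :=
  PathBasis {
  bas :> T -> B;
  btriv : V -> T;
  bsrc : T -> V;
  btgt : T -> V;
  bmul : T -> T -> option T;
  bcoef : T -> {scalar B};
  bsrc_triv : forall v, bsrc (btriv v) = v;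
  btgt_triv : forall v, btgt (btriv v) = v;
  bmul_trivl : forall v x, bmul (btriv v) x = if v == bsrc x then Some x else None;
  bmul_trivr : forall x v, bmul x (btriv v) = if btgt x == v then Some x else None;
  bmul_comp : forall x y z, bmul x y = Some z ->
    [/\ btgt x = bsrc y, bsrc z = bsrc x & btgt z = btgt y];
  bmul_eq_triv : forall x y v, bmul x y = Some (btriv v) ->
    x = btriv v /\ y = btriv v;
  basM : forall x y, bas x * bas y = oapp bas 0 (bmul x y);
  bas_sum : \sum_v bas (btriv v) = 1;
  bcoef_bas : forall x y, bcoef x (bas y) = (x == y)%:R;
  bas_span : forall z, exists s : seq T, z = \sum_(x <- s) bcoef x z *: bas x
}.

Section PathBasisTheory.
Variables (K : fieldType) (B : algType K) (V : finType) (T : choiceType).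
Variable b : path_basis B V T.

Lemma bas_ind (Q : B -> Prop) :
  Q 0 -> (forall y z, Q y -> Q z -> Q (y + z)) ->
  (forall (c : K) x, Q (c *: b x)) -> forall z, Q z.
Proof.
move=> Q0 QD QZ z; have [s ->] := bas_span b z.
by elim/big_ind: _ => // x _; apply: QZ.
Qed.

Lemma bas_eq0 (z : B) : (forall x, bcoef b x z = 0) -> z = 0.
Proof.
move=> z0; have [s ->] := bas_span b z.
by rewrite big1 // => x _; rewrite z0 scale0r.
Qed.

Lemma bas_neq0 x : b x != 0.
Proof.
apply/eqP => /(congr1 (bcoef b x)); rewrite bcoef_bas eqxx linear0 => /eqP.
by rewrite [_ == 0]oner_eq0.
Qed.

Lemma bas_inj : injective b.
Proof.
move=> x y /(congr1 (bcoef b x)); rewrite !bcoef_bas eqxx.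
by case: (x =P y) => // _ /eqP; rewrite [_ == 0]oner_eq0.
Qed.

Lemma mul_triv_bas v x : b (btriv b v) * b x = if v == bsrc b x then b x else 0.
Proof. by rewrite basM bmul_trivl; case: ifP. Qed.

Lemma mul_bas_triv v x : b x * b (btriv b v) = if btgt b x == v then b x else 0.
Proof. by rewrite basM bmul_trivr; case: ifP. Qed.

Lemma triv_idem v : b (btriv b v) * b (btriv b v) = b (btriv b v).
Proof. by rewrite mul_triv_bas bsrc_triv eqxx. Qed.

Lemma bcoef_triv_mul v x z :
  bcoef b x (b (btriv b v) * z) = if v == bsrc b x then bcoef b x z else 0.
Proof.
elim/bas_ind: z => [|y z IHy IHz|c y].
- by rewrite mulr0 !linear0 if_same.
- by rewrite mulrDr !linearD IHy IHz; case: ifP => //; rewrite addr0.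
rewrite -scalerAr mul_triv_bas (fun_if (fun w => bcoef b x (c *: w))) scaler0 linear0.
rewrite !linearZ_LR bcoef_bas; case: (x =P y) => [->|_] //.
by rewrite mulr0 !if_same.
Qed.

(** An idempotent arises as a product of basis elements only as its own square, so its coordinate is
    multiplicative. These characters detect the radical below. *)
Lemma bcoef_trivM v (y z : B) :
  bcoef b (btriv b v) (y * z) = bcoef b (btriv b v) y * bcoef b (btriv b v) z.
Proof.
elim/bas_ind: y => [|y y' IHy IHy'|c y].
- by rewrite mul0r linear0 mul0r.
- by rewrite mulrDl !linearD /= mulrDl IHy IHy'.
rewrite -scalerAl !linearZ /= -mulrA; congr (_ * _).
elim/bas_ind: z => [|z z' IHz IHz'|d z].
- by rewrite mulr0 linear0 mulr0.
- by rewrite mulrDr !linearD /= mulrDr IHz IHz'.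
rewrite -scalerAr !linearZ /= mulrCA; congr (_ * _).
rewrite basM !bcoef_bas; case: (btriv b v =P y) => [<-|vy]; last first.
  rewrite mul0r; case E: bmul => [x|] /=; last by rewrite linear0.
  rewrite bcoef_bas; case: eqP => // vx; rewrite -vx in E.
  by case: (bmul_eq_triv E) => /esym.
rewrite mul1r bmul_trivl; case: ifP => [_|] /=; first exact: bcoef_bas.
by move=> nv; rewrite linear0; case: eqP => // vz; rewrite -vz bsrc_triv eqxx in nv.
Qed.

Lemma btriv_inj : injective (btriv b).
Proof. by move=> v w /(congr1 (bsrc b)); rewrite !bsrc_triv. Qed.

End PathBasisTheory.

(* The words of the Anick resolution are those in which each letter [follow]s the
   previous one. With u the last letter of w, its differential is
   d[w y] = [w] y, corrected by - [w' u1] y1 if w = w' u and [corr u y = Some (u1, y1)],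
   in which case u y = u1 y1 in the algebra. For a basis element x, either [w] x is in
   normal form modulo boundaries, when [~~ extends u x], or x = y x' and [w] x is, up to
   normal forms, the boundary of [w y] x'. *)
Record anick_data (K : fieldType) (B : algType K) (V : finType) (T : choiceType)
    (b : path_basis B V T) := AnickData {
  ltr : finType;
  lval : ltr -> T;
  lstart : V -> ltr;
  follow : rel ltr;
  corr : ltr -> ltr -> option (ltr * ltr);
  extends : ltr -> T -> bool;
  lstartE : forall v, lval (lstart v) = btriv b v;
  follow_comp : forall u y, follow u y -> btgt b (lval u) = bsrc b (lval y);
  follow_triv : forall u y v, follow u y -> lval y <> btriv b v;
  corr_start : forall v y, corr (lstart v) y = None;
  follow_mul : forall x u y, follow x u -> follow u y -> corr u y = None ->
    bmul b (lval u) (lval y) = None;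
  corrP : forall x u y u1 y1, follow x u -> follow u y -> corr u y = Some (u1, y1) ->
    [/\ follow x u1, bmul b (lval u1) (lval y1) = bmul b (lval u) (lval y),
      bmul b (lval u) (lval y) <> None
      & forall x2 u2, corr x u1 = Some (x2, u2) -> bmul b (lval u2) (lval y1) = None];
  corr_triv : forall u y u1 y1 v, follow u y -> corr u y = Some (u1, y1) ->
    lval y1 <> btriv b v;
  corr_corr : forall x u y x1 u1, follow x u -> follow u y -> corr x u = Some (x1, u1) ->
    corr u y = None /\ bmul b (lval u1) (lval y) = None;
  extends_ex : forall u x, btgt b (lval u) = bsrc b x -> extends u x ->
    exists y x', [/\ follow u y, bmul b (lval y) x' = Some x & ~~ extends y x'];
  extends_mul : forall u y x', follow u y -> btgt b (lval y) = bsrc b x' ->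
    ~~ extends y x' -> exists2 x, bmul b (lval y) x' = Some x & extends u x;
  extends_inj : forall u y x y1 x1 z, follow u y -> follow u y1 ->
    ~~ extends y x -> ~~ extends y1 x1 ->
    bmul b (lval y) x = Some z -> bmul b (lval y1) x1 = Some z -> y = y1 /\ x = x1;
  extends_corr : forall u y u1 y1 x z, follow u y -> corr u y = Some (u1, y1) ->
    btgt b (lval y) = bsrc b x ->
    ~~ extends y x -> bmul b (lval y1) x = Some z -> ~~ extends u1 z;
  extends_start : forall x, ~~ extends (lstart (bsrc b x)) x -> x = btriv b (bsrc b x)
}.

Section AnickResolution.
Variables (K : fieldType) (B : algType K) (V : finType) (T : choiceType).
Variables (b : path_basis B V T) (a : anick_data b).

Local Notation Y := (ltr a).
Local Notation st := (lstart a).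
Local Notation e v := (b (btriv b v)).

(** A word of length 0 is a vertex, which is why the vertex is stored; the letter [st v] precedes
    the tuple and is not counted in [n]. *)
Definition word n := {p : V * n.-tuple Y | path (@follow _ _ _ _ _ a) (st p.1) p.2}.
Definition wlast n (w : word n) : Y := last (st (val w).1) (val w).2.
Definition wend n (w : word n) : V := btgt b (lval (wlast w)).

(** The direct sum over the words [w] of the right ideals [e (wend w) * B], that is, the span of the
    words tensored with [B] over the subalgebra of the vertices. It is a direct summand of a free
    module. *)
Record anick_mod n := AnickMod {
  amval : {ffun word n -> B^c^o};
  amvalP : [forall w, e (wend w) * (amval w : B) == amval w]
}.
HB.instance Definition _ n := [isSub for @amval n].
HB.instance Definition _ n := [Choice of anick_mod n by <:].

Fact anick_submod n :
  submod_closed [pred f : {ffun word n -> B^c^o} |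
                 [forall w, e (wend w) * (f w : B) == f w]].
Proof.
split=> [|c f g]; rewrite !inE.
  by apply/forallP => w; rewrite !ffunE mulr0.
move=> /forallP fP /forallP gP; apply/forallP => w; rewrite !ffunE.
by rewrite mulrDr (eqP (gP w)) [_ *: _]/( _ * _) /= mulrA (eqP (fP w)).
Qed.

HB.instance Definition _ n :=
  GRing.SubChoice_isSubLmodule.Build B^c {ffun word n -> B^c^o} _ (anick_mod n)
    (@anick_submod n).

Definition amfun n (f : anick_mod n) (w : word n) : B := amval f w.

Lemma amfunD n (f g : anick_mod n) w : amfun (f + g) w = amfun f w + amfun g w.
Proof. exact: (ffunE (fun x => amval f x + amval g x)). Qed.

Lemma amfunN n (f : anick_mod n) w : amfun (- f) w = - amfun f w.
Proof. exact: (ffunE (fun x => - amval f x)). Qed.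

Lemma amfun0 n w : amfun (0 : anick_mod n) w = 0.
Proof. exact: (ffunE (fun x => 0)). Qed.

Lemma amfun_sum n (I : Type) (r : seq I) (F : I -> anick_mod n) w :
  amfun (\sum_(i <- r) F i) w = \sum_(i <- r) amfun (F i) w.
Proof.
exact: (big_morph (fun f => amfun f w) (fun f g => amfunD f g w) (amfun0 w)).
Qed.

Lemma amfun_act n (f : anick_mod n) (c : B) w : amfun (f <| c) w = amfun f w * c.
Proof. exact: (ffunE (fun x => (c : B^c^o) *: amval f x)). Qed.

Lemma amfun_end n (f : anick_mod n) w : e (wend w) * amfun f w = amfun f w.
Proof. exact/eqP/(forallP (amvalP f)). Qed.

Lemma amfunP n (f g : anick_mod n) : (forall w, amfun f w = amfun g w) -> f = g.
Proof. by move=> fg; apply/val_inj/ffunP. Qed.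

End AnickResolution.

Lemma actA (K : fieldType) (B : algType K) (M : lmodType B^c) (m : M) (x y : B) :
  (m <| x) <| y = m <| (x * y).
Proof. by rewrite scalerA. Qed.

Section AnickComplex.
Variables (K : fieldType) (B : algType K) (V : finType) (T : choiceType).
Variables (b : path_basis B V T) (a : anick_data b).

Local Notation Y := (ltr a).
Local Notation st := (lstart a).
Local Notation e v := (b (btriv b v)).
Local Notation fol := (@follow _ _ _ _ _ a).
Local Notation P := (anick_mod a).
Local Notation wd := (word a).

Definition amlin n (M : lmodType B^c) (G : wd n -> M) (f : P n) : M :=
  \sum_w G w <| amfun f w.

Fact amlin_linear n (M : lmodType B^c) (G : wd n -> M) : linear (amlin G).
Proof.
move=> c f g; rewrite /amlin scaler_sumr -big_split; apply: eq_bigr => w _ /=.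
by rewrite amfunD amfun_act scalerDl -actA.
Qed.

HB.instance Definition _ n (M : lmodType B^c) (G : wd n -> M) :=
  GRing.isLinear.Build B^c (P n) M *:%R (amlin G) (amlin_linear G).

Fact gen_subproof n (w : wd n) :
  [forall w', e (wend w') *
     ([ffun w' => if w' == w then e (wend w) else 0] : {ffun wd n -> B^c^o}) w' ==
     ([ffun w' => if w' == w then e (wend w) else 0] : {ffun wd n -> B^c^o}) w' :> B].
Proof.
apply/forallP => w'; rewrite !ffunE; case: (w' =P w) => [->|_]; last by rewrite mulr0.
by rewrite triv_idem eqxx.
Qed.

Definition gen n (w : wd n) : P n := AnickMod (gen_subproof w).

Lemma amfun_gen n (w w' : wd n) :
  amfun (gen w) w' = if w' == w then e (wend w) else 0.
Proof. exact: ffunE. Qed.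

Lemma gen_end n (w : wd n) : gen w <| e (wend w) = gen w.
Proof.
apply: amfunP => w'; rewrite amfun_act amfun_gen.
by case: eqP => [_|]; rewrite ?triv_idem ?mul0r.
Qed.

Lemma am_decomp n (f : P n) : f = \sum_w gen w <| amfun f w.
Proof.
apply: amfunP => w; rewrite amfun_sum (bigD1 w) //= big1 => [|w' ww'].
  by rewrite addr0 amfun_act amfun_gen eqxx amfun_end.
by rewrite amfun_act amfun_gen eq_sym (negPf ww') mul0r.
Qed.

Lemma amlin_act n (M : lmodType B^c) (G : wd n -> M) f x :
  amlin G (f <| x) = amlin G f <| x.
Proof. exact: linearZ_LR. Qed.

Lemma amlin_gen n (M : lmodType B^c) (G : wd n -> M) w :
  amlin G (gen w) = G w <| e (wend w).
Proof.
rewrite /amlin (bigD1 w) //= big1 => [|w' ww'].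
  by rewrite addr0 amfun_gen eqxx.
by rewrite amfun_gen (negPf ww') [LHS]scale0r.
Qed.

Lemma am_ext n (M : lmodType B^c) (f g : {linear P n -> M}) :
  (forall w, f (gen w) = g (gen w)) -> forall x, f x = g x.
Proof.
move=> fg x; rewrite (am_decomp x) !linear_sum; apply: eq_bigr => w _.
by rewrite !linearZ_LR fg.
Qed.

Lemma am_projective n : projective (P n).
Proof.
move=> M N g f gs; pose G w := sval (cid (gs (f (gen w)))).
exists (amlin G) => x; apply: (am_ext (f := g \o amlin G)) => w /=.
by rewrite amlin_gen linearZ_LR (svalP (cid (gs (f (gen w))))) -linearZ_LR gen_end.
Qed.

Definition mkword n (v : V) (s : seq Y) : option (wd n) :=
  obind (fun t : n.-tuple Y => insub (v, t)) (insub s).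

Lemma mkwordP n v s : size s = n -> path fol (st v) s ->
  exists2 w : wd n, mkword n v s = Some w & (val w).1 = v /\ tval (val w).2 = s.
Proof.
move=> sn ps; rewrite /mkword; case: insubP => [t _ tE|]; last by rewrite sn eqxx.
rewrite /=; case: insubP => [w _ wE|]; last by rewrite /= tE ps.
by exists w; rewrite // wE.
Qed.

Lemma mkwordE n (w : wd n) : mkword n (val w).1 (val w).2 = Some w.
Proof.
have [w' wE] := mkwordP (size_tuple (val w).2) (valP w); rewrite {}wE => -[v' s'].
congr Some; apply: val_inj; rewrite [LHS]surjective_pairing [RHS]surjective_pairing.
by congr pair => //; apply: val_inj.
Qed.

(** The value 0 on lists that are not words makes this total, so that letters can be replaced in
    [dseq] without carrying proofs. *)
Definition gens n v s : P n := oapp (@gen n) 0 (mkword n v s).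

(* [take n.-1 s] is [s] without its last letter, which [corr] replaces by [u1]. *)
Definition dseq n v s (y : Y) : P n :=
  gens n v s <| b (lval y) -
  (if corr (last (st v) s) y is Some (u1, y1)
   then gens n v (rcons (take n.-1 s) u1) <| b (lval y1) else 0).

Definition dgen n (w : wd n.+1) : P n :=
  let: (v, s) := val w in dseq n v (take n s) (last (st v) s).

Definition amd n : P n.+1 -> P n := amlin (@dgen n).
HB.instance Definition _ n := GRing.Linear.on (@amd n).

Lemma gens_end n v s : size s = n -> path fol (st v) s ->
  gens n v s <| e (btgt b (lval (last (st v) s))) = gens n v s.
Proof.
move=> sn ps; have [w wE [v' s']] := mkwordP sn ps.
by rewrite /gens wE /= -[in RHS]gen_end /wend /wlast v' s'.
Qed.

Lemma amd_gens n v s y z : size s = n -> path fol (st v) (rcons s y) ->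
  amd (gens n.+1 v (rcons s y) <| b z) =
  if btgt b (lval y) == bsrc b z then dseq n v s y <| b z else 0.
Proof.
move=> sn ps; have [|w wE [v' s']] := @mkwordP n.+1 v (rcons s y) _ ps.
  by rewrite size_rcons sn.
rewrite linearZ_LR /gens wE /= [amd _]amlin_gen actA.
have -> : wend w = btgt b (lval y) by rewrite /wend /wlast v' s' last_rcons.
rewrite mul_triv_bas; case: ifP => _; last by rewrite [LHS]scale0r.
rewrite /dgen; case: (val w) v' s' => /= v0 [t tn] /= -> ->.
by rewrite last_rcons -cats1 take_size_cat.
Qed.

Lemma word_ind n (Q : wd n -> Prop) :
  (forall v s w, size s = n -> path fol (st v) s -> mkword n v s = Some w -> Q w) ->
  forall w, Q w.
Proof.
move=> H w; apply: (H (val w).1 (val w).2); rewrite ?size_tuple ?mkwordE //.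
exact: (valP w).
Qed.

(** Corrections never overlap. If [u y] is corrected to [u1 y1], the two leading terms cancel and
    the correction of [x u1] is killed by [y1]. Otherwise [u y] is 0, and the correction of [x u] is
    killed by [y]. *)
Lemma amd_amd n (f : P n.+2) : amd (amd f) = 0.
Proof.
apply: (am_ext (f := (@amd n) \o (@amd n.+1)) (g := \0)) => w /=.
elim/word_ind: w => v s w sn ps wE.
have -> : gen w = gens n.+2 v s by rewrite /gens wE.
case/lastP: s sn ps wE => // s y; rewrite size_rcons => -[sn] ps wE.
case/lastP: s sn ps wE => // s u; rewrite size_rcons => -[sn] ps wE.
have su : size (rcons s u) = n.+1 by rewrite size_rcons sn.
have ps' : path fol (st v) (rcons s u) by move: ps; rewrite rcons_path => /andP[].
have fuy : follow u y by move: ps; rewrite rcons_path last_rcons => /andP[].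
have ps0 : path fol (st v) s by move: ps'; rewrite rcons_path => /andP[].
set x := last (st v) s.
have fxu : follow x u by move: ps'; rewrite rcons_path => /andP[].
have syE : size (rcons (rcons s u) y) = n.+2 by rewrite size_rcons su.
rewrite -(gens_end syE ps) last_rcons amd_gens // bsrc_triv eqxx linearZ_LR.
rewrite {1}/dseq last_rcons.
have -> : take n.+1.-1 (rcons s u) = s by rewrite -cats1 take_size_cat.
rewrite linearB /= amd_gens // (follow_comp fuy) eqxx.
have bm0 t t' : bmul b t t' = None -> b t * b t' = 0 by rewrite basM => ->.
have actB (m m' : P n) (c : B) : (m - m') <| c = m <| c - m' <| c by exact: scalerBr.
case E: corr => [[u1 y1]|].
  have [fxu1 mE mN x2N] := corrP fxu fuy E.
  have ps1 : path fol (st v) (rcons s u1) by rewrite rcons_path ps0.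
  have cuy : btgt b (lval u1) = bsrc b (lval y1).
    by case zE: bmul mE mN => [z|] <- // _; have [] := bmul_comp zE.
  rewrite amd_gens // cuy eqxx /dseq -/x.
  case E1: (corr x u) => [[x1 u2]|].
    by have := corr_corr fxu fuy E1; rewrite E => -[].
  have key : b (lval u1) * b (lval y1) = b (lval u) * b (lval y) by rewrite !basM mE.
  rewrite subr0 !actB !actA [b (lval u1) * _]mulrA key -mulrA.
  case E2: (corr x u1) => [[x2 u2]|]; last by rewrite [X in _ - (_ - X)]scaler0 subr0 subrr.
  by rewrite actA [b (lval u2) * _]mulrA (bm0 _ _ (x2N _ _ E2)) mul0r [X in _ - (_ - X)]scale0r subr0 subrr.
rewrite linear0 subr0 /dseq -/x !actB !actA [b (lval u) * _]mulrA (bm0 _ _ (follow_mul fxu fuy E)) mul0r [X in X - _]scale0r.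
case E1: (corr x u) => [[x1 u1]|]; last by rewrite [X in _ - X]scaler0 subr0.
by have [_ mN] := corr_corr fxu fuy E1; rewrite actA mulrA (bm0 _ _ mN) mul0r [X in _ - X]scale0r subr0.
Qed.

End AnickComplex.

(** * Exactness by normal forms modulo boundaries *)

Section AnickExactness.
Variables (K : fieldType) (B : algType K) (V : finType) (T : choiceType).
Variables (b : path_basis B V T) (a : anick_data b).

Local Notation Y := (ltr a).
Local Notation st := (lstart a).
Local Notation e v := (b (btriv b v)).
Local Notation fol := (@follow _ _ _ _ _ a).
Local Notation P := (anick_mod a).
Local Notation wd := (word a).

Definition amcoef n (w : wd n) (x : T) (f : P n) : K := bcoef b x (amfun f w).

Lemma amcoefD n (w : wd n) x f g : amcoef w x (f + g) = amcoef w x f + amcoef w x g.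
Proof. by rewrite /amcoef amfunD linearD. Qed.

Lemma amcoefB n (w : wd n) x f g : amcoef w x (f - g) = amcoef w x f - amcoef w x g.
Proof. by rewrite /amcoef amfunD amfunN linearB. Qed.

Lemma amcoef0 n (w : wd n) x : amcoef w x (0 : P n) = 0.
Proof. by rewrite /amcoef amfun0 linear0. Qed.

Lemma amcoef_scale n (w : wd n) x f (c : K) : amcoef w x (f <| c%:A) = c * amcoef w x f.
Proof. by rewrite /amcoef amfun_act mulr_algr linearZ. Qed.

Lemma amcoef_eq0 n (f : P n) : (forall w x, amcoef w x f = 0) -> f = 0.
Proof.
move=> f0; apply: amfunP => w; rewrite amfun0; apply: (bas_eq0 (b := b)) => x.
exact: f0.
Qed.

Lemma amcoef_end n (w : wd n) x f : wend w <> bsrc b x -> amcoef w x f = 0.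
Proof.
by move=> wx; rewrite /amcoef -amfun_end bcoef_triv_mul; case: eqP.
Qed.

Lemma amcoef_gen n (w w' : wd n) x z :
  amcoef w' x (gen w <| b z) = ((w' == w) && (x == z) && (wend w == bsrc b z))%:R.
Proof.
rewrite /amcoef amfun_act amfun_gen; case: (w' =P w) => _ /=; last by rewrite mul0r linear0.
rewrite mul_triv_bas; case: ifP => _; rewrite ?andbT ?andbF ?linear0 //.
exact: bcoef_bas.
Qed.

(** The normal forms. They are a complement of the boundaries: both together span by [flat_reduce],
    and a flat cycle is 0 by [flat_inj] and [flat_inj0]. *)
Definition flat n (f : P n) : Prop :=
  forall w x, extends (wlast w) x -> amcoef w x f = 0.

Lemma flat0 n : flat (0 : P n).
Proof. by move=> w x _; rewrite amcoef0. Qed.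

Lemma flatD n (f g : P n) : flat f -> flat g -> flat (f + g).
Proof. by move=> f0 g0 w x wx; rewrite amcoefD f0 // g0 // addr0. Qed.

Lemma flat_gen n (w : wd n) z : ~~ extends (wlast w) z -> flat (gen w <| b z).
Proof.
move=> wz w' x wx; rewrite amcoef_gen; case: (w' =P w) => //= ww.
by case: (x =P z) => //= xz; rewrite -ww -xz wx in wz.
Qed.

Lemma gensP n v s : size s = n -> path fol (st v) s ->
  exists w : wd n, [/\ gens n v s = gen w, (val w).1 = v, (val w).2 = s :> seq _
                     & wlast w = last (st v) s].
Proof.
move=> sn ps; have [w wE [v' s']] := mkwordP sn ps.
by exists w; rewrite /gens wE /wlast v' s'.
Qed.

(** Here [extends_corr] enters: the correction term in the boundary of [[s y] x] is already in
    normal form when [[s y] x] is. *)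
Lemma flat_corr n v s y x : size s = n -> path fol (st v) (rcons s y) ->
  btgt b (lval y) = bsrc b x -> ~~ extends y x ->
  flat ((if corr (last (st v) s) y is Some (u1, y1)
         then gens n v (rcons (take n.-1 s) u1) <| b (lval y1) else 0) <| b x).
Proof.
move=> sn ps yx eyx; case E: corr => [[u1 y1]|]; last by rewrite [_ *: _]scaler0; apply: flat0.
case/lastP: s sn ps E => [|s u] sn ps E; first by rewrite /= corr_start in E.
rewrite last_rcons in E; rewrite actA basM.
have : path fol (st v) (rcons s u) by move: ps; rewrite rcons_path => /andP[].
have uy : follow u y by move: ps; rewrite rcons_path last_rcons => /andP[].
rewrite rcons_path => /andP[ps0 xu].
have [xu1 _ _ _] := corrP xu uy E.
case zE: bmul => [z|]; last by rewrite [_ *: _]scale0r; apply: flat0.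
have sn' : size s = n.-1 by rewrite -sn size_rcons.
have -> : take n.-1 (rcons s u) = s by rewrite -cats1 -sn' take_size_cat.
have [||w [-> _ _ wl]] := @gensP n v (rcons s u1).
- by rewrite size_rcons -sn size_rcons.
- by rewrite rcons_path ps0.
by apply: flat_gen; rewrite wl last_rcons; apply: extends_corr uy E yx eyx zE.
Qed.

Lemma amd_gens_bas n v s y x : size s = n -> path fol (st v) (rcons s y) ->
  btgt b (lval y) = bsrc b x ->
  amd (gens n.+1 v (rcons s y) <| b x) = gens n v s <| (b (lval y) * b x) -
    (if corr (last (st v) s) y is Some (u1, y1)
     then gens n v (rcons (take n.-1 s) u1) <| b (lval y1) else 0) <| b x.
Proof.
by move=> sn ps yx; rewrite amd_gens // yx eqxx [LHS]scalerBr actA.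
Qed.

Lemma word_split n (w : wd n.+1) : exists (w0 : wd n) (y : Y),
  [/\ (val w).1 = (val w0).1, (val w).2 = rcons (val w0).2 y :> seq _,
      follow (wlast w0) y, wlast w = y
    & amd (gen w) = gen w0 <| b (lval y) -
        (if corr (wlast w0) y is Some (u1, y1)
         then gens n (val w0).1 (rcons (take n.-1 (val w0).2) u1) <| b (lval y1) else 0)
        <| e (wend w)].
Proof.
elim/word_ind: w => v s w sn ps wE.
have gE : gen w = gens n.+1 v s by rewrite /gens wE.
have [w1] := mkwordP sn ps; rewrite wE => -[<-] [wv ws] {w1}.
case/lastP: s sn ps wE gE ws => // s y sn ps wE gE ws.
have := sn; rewrite size_rcons => -[sn'].
have [ps0 uy] : path fol (st v) s /\ follow (last (st v) s) y.
  by move: ps; rewrite rcons_path => /andP[].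
have [w0 [g0 v0 s0 l0]] := gensP sn' ps0; exists w0, y; split.
- by rewrite wv v0.
- by rewrite ws s0.
- by rewrite l0.
- by rewrite /wlast ws last_rcons.
rewrite gE -(gens_end sn ps) last_rcons amd_gens_bas ?bsrc_triv // g0 mul_bas_triv eqxx l0 v0 s0.
by rewrite /wend /wlast ws last_rcons.
Qed.

Lemma am_ind n (Q : P n -> Prop) :
  Q 0 -> (forall f g, Q f -> Q g -> Q (f + g)) ->
  (forall w x (c : K), Q ((gen w <| b x) <| c%:A)) -> forall f, Q f.
Proof.
move=> Q0 QD QZ f; rewrite (am_decomp f); elim/big_ind: _ => // w _.
elim/(bas_ind (b := b)): (amfun f w) => [|y z Qy Qz|c x]; first by rewrite [_ *: _]scale0r.
  by rewrite [_ *: _]scalerDl; apply: QD.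
by have := QZ w x c; rewrite actA mulr_algr.
Qed.

(** With [x = y x'], subtracting the boundary of [[w y] x'] from [[w] x] leaves only a correction
    term, which is flat. One step thus replaces a terminating rewriting. *)
Lemma flat_reduce n (f : P n) : exists g : P n.+1, flat (f - amd g).
Proof.
elim/am_ind: f => [|f1 f2 [g1 h1] [g2 h2]|w x c].
- by exists 0; rewrite linear0 subr0; apply: flat0.
- exists (g1 + g2); rewrite linearD opprD addrACA; exact: flatD.
suff [g gP] : exists g : P n.+1, flat ((gen w <| b x) - amd g).
  exists (g <| c%:A); rewrite linearZ_LR -[X in flat X](scalerBr (c%:A : B^c)).
  by move=> w' x' /gP wx; rewrite amcoef_scale wx mulr0.
case: (wend w =P bsrc b x) => [wx|nwx]; last first.
  exists 0; rewrite linear0 subr0 => w' x' _; rewrite amcoef_gen.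
  by rewrite (introF eqP nwx) andbF.
case ewx: (extends (wlast w) x); last first.
  by exists 0; rewrite linear0 subr0; apply: flat_gen; rewrite ewx.
elim/word_ind: w wx ewx => v s w sn ps wE wx ewx.
have gE : gen w = gens n v s by rewrite /gens wE.
have wl : wlast w = last (st v) s.
  by have [w'] := mkwordP sn ps; rewrite wE => -[<-] [v' s']; rewrite /wlast v' s'.
have [y [x' [wy yx eyx]]] := extends_ex wx ewx.
have [yx' _ _] := bmul_comp yx.
have ps' : path fol (st v) (rcons s y) by rewrite rcons_path ps -wl.
exists (gens n.+1 v (rcons s y) <| b x'); rewrite amd_gens_bas // basM yx /= gE.
by rewrite opprD opprK addNKr; apply: flat_corr.
Qed.

(** The leading term [[w] (y x')] determines [[w y] x'] among normal forms, and correction terms,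
    being flat, have no coefficient where [extends] holds. So every coefficient of a flat [f]
    reappears as a coefficient of its boundary. *)
Lemma flat_inj n (f : P n.+1) : flat f -> amd f = 0 -> f = 0.
Proof.
move=> ff fd; apply: amcoef_eq0 => w' x'.
case: (wend w' =P bsrc b x') => [wx|/amcoef_end-> //].
case ewx: (extends (wlast w') x'); first exact: ff.
elim/word_ind: w' wx ewx => v s0 w' sn ps wE wx ewx.
case/lastP: s0 sn ps wE => // s y; rewrite size_rcons => -[sn] ps wE.
have wl : wlast w' = y.
  have [w1] := mkwordP (n := n.+1) (etrans (size_rcons s y) (congr1 S sn)) ps.
  by rewrite wE => -[<-] [v' s']; rewrite /wlast v' s' last_rcons.
rewrite /wend wl in wx; rewrite wl in ewx.
have [ps0 uy] : path fol (st v) s /\ follow (last (st v) s) y.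
  by move: ps; rewrite rcons_path => /andP[].
have [x xE exx] := extends_mul uy wx (negbT ewx).
have [w [gw wv ws wlw]] := gensP sn ps0.
(* [Psi] compares the coefficient of [[w'] x'] in [g] with that of its leading term [[w] x] in the
   boundary. It is additive, so it is enough that it vanish on each term of the flat [f]. *)
pose Psi g := amcoef w x (amd g) - amcoef w' x' g.
have PsiD g1 g2 : Psi (g1 + g2) = Psi g1 + Psi g2.
  by rewrite /Psi linearD !amcoefD opprD addrACA.
have Psi0 : Psi 0 = 0 by rewrite /Psi linear0 !amcoef0 subr0.
suff : Psi f = 0 by rewrite /Psi fd amcoef0 sub0r => /eqP; rewrite oppr_eq0 => /eqP.
rewrite (am_decomp f) (big_morph Psi PsiD Psi0) big1 // => w1 _.
have [r rE] := bas_span b (amfun f w1); rewrite rE.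
rewrite [_ *: _]scaler_suml (big_morph Psi PsiD Psi0) big1 // => x1 _.
have -> : ((bcoef b x1 (amfun f w1) *: b x1 : B) : B^c) *: gen w1 =
          (gen w1 <| b x1) <| (bcoef b x1 (amfun f w1))%:A by rewrite actA mulr_algr.
rewrite /Psi linearZ_LR !amcoef_scale -mulrBr -/(amcoef w1 x1 f).
case ewx1: (extends (wlast w1) x1); first by rewrite ff // mul0r.
case: (wend w1 =P bsrc b x1) => [wx1|/amcoef_end->]; last by rewrite mul0r.
suff -> : amcoef w x (amd (gen w1 <| b x1)) = amcoef w' x' (gen w1 <| b x1).
  by rewrite subrr mulr0.
elim/word_ind: w1 wx1 ewx1 {rE} => v1 s1 w1 sn1 ps1 wE1 wx1 ewx1.
have g1 : gen w1 = gens n.+1 v1 s1 by rewrite /gens wE1.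
have wE1' := mkwordE w1.
case/lastP: s1 sn1 ps1 wE1 g1 => // s1 y1; rewrite size_rcons => -[sn1] ps1 wE1 g1.
have [w2] := mkwordP (n := n.+1) (etrans (size_rcons s1 y1) (congr1 S sn1)) ps1.
rewrite wE1 => -[<-] [v1' s1'].
have wl1 : wlast w1 = y1 by rewrite /wlast v1' s1' last_rcons.
rewrite /wend wl1 in wx1; rewrite wl1 in ewx1.
have [ps01 uy1] : path fol (st v1) s1 /\ follow (last (st v1) s1) y1.
  by move: ps1; rewrite rcons_path => /andP[].
have [z1 zE1 ez1] := extends_mul uy1 wx1 (negbT ewx1).
rewrite amcoef_gen g1 amd_gens_bas // amcoefB basM zE1 /=.
rewrite [X in _ - X](flat_corr sn1 ps1 wx1 (negbT ewx1)) ?wlw // subr0.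
have [w3 [-> wv3 ws3 wl3]] := gensP sn1 ps01.
have [_ sz1 _] := bmul_comp zE1.
rewrite amcoef_gen /wend wl3 wl1 (follow_comp uy1) -wx1 sz1 !eqxx !andbT.
congr ((nat_of_bool _)%:R); apply/idP/idP => /andP[/eqP e1 /eqP e2].
  rewrite -e1 ws in ws3; rewrite -e1 wv in wv3.
  rewrite -ws3 -wv3 -e2 in uy1 zE1.
  have [ey ex] := extends_inj uy uy1 (negbT ewx) (negbT ewx1) xE zE1.
  rewrite ex eqxx andbT; apply/eqP/Some_inj.
  by rewrite -wE -wE1 ey ws3 wv3.
have : (val w').2 = rcons s1 y1 :> seq _ /\ (val w').1 = v1 by rewrite e1 v1' s1'.
have [w4] := mkwordP (n := n.+1) (etrans (size_rcons s y) (congr1 S sn)) ps.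
rewrite wE => -[<-] [-> ->] [/rcons_inj[es ey] ev].
rewrite -e2 -ey xE in zE1; case: zE1 => ->; rewrite eqxx andbT.
apply/eqP; apply: val_inj; rewrite [LHS]surjective_pairing [RHS]surjective_pairing.
rewrite wv wv3 ev; congr pair; apply: val_inj => /=; by rewrite ws ws3.
Qed.

Section Augmented.
Variables (S : lmodType B^c) (q : {linear B^c^o -> S}).
Hypothesis q_surj : forall s, exists z, q z = s.
Hypothesis q_ker : forall z, q z = 0 <-> forall v, bcoef b (btriv b v) z = 0.

Definition ameps : P 0 -> S := amlin (fun w => q (e (wend w))).
HB.instance Definition _ := GRing.Linear.on ameps.

Lemma q_act (x y : B) : q x <| y = q (x * y : B).
Proof. exact: (esym (linearZ_LR q (y : B^c) x)). Qed.

Lemma wend0 (w : wd 0) : wend w = (val w).1.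
Proof.
rewrite /wend /wlast; case: (val w) => v s /=.
by rewrite (tuple0 s) /= lstartE btgt_triv.
Qed.

Lemma wlast0 (w : wd 0) : wlast w = st (wend w).
Proof. by rewrite wend0 /wlast; case: (val w) => v s /=; rewrite (tuple0 s). Qed.

Lemma wend0_inj : injective (@wend _ _ _ _ _ a 0).
Proof.
move=> w w'; rewrite !wend0 => vE; apply: val_inj.
rewrite [LHS]surjective_pairing [RHS]surjective_pairing vE.
by rewrite (tuple0 (val w).2) (tuple0 (val w').2).
Qed.

Lemma ameps_gen w : ameps (gen w) = q (e (wend w)).
Proof. by rewrite [ameps _]amlin_gen q_act triv_idem. Qed.

Lemma amepsE f : ameps f = q (\sum_w e (wend w) * amfun f w).
Proof. by rewrite linear_sum; apply: eq_bigr => w _; rewrite -q_act. Qed.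

Lemma ameps_amd f : ameps (amd f) = 0.
Proof.
apply: (am_ext (f := ameps \o (@amd _ _ _ _ _ a 0)) (g := \0)) => w /=.
elim/word_ind: w => v s w sn ps wE.
have -> : gen w = gens 1 v s by rewrite /gens wE.
case/lastP: s sn ps wE => // s y; rewrite size_rcons => -[sn] ps wE.
have uy : follow (st v) y by move: sn ps; case: s {wE} => //= _; rewrite andbT.
have syE : size (rcons s y) = 1 by rewrite size_rcons sn.
rewrite -(gens_end syE ps) last_rcons amd_gens_bas ?bsrc_triv //.
case: s sn ps wE syE => // sn ps wE syE; rewrite /= corr_start.
rewrite [X in _ - X]scaler0 subr0 linearZ_LR.
have [w0 [-> _ _ _]] := @gensP 0 v [::] sn isT.
rewrite /= ameps_gen q_act; apply/q_ker => v'.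
rewrite bcoef_triv_mul; case: ifP => // _.
rewrite mul_bas_triv eqxx bcoef_bas; case: eqP => // yE.
by have := follow_triv uy (esym yE).
Qed.

(** By [extends_start] a flat element of degree 0 has coefficients only at the idempotents, and
    exactly these are detected by [q]. *)
Lemma flat_inj0 f : flat f -> ameps f = 0 -> f = 0.
Proof.
move=> ff; rewrite amepsE => /q_ker f0; apply: amcoef_eq0 => w x.
case: (wend w =P bsrc b x) => [wx|/amcoef_end-> //].
case ewx: (extends (wlast w) x); first exact: ff.
rewrite wlast0 wx in ewx.
rewrite (extends_start (negbT ewx)) -wx; have := f0 (wend w).
rewrite linear_sum (bigD1 w) //= big1 => [|w' ww'].
  by rewrite addr0 bcoef_triv_mul bsrc_triv eqxx.
rewrite bcoef_triv_mul bsrc_triv; case: ifP => // /eqP/wend0_inj ww.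
by rewrite ww eqxx in ww'.
Qed.

Lemma ameps_surj s : exists f, ameps f = s.
Proof.
have [z <-] := q_surj s.
exists (\sum_v gens 0 v ([::] : seq Y) <| (z : B)).
have {2}-> : z = \sum_v e v * (z : B) by rewrite -mulr_suml (bas_sum b) mul1r.
rewrite !linear_sum.
apply: eq_bigr => v _; have [w [-> wv _ _]] := @gensP 0 v [::] erefl isT.
by rewrite linearZ_LR /= ameps_gen q_act wend0 wv.
Qed.

Lemma ameps_exact f : ameps f = 0 <-> exists g, amd g = f.
Proof.
split=> [f0|[g <-]]; last exact: ameps_amd.
have [g fg] := flat_reduce f; exists g; apply/esym/eqP; rewrite -subr_eq0.
by apply/eqP/flat_inj0 => //; rewrite linearB /= f0 ameps_amd subr0.
Qed.

Lemma amd_exact n (f : P n.+1) : amd f = 0 <-> exists g, amd g = f.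
Proof.
split=> [f0|[g <-]]; last exact: amd_amd.
have [g fg] := flat_reduce f; exists g; apply/esym/eqP; rewrite -subr_eq0.
by apply/eqP/flat_inj => //; rewrite linearB /= f0 amd_amd subr0.
Qed.

Definition anick_resolution : resolution S :=
  @Resolution B^c S (fun n => P n) (fun n => @amd _ _ _ _ _ a n) ameps
    (@am_projective _ _ _ _ _ a) ameps_surj ameps_exact amd_exact.

End Augmented.
End AnickExactness.

(** * Monomial algebras and their chains *)

Section CoordinateFunctions.
Variables (K : fieldType) (B : lmodType K) (T : choiceType) (f : T -> B).

Hypothesis f_span : forall z, exists (s : seq T) (k : T -> K),
  uniq s /\ z = \sum_(x <- s) k x *: f x.
Hypothesis f_free : forall (s : seq T) (k : T -> K), uniq s ->
  \sum_(x <- s) k x *: f x = 0 -> forall x, x \in s -> k x = 0.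

Lemma coordinate_functions : exists coef : T -> {scalar B},
  (forall x y, coef x (f y) = (x == y)%:R) /\
  (forall z, exists s : seq T, z = \sum_(x <- s) coef x z *: f x).
Proof.
(* [k] is a family of coordinates of [z] supported in [r]. Freeness makes [k] unique, and uniqueness
   makes the chosen coordinates linear in [z]. *)
pose repu z k (r : seq T) := [/\ uniq r, z = \sum_(x <- r) k x *: f x
  & forall x, x \notin r -> k x = 0 :> K].
have wide z k r r' : repu z k r -> uniq r' -> {subset r <= r'} -> repu z k r'.
  move=> [ur -> k0] ur' rr'; split=> // [|x xr']; last first.
    by apply: k0; apply: contra xr' => /rr'.
  rewrite [RHS](bigID (mem r)) /= [X in _ = _ + X]big1 => [|x xr]; last by rewrite k0 ?scale0r.
  rewrite addr0 -[RHS]big_filter; apply: perm_big; apply: uniq_perm; rewrite ?filter_uniq //.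
  by move=> x; rewrite mem_filter; case xr: (x \in r) => //=; rewrite rr'.
have lin (c : K) z z' k k' r r' : repu z k r -> repu z' k' r' ->
    exists r2, repu (c *: z + z') (fun x => c * k x + k' x) r2.
  move=> h h'; set u := undup (r ++ r').
  have [uu uz uk] : repu z k u.
    by apply: wide h (undup_uniq _) _ => x; rewrite mem_undup mem_cat => ->.
  have [_ uz' uk'] : repu z' k' u.
    by apply: wide h' (undup_uniq _) _ => x; rewrite mem_undup mem_cat orbC => ->.
  exists u; split=> // [|x xu]; last by rewrite uk // uk' // mulr0 addr0.
  rewrite {1}uz {1}uz' scaler_sumr -big_split; apply: eq_bigr => x _ /=.
  by rewrite scalerDl scalerA.
have uni z k k' r r' : repu z k r -> repu z k' r' -> forall x, k x = k' x.
  move=> h h' x; have [r2 [u2 z2 k2]] := lin (-1) _ _ _ _ _ _ h h'.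
  rewrite scaleN1r addNr in z2.
  have : -1 * k x + k' x = 0.
    by case: (boolP (x \in r2)) => [|/k2 //]; apply: f_free u2 (esym z2) x.
  by rewrite mulN1r addrC => /eqP; rewrite subr_eq0 => /eqP.
have ex z : exists k r, repu z k r.
  have [s [k [us ->]]] := f_span z; exists (fun x => if x \in s then k x else 0), s.
  split=> // [|x /negPf->] //; apply: eq_big_seq => x -> //.
pose c x z := sval (cid (ex z)) x.
have cP z : exists r, repu z (c^~ z) r := svalP (cid (ex z)).
have clin x : scalar (c x).
  move=> d z z'; have [r h] := cP z; have [r' h'] := cP z'; have [r1 h1] := cP (d *: z + z').
  have [r2 h2] := lin d _ _ _ _ _ _ h h'; exact: uni h1 h2 x.
exists (fun x => HB.pack (c x) (GRing.isLinear.Build _ _ _ _ (c x) (clin x)) : {scalar B}).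
split=> [x y|z] /=; last by have [r [_ zE _]] := cP z; exists r.
have [r h] := cP (f y); apply: (uni _ _ (fun x => (x == y)%:R) _ [:: y] h).
split=> // [|x']; first by rewrite big_seq1 eqxx scale1r.
by rewrite inE => /negPf->.
Qed.

End CoordinateFunctions.

Section PathAlgebraFacts.
Variables (K : fieldType) (Q : quiver).
Local Notation KQ := (path_algebra K Q).

Lemma path_algebra_ind (H : KQ -> Prop) :
  H 0 -> (forall f g, H f -> H g -> H (f + g)) ->
  (forall (c : K) p, H (c *: path_elt p)) -> forall f, H f.
Proof.
move=> H0 HD HZ f; rewrite (path_algebraE f).
by elim/big_ind: _ => // p _; apply: HZ.
Qed.

Definition pcoef (p : qpath Q) (f : KQ) : K := mcoeff p f.

Fact pcoef_scalar p : scalar (pcoef p).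
Proof. move=> c f g; rewrite /pcoef mcoeffD; congr (_ + _); exact: Defs.coefZ. Qed.

HB.instance Definition _ p := GRing.isLinear.Build K KQ K _ (pcoef p) (pcoef_scalar p).

Lemma pcoef_path p r : pcoef p (path_elt r) = (r == p)%:R.
Proof. exact: coef_path. Qed.

Lemma pcoef_decomp f : f = \sum_(p <- msupp f) pcoef p f *: path_elt p.
Proof. exact: path_algebraE. Qed.

(** The filtration by powers of the arrow ideal, read off from coefficients; it serves to see that
    vertices and arrows survive in an admissible quotient. *)
Definition order_ge (m : nat) (f : KQ) : Prop :=
  forall p, (plen p < m)%N -> pcoef p f = 0.

Lemma order_ge_sums m (H : KQ -> Prop) f :
  (forall g, H g -> order_ge m g) -> sums H f -> order_ge m f.
Proof.
move=> Hm [s sH ->] p pm; rewrite raddf_sum big1_seq // => g /andP[_ gs].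
exact: Hm (sH _ gs) _ pm.
Qed.

Lemma order_geM m n f g : order_ge m f -> order_ge n g -> order_ge (m + n) (f * g).
Proof.
move=> fm gn p pmn; rewrite (pcoef_decomp f) mulr_suml raddf_sum big1_seq //= => p1 _.
rewrite (pcoef_decomp g) mulr_sumr raddf_sum big1_seq //= => p2 _.
rewrite -scalerAl -scalerAr !linearZ /= path_eltM.
case: (ltnP (plen p1) m) => [/fm->|p1m]; first by rewrite mul0r.
case: (ltnP (plen p2) n) => [/gn->|p2n]; first by rewrite mul0r mulr0.
case: (pend p1 =P pstart p2) => [e|ne]; last first.
  by rewrite /pcat (introF eqP ne) /= linear0 !mulr0.
have [r -> rE] := pcatP e; rewrite /= pcoef_path.
case: (r =P p) => [rp|_]; last by rewrite !mulr0.
move: pmn; rewrite -rp /plen /parrows rE /= size_cat ltnNge.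
by rewrite leq_add.
Qed.

Lemma order_ge0 f : order_ge 0 f. Proof. by []. Qed.

Lemma arrow_ideal_order f : arrow_ideal f -> order_ge 1 f.
Proof.
apply: order_ge_sums => g [x [_ [y [[p pl ->] ->]]]].
rewrite -[1%N]/(0 + 1 + 0)%N; apply: order_geM (order_ge0 _); apply: order_geM (order_ge0 _) _.
by move=> r r0; rewrite pcoef_path; case: eqP => // pr; rewrite -pr pl in r0.
Qed.

Lemma ideal_pow_order m f : ideal_pow (@arrow_ideal K Q) m f -> order_ge m f.
Proof.
elim: m f => [|m IH] f; first by move=> _; apply: order_ge0.
apply: order_ge_sums => g [x [y [/arrow_ideal_order x1 /IH ym ->]]].
exact: (@order_geM 1 m).
Qed.

Lemma ideal_pow_path m (p : qpath Q) : (m <= plen p)%N ->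
  ideal_pow (@arrow_ideal K Q) m (path_elt p).
Proof.
elim: m p => [//|m IH] [[v [//|x s]] /= w] lt.
have [/eqP vx ws] : qsrc x == v /\ walk (qtgt x) s by apply/andP.
have w1 : walk v [:: x] by rewrite /= vx eqxx.
pose p1 := @QPath Q (v, [:: x]) w1; pose p2 := @QPath Q (qtgt x, s) ws.
exists [:: path_elt (@QPath Q (v, x :: s) w)]; last by rewrite big_seq1.
move=> y; rewrite inE => /eqP->; exists (path_elt p1), (path_elt p2); split; last first.
- have [|r rE rv] := @pcatP Q p1 p2; first by [].
  by rewrite path_eltM rE /=; congr path_elt; apply: val_inj; rewrite rv.
- exact: IH.
exists [:: path_elt p1]; last by rewrite big_seq1.
move=> z; rewrite inE => /eqP->; exists 1, (path_elt p1), 1.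
by rewrite mul1r mulr1; split=> //; exists p1.
Qed.

Lemma path_ideal_elt (rho : qpath Q -> Prop) p : rho p -> path_ideal K rho (path_elt p).
Proof.
move=> rp; exists [:: path_elt p]; last by rewrite big_seq1.
move=> z; rewrite inE => /eqP->; exists 1, (path_elt p), 1.
by rewrite mul1r mulr1; split=> //; exists p.
Qed.

Section Quotient.
Variables (rho : qpath Q -> Prop) (L : algType K) (pi : {lrmorphism KQ -> L}).
Hypothesis piP : is_quotient (path_ideal K rho) pi.

(** Expanding [x] and [y] in [x * p0 * y], with [p0] a relation, gives multiples of paths through
    [p0], which lie in the ideal themselves. This makes distinct nonzero paths linearly independent
    in the quotient. *)
Lemma monomial_ideal_supp f p : pi f = 0 -> pcoef p f != 0 -> pi (path_elt p) = 0.
Proof.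
move=> /piP.2 [s sI ->]; apply: contraNeq => np; rewrite raddf_sum big1_seq //= => g.
move=> /sI [x [_ [y [[p0 rp0 ->] ->]]]] {s sI}.
have p00 : pi (path_elt p0) = 0 by apply/piP.2/path_ideal_elt.
have np' (h : KQ) : (exists c r, h = c *: path_elt r /\ (c *: pi (path_elt r) = 0)) -> pcoef p h = 0.
  move=> [c [r [-> cr]]]; rewrite linearZ /= pcoef_path; case: (r =P p) => [rp|_]; last by rewrite mulr0.
  move/eqP: cr; rewrite rp scaler_eq0 (negPf np) orbF => /eqP->; by rewrite mul0r.
rewrite (pcoef_decomp x) !mulr_suml raddf_sum big1_seq //= => p1 _.
rewrite (pcoef_decomp y) mulr_sumr raddf_sum big1_seq //= => p2 _.
rewrite -!scalerAl -scalerAr scalerA.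
have pp r r' : exists c r2, path_elt r * path_elt r' = c *: path_elt r2 :> KQ.
  rewrite path_eltM; case: pcat => [r2|]; first by exists 1, r2; rewrite scale1r.
  by exists 0, r; rewrite scale0r.
have [c1 [r1 e1]] := pp p1 p0; have [c2 [r2 e2]] := pp r1 p2.
apply: np'; exists (pcoef p1 x * pcoef p2 y * c1 * c2), r2.
have e3 : path_elt p1 * path_elt p0 * path_elt p2 = (c1 * c2) *: path_elt r2 :> KQ.
  exact: etrans (congr1 (fun z => z * path_elt p2) e1)
    (etrans (esym (scalerAl c1 (path_elt r1) (path_elt p2)))
      (etrans (congr1 ( *:%R c1) e2) (scalerA c1 c2 (path_elt r2)))).
have scE (U : lmodType K) (d : K) (u u' : U) :
    u = (c1 * c2) *: u' -> d *: u = (d * c1 * c2) *: u'.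
  by move=> ->; rewrite scalerA mulrA.
split; first exact: scE e3.
have e4 : (c1 * c2) *: pi (path_elt r2) = 0.
  by rewrite -linearZ_LR -e3 !rmorphM /= p00 mulr0 mul0r.
by rewrite -(mulrA _ c1 c2) -scalerA e4 scaler0.
Qed.

End Quotient.
End PathAlgebraFacts.

Section MonomialAlgebra.
Variables (K : fieldType) (Q : quiver) (rho : qpath Q -> Prop) (L : algType K).
Variable (pi : {lrmorphism path_algebra K Q -> L}).
Local Notation V := (vert Q).
Local Notation Ar := (arr Q).

(** A list that is not a walk from [v] is sent to 0, so that lists of arrows can be cut and joined
    freely. *)
Definition pel (v : V) (s : seq Ar) : L :=
  oapp (fun p : qpath Q => pi (path_elt p)) 0 (insub (v, s)).

Definition endp (v : V) (s : seq Ar) : V := last v (map (@qtgt Q) s).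

Lemma endp_cat v s1 s2 : endp v (s1 ++ s2) = endp (endp v s1) s2.
Proof. by rewrite /endp map_cat last_cat. Qed.

Lemma pel_walk v s : pel v s != 0 -> walk v s.
Proof. by rewrite /pel; case: insubP => [p|] //=; rewrite eqxx. Qed.

Lemma pelE (p : qpath Q) : pel (pstart p) (parrows p) = pi (path_elt p).
Proof.
rewrite /pel /pstart /parrows -surjective_pairing; case: insubP => [r _ rE|].
  by congr (pi (path_elt _)); apply: val_inj.
by rewrite (valP p).
Qed.

Lemma pelM v1 s1 v2 s2 :
  pel v1 s1 * pel v2 s2 = if endp v1 s1 == v2 then pel v1 (s1 ++ s2) else 0.
Proof.
rewrite {1 2}/pel; case: insubP => [p _ pE|nw] /=; last first.
  rewrite mul0r; case: ifP => // _; rewrite /pel insubF // /= walk_cat.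
  by rewrite (negPf nw).
case: insubP => [r _ rE|nw] /=; last first.
  rewrite mulr0; case: eqP => // e; rewrite /pel insubF //= walk_cat.
  by rewrite -/(endp _ _) e (negPf nw) andbF.
rewrite -rmorphM path_eltM.
have -> : endp v1 s1 = pend p by rewrite /pend /pstart /parrows pE.
have <- : pstart r = v2 by rewrite /pstart rE.
case: eqP => [e|ne]; last by rewrite /pcat (introF eqP ne) /= linear0.
have [u -> uE] := pcatP e; rewrite /= -pelE /pstart /parrows uE /=.
by rewrite /pstart /parrows pE rE.
Qed.

Lemma pel_cat v s1 s2 : pel v (s1 ++ s2) = pel v s1 * pel (endp v s1) s2.
Proof. by rewrite pelM eqxx. Qed.

Lemma pel_catl v s1 s2 : pel v (s1 ++ s2) != 0 -> pel v s1 != 0.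
Proof. by apply: contra => /eqP s10; rewrite pel_cat s10 mul0r. Qed.

Lemma pel_catr v s1 s2 : pel v (s1 ++ s2) != 0 -> pel (endp v s1) s2 != 0.
Proof. by apply: contra => /eqP s20; rewrite pel_cat s20 mulr0. Qed.

Hypothesis piP : is_quotient (path_ideal K rho) pi.
Variable N : nat.
Hypothesis pi_long : forall p, (N <= plen p)%N -> pi (path_elt p) = 0.
Hypothesis pi_short : forall p, (plen p <= 1)%N -> pi (path_elt p) <> 0.

Lemma pel_long v s : (N <= size s)%N -> pel v s = 0.
Proof.
by rewrite /pel; case: insubP => //= p _ pE sN; apply: pi_long; rewrite /plen /parrows pE.
Qed.

Lemma pel_size v s : pel v s != 0 -> (size s <= N)%N.
Proof. by apply: contraR; rewrite -ltnNge => /ltnW /pel_long->. Qed.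

Lemma pel_short v s : walk v s -> (size s <= 1)%N -> pel v s != 0.
Proof.
move=> w s1; have -> : pel v s = pi (path_elt (@QPath Q (v, s) w)) by rewrite -pelE.
exact/eqP/pi_short.
Qed.

(** Bounding the length by [N] makes this a finite type, as required of an alphabet in
    [anick_data]. *)
Definition npath := {p : V * N.-bseq Ar | pel p.1 p.2 != 0}.
Definition nstart (x : npath) : V := (val x).1.
Definition narrows (x : npath) : seq Ar := (val x).2.
Definition nend (x : npath) : V := endp (nstart x) (narrows x).

Definition mknpath v s : option npath :=
  obind (fun t : N.-bseq Ar => insub (v, t)) (insub s).

Lemma npathP (x : npath) : pel (nstart x) (narrows x) != 0.
Proof. exact: (valP x). Qed.

Lemma npath_ext (x y : npath) : nstart x = nstart y -> narrows x = narrows y -> x = y.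
Proof.
move=> sE aE; apply: val_inj; rewrite [LHS]surjective_pairing [RHS]surjective_pairing.
by congr pair => //; apply: val_inj.
Qed.

Lemma mknpathP v s : pel v s != 0 ->
  exists2 x, mknpath v s = Some x & nstart x = v /\ narrows x = s.
Proof.
move=> nz; rewrite /mknpath; case: insubP => [t _ tE|]; last by rewrite (pel_size nz).
rewrite /=; case: insubP => [x _ xE|]; last by rewrite /= tE nz.
by exists x; rewrite // /nstart /narrows xE.
Qed.

Lemma mknpath_None v s : pel v s = 0 -> mknpath v s = None.
Proof.
move=> z; rewrite /mknpath; case: insubP => [t _ tE|//] /=.
by rewrite insubF //= tE z eqxx.
Qed.

Lemma mknpathE x : mknpath (nstart x) (narrows x) = Some x.
Proof.
by have [y -> [yv ys]] := mknpathP (npathP x); congr Some; apply: npath_ext.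
Qed.

Lemma mknpath_Some v s x : mknpath v s = Some x ->
  [/\ nstart x = v, narrows x = s & pel v s != 0].
Proof.
case: (pel v s =P 0) => [/mknpath_None->//|/eqP nz].
by have [y -> [yv ys]] := mknpathP nz => -[<-].
Qed.

Definition nel (x : npath) : L := pel (nstart x) (narrows x).

Lemma pel_nel v s : pel v s = oapp nel 0 (mknpath v s).
Proof.
case: (pel v s =P 0) => [z|/eqP nz]; first by rewrite mknpath_None.
by have [x -> [xv xs]] := mknpathP nz; rewrite /= /nel xv xs.
Qed.

Fact ntriv_proof v : pel v [::] != 0.
Proof. exact: pel_short. Qed.

Definition ntriv v : npath := exist _ (v, [bseq]) (ntriv_proof v).

Definition nmul (x y : npath) : option npath :=
  if nend x == nstart y then mknpath (nstart x) (narrows x ++ narrows y) else None.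

Lemma nel_free (s : seq npath) (k : npath -> K) : uniq s ->
  \sum_(x <- s) k x *: nel x = 0 -> forall x, x \in s -> k x = 0.
Proof.
move=> us.
pose pth x := @QPath Q (nstart x, narrows x) (pel_walk (npathP x)).
have pthE x : nel x = pi (path_elt (pth x)) by rewrite -pelE.
pose f := \sum_(x <- s) k x *: path_elt (pth x) : path_algebra K Q.
move=> s0 x xs; have f0 : pi f = 0.
  by rewrite linear_sum -[RHS]s0; apply: eq_bigr => y _; rewrite linearZ_LR pthE.
have xf : pcoef (pth x) f = k x.
  rewrite linear_sum (bigD1_seq x) //= big1 => [|y yx].
    by rewrite addr0 linearZ /= pcoef_path eqxx mulr1.
  rewrite linearZ /= pcoef_path; case: eqP => [e|_]; last by rewrite mulr0.
  by have /eqP[] := yx; apply: npath_ext; case: e.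
apply/eqP; apply: contraT => kx; have := npathP x.
by rewrite -/(nel x) pthE (monomial_ideal_supp piP f0) ?eqxx // xf.
Qed.

Lemma nel_span z : exists (s : seq npath) (k : npath -> K),
  uniq s /\ z = \sum_(x <- s) k x *: nel x.
Proof.
have [f <-] := piP.1 z.
suff [k kE] : exists k : npath -> K, pi f = \sum_x k x *: nel x.
  by exists (index_enum npath), k; rewrite index_enum_uniq kE.
elim/path_algebra_ind: f => [|f g [k1 e1] [k2 e2]|c p].
- by exists (fun _ => 0); rewrite linear0 big1 // => x _; rewrite scale0r.
- exists (fun x => k1 x + k2 x); rewrite raddfD /= e1 e2 -big_split.
  by apply: eq_bigr => x _; rewrite scalerDl.
rewrite linearZ_LR /= -pelE pel_nel; case: mknpath => [x|] /=; last first.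
  by exists (fun _ => 0); rewrite scaler0 big1 // => x _; rewrite scale0r.
exists (fun y => if y == x then c else 0); rewrite (bigD1 x) //= big1 => [|y /negPf->].
  by rewrite eqxx addr0.
by rewrite scale0r.
Qed.

Lemma nmul_comp x y z : nmul x y = Some z ->
  [/\ nend x = nstart y, nstart z = nstart x & nend z = nend y].
Proof.
rewrite /nmul; case: eqP => // e /mknpath_Some[zv zs _].
by rewrite /nend zv zs endp_cat -/(nend x) e.
Qed.

Lemma nmul_eq_triv x y v : nmul x y = Some (ntriv v) -> x = ntriv v /\ y = ntriv v.
Proof.
rewrite /nmul; case: eqP => // e /mknpath_Some[xv xy _].
have [x0 y0] : narrows x = [::] /\ narrows y = [::].
  by case: (narrows x) (narrows y) xy => [|? ?] [|? ?].
have vx : nstart x = v by rewrite -xv.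
by split; apply: npath_ext => //; rewrite -e /nend x0.
Qed.

Lemma nelM x y : nel x * nel y = oapp nel 0 (nmul x y).
Proof. by rewrite /nel pelM /nmul; case: ifP => // _; rewrite pel_nel. Qed.

Lemma nel_sum : \sum_v nel (ntriv v) = 1.
Proof.
rewrite -[RHS](rmorph1 pi) -[1 in RHS]/(pa_one K Q) /pa_one raddf_sum; apply: eq_bigr => v _.
exact: (pelE (ptriv v)).
Qed.

Let coefs := cid (coordinate_functions nel_span nel_free).

Definition npath_basis : path_basis L V npath.
Proof.
refine (@PathBasis _ _ _ _ nel ntriv nstart nend nmul (sval coefs) _ _ _ _
  nmul_comp nmul_eq_triv nelM nel_sum (svalP coefs).1 (svalP coefs).2) => //.
- move=> v x; rewrite /nmul (_ : nend (ntriv v) = v) //; case: (v =P nstart x) => // ->.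
  exact: mknpathE.
- by move=> x v; rewrite /nmul (_ : nstart (ntriv v) = v) // cats0 mknpathE.
Defined.

Lemma nmul_walk x y : nend x = nstart y ->
  (nmul x y == None) = (pel (nstart x) (narrows x ++ narrows y) == 0).
Proof.
move=> e; rewrite /nmul e eqxx pel_nel; case: mknpath => [z|] /=; last by rewrite !eqxx.
by rewrite (negPf (npathP z)).
Qed.

(* The successors of a nontrivial path [u] are the paths [y] for which [u y]
   vanishes but no [u y'] with [y'] a proper prefix of [y] does. *)
Definition nfollow (u y : npath) : bool :=
  [&& nend u == nstart y, narrows y != [::] &
  if narrows u == [::] then size (narrows y) == 1%N
  else (pel (nstart u) (narrows u ++ narrows y) == 0) &&
       (pel (nstart u) (narrows u ++ take (size (narrows y)).-1 (narrows y)) != 0)].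

Definition nextends (u x : npath) : bool :=
  if narrows u == [::] then narrows x != [::]
  else pel (nstart u) (narrows u ++ narrows x) == 0.

(** The letter [y] is the shortest prefix of [x] that is annihilated by [u], or the first arrow of
    [x] if [u] is trivial. *)
Lemma nextends_ex u x : nend u = nstart x -> nextends u x ->
  exists y x', [/\ nfollow u y, nmul y x' = Some x & ~~ nextends y x'].
Proof.
move=> e ux; suff [k [k1 kx H]] : exists k, [/\ (0 < k)%N, (k <= size (narrows x))%N &
  if narrows u == [::] then k == 1%N
  else (pel (nstart u) (narrows u ++ take k (narrows x)) == 0) &&
       (pel (nstart u) (narrows u ++ take k.-1 (narrows x)) != 0)].
  have nx := npathP x; rewrite -(cat_take_drop k (narrows x)) in nx.
  have [y yE [yv ys]] := mknpathP (pel_catl nx).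
  have [x' xE [xv' xs']] := mknpathP (pel_catr nx).
  have yx : nend y = nstart x' by rewrite /nend yv ys xv'.
  have sk : size (take k (narrows x)) = k by rewrite size_takel.
  have yn : narrows y != [::] by rewrite ys -size_eq0 sk -lt0n.
  exists y, x'; split.
  - rewrite /nfollow yn yv e eqxx ys /= sk; case: ifP H => // _.
    by rewrite take_takel // leq_pred.
  - by rewrite /nmul yx eqxx yv ys xs' cat_take_drop mknpathE.
  rewrite /nextends (negPf yn) yv ys xs' cat_take_drop; exact: npathP.
move: ux; rewrite /nextends; case: ifP => [_ xn|un ux].
  by exists 1%N; split=> //; rewrite lt0n size_eq0.
have ex : exists k, pel (nstart u) (narrows u ++ take k (narrows x)) == 0.
  by exists (size (narrows x)); rewrite take_size.
case: (ex_minnP ex) => k k0 kmin; exists k.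
have k1 : (0 < k)%N.
  by rewrite lt0n; apply: contraTN k0 => /eqP->; rewrite take0 cats0 npathP.
split=> //; first by apply: kmin; rewrite take_size.
by rewrite k0 /=; apply/negP => /kmin; rewrite leqNgt prednK ?leqnn.
Qed.

Lemma nextends_mul u y x' : nfollow u y -> nend y = nstart x' -> ~~ nextends y x' ->
  exists2 x, nmul y x' = Some x & nextends u x.
Proof.
case/and3P=> /eqP uy yn H yx; rewrite /nextends (negPf yn) => nz.
have [x xE [xv xs]] := mknpathP nz; exists x; first by rewrite /nmul yx eqxx.
case: ifP H => _ /=.
  by rewrite xs -!size_eq0 in yn *; rewrite size_cat addn_eq0 negb_and yn.
by case/andP=> /eqP z _; rewrite xs catA pel_cat z mul0r.
Qed.

(** Two minimal annihilated prefixes of one path have the same length: the longer one without its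
    last arrow would still contain the shorter one, and would be annihilated too. *)
Lemma nfollow_inj u y x y1 x1 z : nfollow u y -> nfollow u y1 ->
  nmul y x = Some z -> nmul y1 x1 = Some z -> y = y1 /\ x = x1.
Proof.
case/and3P=> /eqP uy yn H /and3P[/eqP uy1 yn1 H1].
rewrite /nmul; case: eqP => // yx /mknpath_Some[_ zs _].
case: eqP => // yx1 /mknpath_Some[_ zs1 _].
suff sE : size (narrows y) = size (narrows y1).
  have := zs; rewrite zs1 => /eqP; rewrite eq_sym eqseq_cat // => /andP[/eqP e1 /eqP e2].
  have ey : y = y1 by apply: npath_ext => //; rewrite -uy uy1.
  by split=> //; apply: npath_ext => //; rewrite -yx -yx1 ey.
case: ifP H H1 => [_ /eqP-> /eqP-> //|_ /andP[z0 n0] /andP[z1 n1]].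
have tk k : (k <= size (narrows y))%N -> (k <= size (narrows y1))%N ->
    take k (narrows y) = take k (narrows y1).
  by move=> ky ky1; rewrite -(takel_cat (narrows x) ky) -(takel_cat (narrows x1) ky1) -zs -zs1.
have bad (r r' : npath) : (size (narrows r) < size (narrows r'))%N ->
    (forall k, (k <= size (narrows r))%N -> (k <= size (narrows r'))%N ->
      take k (narrows r) = take k (narrows r')) ->
    pel (nstart u) (narrows u ++ narrows r) == 0 ->
    pel (nstart u) (narrows u ++ take (size (narrows r')).-1 (narrows r')) != 0 -> False.
  move=> lt tkr r0 /negP[].
  have le : (size (narrows r) <= (size (narrows r')).-1)%N by rewrite -ltnS (ltn_predK lt).
  have -> : take (size (narrows r')).-1 (narrows r') =
      narrows r ++ drop (size (narrows r)) (take (size (narrows r')).-1 (narrows r')).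
    rewrite -{1}(cat_take_drop (size (narrows r)) (take _ (narrows r'))); congr (_ ++ _).
    by rewrite take_takel // -tkr ?take_size // ltnW.
  by rewrite catA pel_cat (eqP r0) mul0r.
case: (ltngtP (size (narrows y)) (size (narrows y1))) => // lt.
  by case: (bad y y1).
by case: (bad y1 y) => // k ky ky1; rewrite tk.
Qed.

Definition npath_anick : anick_data npath_basis.
Proof.
refine (@AnickData _ _ _ _ npath_basis npath id ntriv nfollow (fun _ _ => None) nextends
  _ _ _ _ _ _ _ _ nextends_ex nextends_mul _ _ _) => //=.
- by move=> u y /and3P[/eqP].
- by move=> u y v /and3P[_ yn _] yv; rewrite yv in yn.
- move=> x u y /and3P[_ un _] /and3P[/eqP uy _]; rewrite (negPf un) => /andP[z _] _.
  by apply/eqP; rewrite nmul_walk.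
- by move=> u y x y1 x1 z uy uy1 _ _; apply: nfollow_inj uy uy1.
move=> x; rewrite /nextends /= negbK => /eqP xs; exact: npath_ext.
Defined.

End MonomialAlgebra.

(** * Radical maps and lengths of chains *)

Section Sums.
Variables (V : zmodType) (H : V -> Prop).

Lemma sums0 : sums H 0.
Proof. by exists [::]; rewrite ?big_nil. Qed.

Lemma sums_mem x : H x -> sums H x.
Proof. by move=> Hx; exists [:: x]; rewrite ?big_seq1 // => y; rewrite inE => /eqP->. Qed.

Lemma sumsD x y : sums H x -> sums H y -> sums H (x + y).
Proof.
move=> [s sH ->] [r rH ->]; exists (s ++ r); last by rewrite big_cat.
by move=> z; rewrite mem_cat => /orP[/sH|/rH].
Qed.

Lemma sums_big (I : Type) (r : seq I) (Pr : pred I) (F : I -> V) :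
  (forall i, Pr i -> sums H (F i)) -> sums H (\sum_(i <- r | Pr i) F i).
Proof. by move=> HF; elim/big_ind: _ => //; [exact: sums0 | exact: sumsD]. Qed.

Lemma sums_ind (G : V -> Prop) :
  G 0 -> (forall x y, G x -> G y -> G (x + y)) -> (forall x, H x -> G x) ->
  forall x, sums H x -> G x.
Proof.
move=> G0 GD HG x [s sH ->]; elim: s sH => [|y s IH] sH; first by rewrite big_nil.
rewrite big_cons; apply: GD; first by apply/HG/sH; rewrite inE eqxx.
by apply: IH => z zs; apply: sH; rewrite inE zs orbT.
Qed.

End Sums.

Section DirectSum.
Variables (T : choiceType) (V : zmodType) (V_ : T -> V -> Prop).
Hypothesis dV : direct_sum V_.

Lemma direct_sum_mem0 i : V_ i 0. Proof. by case: dV. Qed.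

Lemma direct_sum_memB i x y : V_ i x -> V_ i y -> V_ i (x - y).
Proof. by case: dV => _ H _ _; apply: H. Qed.

Lemma direct_sum_memN i x : V_ i x -> V_ i (- x).
Proof. by move=> ix; rewrite -sub0r; apply: direct_sum_memB (direct_sum_mem0 i) ix. Qed.

Lemma direct_sum_memD i x y : V_ i x -> V_ i y -> V_ i (x + y).
Proof. by move=> ix iy; rewrite -[y]opprK; apply/direct_sum_memB/direct_sum_memN. Qed.

Lemma homogeneous_components : exists c : T -> V -> V,
  [/\ forall i x y, c i (x + y) = c i x + c i y,
      forall i x, V_ i (c i x),
      forall i j x, V_ j x -> c i x = if i == j then x else 0
    & forall x, exists2 s : seq T, uniq s & x = \sum_(i <- s) c i x].
Proof.
case: dV => _ _ dec uni.
have ex x : exists c, (forall i, V_ i (c i)) /\ exists s : seq T,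
    [/\ uniq s, x = \sum_(i <- s) c i & forall i, i \notin s -> c i = 0].
  have [s [f [us fi ->]]] := dec x; exists (fun i => if i \in s then f i else 0).
  split=> [i|]; first by case: ifP => _; rewrite ?fi //; apply: direct_sum_mem0.
  exists s; split=> // [|i /negPf->] //; by apply: eq_big_seq => i ->.
have wide x (c : T -> V) s s' : x = \sum_(i <- s) c i -> (forall i, i \notin s -> c i = 0) ->
    uniq s -> uniq s' -> {subset s <= s'} -> x = \sum_(i <- s') c i.
  move=> -> c0 us us' ss.
  rewrite [RHS](bigID (mem s)) /= [X in _ = _ + X]big1 => [|i]; last exact: c0.
  rewrite addr0 -[RHS]big_filter; apply: perm_big; apply: uniq_perm; rewrite ?filter_uniq //.
  by move=> i; rewrite mem_filter; case si: (i \in s) => //=; rewrite ss.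
pose c i x := sval (cid (ex x)) i.
have cV i x : V_ i (c i x) by case: (svalP (cid (ex x))) => H _; apply: H.
have cS x : exists s : seq T, [/\ uniq s, x = \sum_(i <- s) c i x & forall i, i \notin s -> c i x = 0].
  by case: (svalP (cid (ex x))).
have uniq3 x y z (f g h : T -> V) r s t : (forall i, V_ i (f i)) -> (forall i, V_ i (g i)) ->
    (forall i, V_ i (h i)) -> uniq r -> uniq s -> uniq t ->
    x = \sum_(i <- r) f i -> y = \sum_(i <- s) g i -> z = \sum_(i <- t) h i ->
    (forall i, i \notin r -> f i = 0) -> (forall i, i \notin s -> g i = 0) ->
    (forall i, i \notin t -> h i = 0) -> z = x + y -> forall i, h i = f i + g i.
  move=> fV gV hV ur us ut xE yE zE f0 g0 h0 e i.
  set u := undup (r ++ s ++ t).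
  have uu : uniq u by apply: undup_uniq.
  have ur' : {subset r <= u} by move=> j jr; rewrite mem_undup !mem_cat jr.
  have us' : {subset s <= u} by move=> j js; rewrite mem_undup !mem_cat js orbT.
  have ut' : {subset t <= u} by move=> j jt; rewrite mem_undup !mem_cat jt !orbT.
  have := uni u (fun i => h i - (f i + g i)) uu; rewrite sumrB big_split /=.
  rewrite -(wide _ _ _ u xE f0 ur uu ur') -(wide _ _ _ u yE g0 us uu us').
  rewrite -(wide _ _ _ u zE h0 ut uu ut').
  rewrite e subrr => /(_ _ erefl i) => H.
  case: (boolP (i \in u)) => [/H H'|].
    by apply/eqP; rewrite -subr_eq0 H' // => j; apply/direct_sum_memB/direct_sum_memD.
  by rewrite mem_undup !mem_cat !negb_or => /and3P[/f0-> /g0-> /h0->]; rewrite addr0.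
exists c; split=> // [i x y|i j x jx|x].
- have [r [ur xE x0]] := cS x; have [s [us yE y0]] := cS y; have [t [ut zE z0]] := cS (x + y).
  by apply: (uniq3 x y (x + y) (c^~ x) (c^~ y) (c^~ (x + y)) r s t).
- have [r [ur xE x0]] := cS x.
  have := uniq3 x 0 x (c^~ x) (fun _ => 0) (fun i => if i == j then x else 0) r [::] [:: j].
  move=> -> //; rewrite ?addr0 ?big_nil ?big_seq1 ?eqxx // => k.
  + exact: direct_sum_mem0.
  + by case: eqP => [->|_] //; apply: direct_sum_mem0.
  by rewrite inE => /negPf->.
by have [s [us sE _]] := cS x; exists s.
Qed.

End DirectSum.

Section Radical.
Variables (K : fieldType) (B : algType K) (V : finType) (T : choiceType).
Variables (b : path_basis B V T) (a : anick_data b).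
Local Notation P := (anick_mod a).

Definition nontriv_elt (z : B) : Prop := forall v, bcoef b (btriv b v) z = 0.

Definition amrad n (f : P n) : Prop := forall w, nontriv_elt (amfun f w).

Lemma nontriv_bas x : (forall v, x <> btriv b v) -> nontriv_elt (b x).
Proof. by move=> nx v; rewrite bcoef_bas; case: eqP => // /esym/nx. Qed.

Lemma amradD n (f g : P n) : amrad f -> amrad g -> amrad (f + g).
Proof. by move=> fr gr w v; rewrite amfunD linearD fr gr addr0. Qed.

Lemma amradN n (f : P n) : amrad f -> amrad (- f).
Proof. by move=> fr w v; rewrite amfunN linearN fr oppr0. Qed.

Lemma amrad0 n : amrad (0 : P n).
Proof. by move=> w v; rewrite amfun0 linear0. Qed.

Lemma amrad_act n (f : P n) z : nontriv_elt z -> amrad (f <| z).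
Proof. by move=> z0 w v; rewrite amfun_act bcoef_trivM z0 mulr0. Qed.

Lemma amrad_lin n m (h : {linear P n -> P m}) f : amrad f -> amrad (h f).
Proof.
move=> fr; rewrite (am_decomp f) linear_sum; elim/big_ind: _ => //.
- exact: amrad0.
- by move=> x y; apply: amradD.
by move=> w _; rewrite linearZ_LR; apply: amrad_act.
Qed.

Lemma amrad_amd n (f : P n.+1) : amrad (amd f).
Proof.
rewrite (am_decomp f) linear_sum; elim/big_ind: _ => //.
- exact: amrad0.
- by move=> x y; apply: amradD.
move=> w _; rewrite linearZ_LR; elim/word_ind: w => v s w sn ps wE.
have -> : gen w = gens n.+1 v s by rewrite /gens wE.
move=> w' v'; rewrite amfun_act bcoef_trivM (_ : bcoef _ _ _ = 0) ?mul0r //.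
move: w' v'; change (amrad (amd (gens n.+1 v s))).
case/lastP: s sn ps {wE} => // s y sn ps.
move: (sn); rewrite size_rcons => -[sn'].
rewrite -(gens_end sn ps) last_rcons amd_gens_bas ?bsrc_triv //.
have uy : follow (last (lstart a v) s) y by move: ps; rewrite rcons_path => /andP[].
apply: amradD.
  by rewrite mul_bas_triv eqxx; apply/amrad_act/nontriv_bas => v'; apply: follow_triv uy.
apply: amradN; case E: corr => [[u1 y1]|]; last by rewrite [_ *: _]scaler0; apply: amrad0.
rewrite actA; apply: amrad_act => v'; rewrite bcoef_trivM.
by rewrite (nontriv_bas (x := lval y1)) ?mul0r // => v''; apply: corr_triv uy E.
Qed.

Lemma gen_notin_rad n (w : word a n) : ~ amrad (gen w).
Proof.
move=> /(_ w (wend w)); rewrite amfun_gen eqxx bcoef_bas eqxx => /eqP.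
by rewrite [_ == 0]oner_eq0.
Qed.

Section Lift.
Variables (S : lmodType B^c) (q : {linear B^c^o -> S}).
Hypothesis q_surj : forall s, exists z, q z = s.
Hypothesis q_ker : forall z, q z = 0 <-> forall v, bcoef b (btriv b v) z = 0.
Local Notation X := (anick_resolution a q_surj q_ker).

(** The difference with the identity lifts 0, so it is null-homotopic, and both terms of the
    homotopy formula land in the radical with the differentials. This takes the place of the
    uniqueness of minimal resolutions. *)
Lemma endo_lift_id (g : forall n, {linear X n -> X n}) :
  (forall x, res_eps X (g 0 x) = res_eps X x) ->
  (forall n x, res_d X n (g n.+1 x) = g n (res_d X n x)) ->
  forall n (x : X n), amrad (g n x - x).
Proof.
move=> ge gd.
pose f n : {linear X n -> X n} := g n \- idfun.
have [x|n x|h [h0 hS]] := @null_homotopy _ _ X X f.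
- by rewrite /f /= linearB /= ge subrr.
- by rewrite /f /= linearB /= gd.
case=> [|n] x; first by rewrite -[_ - _]/(f 0%N x) -h0; apply: amrad_amd.
have -> : g n.+1 x - x = res_d X n.+1 (h n.+1 x) + h n (res_d X n x).
  by rewrite hS addrNK.
by apply: amradD; [apply: amrad_amd | apply/(amrad_lin (h n))/amrad_amd].
Qed.

End Lift.
End Radical.

Section Admissible.
Variables (K : fieldType) (Q : quiver) (rho : qpath Q -> Prop) (L : algType K).
Variable (pi : {lrmorphism path_algebra K Q -> L}).
Hypothesis adm : admissible (path_ideal K rho).
Hypothesis piP : is_quotient (path_ideal K rho) pi.

Lemma admissible_long : exists N, forall p, (N <= plen p)%N -> pi (path_elt p) = 0.
Proof.
have [[m _ mI] _] := adm; exists m => p mp.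
by apply/piP.2/mI/ideal_pow_path.
Qed.

Lemma admissible_short p : (plen p <= 1)%N -> pi (path_elt p) <> 0.
Proof.
move=> p1 /piP.2/adm.2/ideal_pow_order/(_ p p1); rewrite pcoef_path eqxx => /eqP.
by rewrite [_ == 0]oner_eq0.
Qed.

End Admissible.

(** * Lengths of the chains of a stacked algebra *)

Section StackedLengths.
Variables (K : fieldType) (Q : quiver) (rho : qpath Q -> Prop) (L : algType K).
Variable (pi : {lrmorphism path_algebra K Q -> L}).
Hypothesis piP : is_quotient (path_ideal K rho) pi.
Variable N : nat.
Hypothesis pi_long : forall p, (N <= plen p)%N -> pi (path_elt p) = 0.
Hypothesis pi_short : forall p, (plen p <= 1)%N -> pi (path_elt p) <> 0.
Variables (S : lmodType L^c) (q : {linear L^c^o -> S}).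
Hypothesis qP : is_degree0_module (length_grading pi) q.

Local Notation b := (npath_basis piP pi_long pi_short).
Local Notation a := (npath_anick piP pi_long pi_short).
Local Notation gr := (length_grading pi).
Local Notation len x := (size (narrows x)).
Local Notation nel := (@nel _ _ _ pi N).
Local Notation ntriv := (ntriv N pi_short).

Lemma nel_grading x : gr (len x) (nel x).
Proof.
exists (path_elt (@QPath Q (nstart x, narrows x) (pel_walk (npathP x)))); last by rewrite -pelE.
apply: sums_mem; exists 1; eexists; rewrite scale1r; split; last by [].
by [].
Qed.

Lemma length_gradingZ n (c : K) y : gr n y -> gr n (c *: y).
Proof.
move=> [x xn ->]; exists (c *: x); last by rewrite linearZ_LR.
elim/sums_ind: xn => [|x1 x2 h1 h2|_ [d [p [pn ->]]]].
- by rewrite scaler0; apply: sums0.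
- rewrite scalerDr; exact: (sumsD h1 h2).
by apply: sums_mem; exists (c * d), p; rewrite scalerA.
Qed.

Lemma bcoef_grading n x y : gr n y -> len x <> n -> bcoef b x y = 0.
Proof.
move=> [f fn ->] xn; elim/sums_ind: fn => [|x1 x2 h1 h2|_ [d [p [pn ->]]]].
- by rewrite !linear0.
- by rewrite raddfD linearD /= h1 h2 addr0.
rewrite linearZ_LR linearZ /= -pelE (pel_nel pi_long).
case E: mknpath => [z|] /=; last by rewrite linear0 mulr0.
rewrite (bcoef_bas b x z); case: eqP => [xz|_]; last by rewrite mulr0.
by have [_ zs _] := mknpath_Some pi_long E; rewrite xz zs in xn.
Qed.

Lemma positive_partP z : positive_part gr z <-> forall v, bcoef b (btriv b v) z = 0.
Proof.
split.
  elim/sums_ind: z / => [|x y hx hy|x [n n0 xn]] v.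
  - by rewrite linear0.
  - by rewrite linearD /= hx hy addr0.
  by apply: bcoef_grading xn _ => /= n1; rewrite -n1 in n0.
move=> z0; have [s ->] := bas_span b z; apply: sums_big => x _.
case: (posnP (len x)) => [x0|xp].
  suff -> : bcoef b x z = 0 by rewrite scale0r; apply: sums0.
  rewrite -(z0 (nstart x)); congr (bcoef b _ z); apply: npath_ext => //.
  exact: size0nil.
by apply: sums_mem; exists (len x) => //; apply/length_gradingZ/nel_grading.
Qed.

Lemma q_surj s : exists z, q z = s. Proof. exact: qP.1. Qed.

Lemma q_ker z : q z = 0 <-> forall v, bcoef b (btriv b v) z = 0.
Proof. by rewrite qP.2; apply: positive_partP. Qed.

Definition chain_resolution : resolution S := anick_resolution a q_surj q_ker.
Local Notation X := chain_resolution.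

Definition warrows n (w : word a n) : seq (arr Q) :=
  flatten (map (@narrows _ _ _ pi N) (val w).2).

Definition wlen n (w : word a n) : nat := size (warrows w).

Lemma chain_split n (w : word a n.+1) : exists (w0 : word a n) (y : npath pi N),
  [/\ (val w).1 = (val w0).1, (val w).2 = rcons (val w0).2 y :> seq _,
      nfollow (wlast w0) y, wlast w = y
    & amd (gen w : anick_mod a n.+1) = (gen w0 : anick_mod a n) <| nel y].
Proof.
have [w0 [y [wv ws wy wl wd]]] := word_split w; exists w0, y; split=> //.
by rewrite wd [X in _ - X]scaler0 subr0.
Qed.

(** The stacked condition is imposed only up to the global dimension. A resolution vanishing in
    degree [n] would factor a lift of the identity through 0 there, and so put [gen w] in the
    radical. *)
Lemma chain_le_gldim n (w : word a n) : le_gldim L^c n.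
Proof.
exists S => -[P' P'0].
have [f [fe fd]] := comparison_map X P'; have [g [ge gd]] := comparison_map P' X.
pose k m : {linear X m -> X m} := g m \o f m.
have ke x : res_eps X (k 0%N x) = res_eps X x by rewrite /= ge fe.
have kd m x : res_d X m (k m.+1 x) = k m (res_d X m x) by rewrite /= gd fd.
have := endo_lift_id ke kd (gen w).
rewrite /k /= (P'0 n (leqnn n) (f n (gen w))) linear0 sub0r => h.
case: (@gen_notin_rad _ _ _ _ b a n w); rewrite -[gen w]opprK; exact: amradN.
Qed.

Section Graded.
Variables (P : resolution S) (P_ : forall n, int -> P n -> Prop).
Hypothesis PG : minimal_graded gr (concentrated0 S) P_.

Lemma concentrated0_comp (i : int) (s : S) : concentrated0 S i s -> i <> 0 -> s = 0.
Proof. by case. Qed.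

(** Each lift of a generator is replaced by its component of degree [wlen w]; this is still a lift,
    as the differentials and the augmentation are homogeneous. *)
Lemma graded_comparison : exists f : forall n, {linear X n -> P n},
  [/\ forall x, res_eps P (f 0 x) = res_eps X x,
      forall n x, res_d P n (f n.+1 x) = f n (res_d X n x)
    & forall n w, @P_ n (wlen w) (f n (gen w))].
Proof.
have dP n : direct_sum (@P_ n) := (mg_graded PG n).1.
have e0 m (i : int) x v : @P_ m i x -> @P_ m i (x <| nel (ntriv v)).
  move=> xi; have := (mg_graded PG m).2 i 0%N x (nel (ntriv v)) xi (nel_grading (ntriv v)).
  by rewrite addr0.
pose inv n (f : {linear X n -> P n}) :=
  [/\ forall x, res_cycle (f (res_d X n x)), forall w, @P_ n (wlen w) (f (gen w)) &
  match n return (X n -> P n) -> Prop with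
  | 0 => fun f => forall x, res_eps P (f x) = res_eps X x
  | _ => fun _ => True
  end f].
have [||f [fi fE]] := @dependent_choice _ inv
  (fun n f g => forall x, res_d P n (g x) = f (res_d X n x)).
- have [c [cD cV cE cS]] := homogeneous_components (dP 0).
  have c0 i : c i 0 = 0 by apply: (addrI (c i 0)); rewrite -cD !addr0.
  have ce x : res_eps P (c 0 x) = res_eps P x.
    have [s us ->] := cS x; rewrite (big_morph (c 0) (cD 0) (c0 0)) !linear_sum.
    apply: eq_bigr => i _; rewrite (cE _ _ _ (cV i x)); case: eqP => [//|i0].
    by have /concentrated0_comp-> := mg_eps PG (cV i x); [rewrite linear0 | move/esym].
  pose G (w : word a 0) := c 0 (sval (cid (@res_eps_surj _ _ P (q (nel (ntriv (wend w))))))).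
  have Gw w : res_eps P (G w) = q (nel (ntriv (wend w))).
    by rewrite ce; case: (cid _).
  exists (amlin G : {linear X 0 -> P 0}).
  have Ge x : res_eps P (amlin G x) = res_eps X x.
    apply: (@am_ext _ _ _ _ b a 0 S (res_eps P \o amlin G) (res_eps X)) => w /=.
    rewrite amlin_gen linearZ_LR Gw (ameps_gen _ w).
    rewrite q_act; congr (q _); exact: triv_idem b _.
  split=> // [x|w]; first by rewrite /= Ge; exact: (@res_cycle_d _ _ X 0 x).
  rewrite /= amlin_gen /wlen /warrows (tuple0 (val w).2) /=; apply/e0/cV.
- move=> n f [fc fh _].
  have [c [cD cV cE cS]] := homogeneous_components (dP n.+1).
  have [c' [cD' cV' cE' cS']] := homogeneous_components (dP n).
  have c0 i : c i 0 = 0 by apply: (addrI (c i 0)); rewrite -cD !addr0.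
  have c0' i : c' i 0 = 0 by apply: (addrI (c' i 0)); rewrite -cD' !addr0.
  have dc i x : res_d P n (c i x) = c' i (res_d P n x).
    have [s us ->] := cS x; rewrite (big_morph (c i) (cD i) (c0 i)) !linear_sum.
    rewrite (big_morph (c' i) (cD' i) (c0' i)); apply: eq_bigr => j _.
    rewrite (cE _ _ _ (cV j x)) (cE' _ _ _ (mg_d PG (cV j x))).
    by case: eqP => // _; rewrite linear0.
  have ex (w : word a n.+1) : exists x, res_d P n x = f (res_d X n (gen w)).
    exact/res_cycleP/fc.
  have hom w : @P_ n (wlen w) (f (res_d X n (gen w))).
    have [w0 [y [_ ws _ _ dw]]] := chain_split w.
    rewrite (dw : res_d X n (gen w) = (gen w0 : X n) <| nel y) linearZ_LR.
    have := (mg_graded PG n).2 _ _ _ _ (fh w0) (nel_grading y).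
    by rewrite /wlen /warrows ws map_rcons flatten_rcons size_cat.
  pose G (w : word a n.+1) := c (wlen w) (sval (cid (ex w))).
  have Gw w : res_d P n (G w) = f (res_d X n (gen w)).
    by rewrite dc (svalP (cid (ex w))) (cE' _ _ _ (hom w)) eqxx.
  have Ge x : res_d P n (amlin G x) = f (res_d X n x).
    apply: (@am_ext _ _ _ _ b a n.+1 _ (res_d P n \o amlin G) (f \o res_d X n)) => w /=.
    by rewrite amlin_gen linearZ_LR Gw -!linearZ_LR gen_end.
  exists (amlin G : {linear X n.+1 -> P n.+1}) => //; split=> // [x|w].
    by rewrite /= Ge res_dd linear0.
  by rewrite /= amlin_gen; apply/e0/cV.
exists f; split=> // [x|n w]; first by case: (fi 0) => _ _; apply.
by case: (fi n).
Qed.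

(** Only the map [f] to [P] is homogeneous; the map [g] back is arbitrary. As [P n] is generated in
    degree [d], an element deprived of its component of degree [d] is a combination of radical
    multiples, and [g] sends it into the radical. If [wlen w] were not [d], this would apply to all
    of [f n (gen w)], and [gen w] itself would be in the radical. *)
Lemma wlen_stacked D A n (w : word a n) : stacked P_ D A -> wlen w = delta D A n.
Proof.
move=> [_ _ /(_ n (chain_le_gldim w)) gd]; apply: contrapT => ne.
have [f [fe fd fh]] := graded_comparison.
have [g [ge ggd]] := comparison_map P X.
have [c [cD cV cE _]] := homogeneous_components (mg_graded PG n).1.
set d : int := delta D A n in gd.
have c0 : c d 0 = 0 by apply: (addrI (c d 0)); rewrite -cD !addr0.
pose ok y := amrad (g n (y - c d y) : anick_mod a n).
have ok0 : ok 0 by rewrite /ok c0 subr0 linear0; apply: amrad0.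
have okD x y : ok x -> ok y -> ok (x + y).
  by move=> hx hy; rewrite /ok cD opprD addrACA linearD; exact: (amradD hx hy).
have okx x : ok x.
  elim/sums_ind: {x}(gd x) => // _ [m [z [md ->]]].
  elim/(bas_ind (b := b)): z => [|y z yo zo|k x]; first by rewrite scale0r.
    by rewrite scalerDl; apply: okD.
  have xh := (mg_graded PG n).2 _ _ _ _ md (length_gradingZ k (nel_grading x)).
  rewrite /ok (cE _ _ _ xh); case: (posnP (len x)) => [x0|xp].
    by rewrite x0 addr0 eqxx subrr linear0; apply: amrad0.
  rewrite -[X in X == _]addr0 (inj_eq (addrI _)) eq_sym.
  case: eqP => [[x0]|_]; first by rewrite x0 in xp.
  rewrite subr0 linearZ_LR; apply: amrad_act => v; rewrite linearZ /=.
  rewrite (nontriv_bas (b := b)) ?mulr0 // => v' xv'; by rewrite xv' in xp.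
pose k m : {linear X m -> X m} := g m \o f m.
have ke x : res_eps X (k 0%N x) = res_eps X x by rewrite /= ge fe.
have kd m x : res_d X m (k m.+1 x) = k m (res_d X m x) by rewrite /= ggd fd.
have h1 := endo_lift_id ke kd (gen w); have := okx (f n (gen w)).
rewrite /ok (cE _ _ _ (fh n w)) (_ : (d == _) = false); last first.
  by apply/negP => /eqP[] /esym.
rewrite subr0 => h2; case: (@gen_notin_rad _ _ _ _ b a n w).
have -> : gen w = k n (gen w) - (k n (gen w) - gen w) :> anick_mod a n.
  by rewrite opprB addrC addrNK.
by apply: amradD => //; apply: amradN.
Qed.

End Graded.
End StackedLengths.

(** * Combinatorics of chains in stacked algebras *)

(** In degree 1 this would read [D + A = 1 + D]. *)
Lemma deltaD2 D A n : (1 < n)%N -> delta D A n.+2 = (delta D A n + D)%N.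
Proof. by case: n => [|[|n]] // _; rewrite /= !negbK; case: ifP => _; lia. Qed.

Section Delta.
Variables D A : nat.
Local Open Scope nat_scope.
Local Notation delta := (delta D A).

Lemma delta_even n : 1 < n -> ~~ odd n -> delta n = n./2 * D.
Proof. by case: n => [|[|n]] //= _ /negPf->. Qed.

Lemma delta_odd n : 1 < n -> odd n -> delta n = n./2 * D + A.
Proof. by case: n => [|[|n]] //= _ ->. Qed.

Lemma deltaS_odd n : 1 < n -> odd n -> delta n.+1 = delta n + D - A.
Proof.
move=> n1 on; have on' : ~~ odd n.+1 by rewrite /= on.
have h : n.+1./2 = n./2.+1 by rewrite -[n.+1./2]/(uphalf n) uphalf_half on.
by rewrite (delta_even (leqW n1) on') (delta_odd n1 on) h; lia.
Qed.

Lemma deltaS_even n : 1 < n -> ~~ odd n -> delta n.+1 = delta n + A.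
Proof.
move=> n1 on; have on' : odd n.+1 by rewrite /= on.
have h : n.+1./2 = n./2 by rewrite -[n.+1./2]/(uphalf n) uphalf_half (negPf on).
by rewrite (delta_odd (leqW n1) on') (delta_even n1 on) h.
Qed.

Lemma delta_ge n : 1 < n -> D <= delta n.
Proof.
move=> n1; have : 0 < n./2 by case: n n1 => [|[|n]].
by case: (boolP (odd n)) => on; [rewrite delta_odd | rewrite delta_even] => //; nia.
Qed.

Lemma delta_dvd n : A %| D -> 1 < n -> A %| delta n.
Proof.
move=> AD n1; case: (boolP (odd n)) => on; [rewrite delta_odd | rewrite delta_even] => //.
  by rewrite dvdn_addl // dvdn_mull.
by rewrite dvdn_mull.
Qed.

End Delta.

Section Chains.
Variables (K : fieldType) (Q : quiver) (rho : qpath Q -> Prop) (L : algType K).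
Variable (pi : {lrmorphism path_algebra K Q -> L}).
Hypothesis piP : is_quotient (path_ideal K rho) pi.
Variable N : nat.
Hypothesis pi_long : forall p, (N <= plen p)%N -> pi (path_elt p) = 0.
Hypothesis pi_short : forall p, (plen p <= 1)%N -> pi (path_elt p) <> 0.

Local Notation a := (npath_anick piP pi_long pi_short).
Local Notation Ar := (arr Q).
Local Notation pel := (pel pi).
Local Notation np := (npath pi N).

Definition chain n := word a n.
Definition cstart n (w : chain n) : vert Q := (val w).1.
Definition cletters n (w : chain n) : seq np := (val w).2.
Definition carrows n (w : chain n) : seq Ar := warrows w.
Definition clast n (w : chain n) : np := wlast w.
Definition cend n (w : chain n) : vert Q := wend w.

Lemma chain_step n (w : chain n.+1) : exists (w0 : chain n) (y : np),
  [/\ cstart w = cstart w0, cletters w = rcons (cletters w0) y,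
      carrows w = carrows w0 ++ narrows y, nfollow (clast w0) y & clast w = y].
Proof.
have [w0 [y [wv ws wy wl _]]] := word_split w; exists w0, y; split=> //.
by rewrite /carrows /warrows ws map_rcons flatten_rcons.
Qed.

Lemma chain_extend n (w0 : chain n) (y : np) : nfollow (clast w0) y ->
  exists w : chain n.+1,
  [/\ cstart w = cstart w0, carrows w = carrows w0 ++ narrows y & clast w = y].
Proof.
move=> wy; have [||w [_ v' s' l']] := @gensP _ _ _ _ _ a n.+1 (val w0).1 (rcons (val w0).2 y).
- by rewrite size_rcons size_tuple.
- by rewrite rcons_path (valP w0).
exists w; split=> //; last by rewrite [LHS]l' last_rcons.
by rewrite /carrows /warrows s' map_rcons flatten_rcons.
Qed.

Lemma chain0_ex v : exists w : chain 0,
  [/\ cstart w = v, carrows w = [::] & clast w = ntriv N pi_short v].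
Proof.
have [//|//|w [_ v' s' l']] := @gensP _ _ _ _ _ a 0 v [::].
by exists w; split=> //; rewrite /carrows /warrows s'.
Qed.

Lemma carrows0 (w : chain 0) : carrows w = [::].
Proof. by rewrite /carrows /warrows (tuple0 (val w).2). Qed.

Lemma clast0 (w : chain 0) : clast w = ntriv N pi_short (cstart w).
Proof. by rewrite /clast /wlast (tuple0 (val w).2). Qed.

Lemma chain_ext n (w w' : chain n) :
  cstart w = cstart w' -> cletters w = cletters w' -> w = w'.
Proof.
move=> vE sE; apply: val_inj; rewrite [LHS]surjective_pairing [RHS]surjective_pairing.
by congr pair; [exact: vE | apply: val_inj].
Qed.

Lemma cend_last n (w : chain n) : cend w = nend (clast w).
Proof. by []. Qed.

Lemma chain_walk n (w : chain n) :
  walk (cstart w) (carrows w) /\ endp (cstart w) (carrows w) = cend w.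
Proof.
elim: n w => [|n IH] w.
  by rewrite carrows0 cend_last clast0.
have [w0 [y [-> _ -> /and3P[/eqP uy _ _] wl]]] := chain_step w.
have [ww we] := IH w0; rewrite walk_cat ww endp_cat we -/(endp _ _) we.
rewrite cend_last uy cend_last wl; split; last by [].
exact: pel_walk (npathP y).
Qed.

End Chains.

(** * Positions of the zero factors of length [D] *)

Section StackedChains.
Variables (K : fieldType) (Q : quiver) (rho : qpath Q -> Prop) (L : algType K).
Variable (pi : {lrmorphism path_algebra K Q -> L}).
Hypothesis piP : is_quotient (path_ideal K rho) pi.
Variable N : nat.
Hypothesis pi_long : forall p, (N <= plen p)%N -> pi (path_elt p) = 0.
Hypothesis pi_short : forall p, (plen p <= 1)%N -> pi (path_elt p) <> 0.

Local Notation chain := (chain piP pi_long pi_short).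
Local Notation Ar := (arr Q).
Local Notation pel := (pel pi).
Local Notation np := (npath pi N).

Variable D : nat.
Hypothesis D_gt2 : (2 < D)%N.

Local Open Scope nat_scope.

(* Independent of the source, which a nonempty walk determines. *)
Definition zf (s : seq Ar) : bool := [forall v, pel v s == 0%R].

Lemma zf_cat s1 s2 s3 : zf s2 -> zf (s1 ++ s2 ++ s3).
Proof.
move=> /forallP z; apply/forallP => v.
by rewrite !pel_cat (eqP (z _)) mul0r mulr0.
Qed.

Lemma zf_pel v s : zf s -> pel v s = 0%R.
Proof. by move=> /forallP/(_ v)/eqP. Qed.

Lemma zf_walk v s : s != [::] -> walk v s -> pel v s = 0%R -> zf s.
Proof.
case: s => // x s _ /= /andP[/eqP <- w] z; apply/forallP => u.
case: (qsrc x =P u) => [<-|ne]; first by rewrite z.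
by rewrite /pel insubF // /= (introF eqP ne).
Qed.

(** A zero factor of length [D] at position [j]. By [zf_zat] and [zat_zf], the walks that vanish are
    those containing such a factor. *)
Definition zat (s : seq Ar) (j : nat) : bool := (j + D <= size s) && zf (take D (drop j s)).

Lemma zat_drop s i j : zat (drop i s) j -> zat s (j + i).
Proof. by rewrite /zat size_drop drop_drop => /andP[h ->]; rewrite andbT; lia. Qed.

Lemma drop_zat s i j : i <= j -> zat s j -> zat (drop i s) (j - i).
Proof.
by rewrite /zat size_drop drop_drop => ij /andP[h]; rewrite subnK // => ->; rewrite andbT; lia.
Qed.

Lemma zat_take s k j : j + D <= k -> zat (take k s) j = zat s j && (j + D <= size (take k s)).
Proof.
move=> jk; rewrite /zat size_take_min.
have -> : take D (drop j (take k s)) = take D (drop j s).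
  by rewrite !take_drop take_takel //; lia.
case: zf; rewrite ?andbF ?andbT //; lia.
Qed.

Lemma zat_zf s j : zat s j -> zf s.
Proof.
case/andP=> _ /(zf_cat (take j s) (drop D (drop j s))).
by rewrite !cat_take_drop.
Qed.

Lemma walk_drop (v : vert Q) (s : seq Ar) i : walk v s -> walk (endp v (take i s)) (drop i s).
Proof. by rewrite -{1}(cat_take_drop i s) walk_cat => /andP[]. Qed.

Lemma walk_take (v : vert Q) (s : seq Ar) i : walk v s -> walk v (take i s).
Proof. by rewrite -{1}(cat_take_drop i s) walk_cat => /andP[]. Qed.

Lemma zat_bound s j : zat s j -> j + D <= size s.
Proof. by case/andP. Qed.

Lemma walk_start (v v' : vert Q) (s : seq Ar) : s != [::] -> walk v s -> walk v' s -> v = v'.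
Proof. by case: s => // x s _ /= /andP[/eqP-> _] /andP[/eqP->]. Qed.

Variable A : nat.
Hypothesis clen : forall n (w : chain n), size (carrows w) = delta D A n.
Hypothesis A_gt1 : 1 < A.
Hypothesis D_neq : D <> 2 * A.

Lemma npath_of v s : pel v s != 0%R ->
  exists2 x : np, nstart x = v & narrows x = s.
Proof. by move=> /(mknpathP pi_long)[x _ [xv xs]]; exists x. Qed.

Lemma chain1_ex v x s : walk v (x :: s) -> exists w : chain 1,
  [/\ cstart w = v, carrows w = [:: x] & narrows (clast w) = [:: x]].
Proof.
move=> /= /andP[vx _]; have wx : walk v [:: x] by rewrite /= vx.
have [y yv ys] := npath_of (pel_short pi_short wx isT).
have [w0 [w0v w0s w0l]] := chain0_ex piP pi_long pi_short v.
have [|w [wv ws wl]] := @chain_extend _ _ _ _ _ piP N pi_long pi_short 0 w0 y.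
  by rewrite w0l /nfollow ys yv eqxx.
by exists w; rewrite wv ws wl w0s w0v ys.
Qed.

(** The tails are the first arrow and the rest. All that is known about relations is the length of
    chains, so exhibiting a chain is the way to learn that minimal zero walks have length
    [delta 2 = D]. *)
Lemma minimal_zero v s : walk v s -> s != [::] -> zf s ->
  (forall k, k < size s -> ~~ zf (take k s)) -> ~~ zf (behead s) ->
  exists w : chain 2, cstart w = v /\ carrows w = s.
Proof.
case: s => // x s wk _ z tk bh.
have [w1 [w1v w1s w1l]] := chain1_ex wk.
have s0 : s != [::].
  apply/eqP => s0; move: (pel_short pi_short wk).
  by rewrite (zf_pel v z) eqxx s0 => /(_ isT).
move/andP: (wk) => [/eqP vx ws]; have ns : pel (qtgt x) s != 0%R.
  by apply: contraNneq bh => /(zf_walk s0 ws).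
have [y yv ys] := npath_of ns.
have lx : nend (clast w1) = qtgt x.
  by rewrite -cend_last -(chain_walk w1).2 w1s /endp.
have lv : nstart (clast w1) = v.
  by have := pel_walk (npathP (clast w1)); rewrite w1l /= andbT => /eqP <-.
have [|w [wv wsE wl]] := @chain_extend _ _ _ _ _ piP N pi_long pi_short 1 w1 y.
  rewrite /nfollow w1l lx yv eqxx ys s0 /= lv (zf_pel v z) eqxx /=.
  apply: contra (tk (size s) (leqnn _)) => /eqP p0; move: p0.
  have -> : x :: take (size s).-1 s = take (size s) (x :: s) by case: (s) s0.
  move=> p0; have wt := walk_take (size s) wk; apply: (zf_walk _ wt p0).
  by case: (s) s0.
by exists w; rewrite wv wsE w1s w1v ys.
Qed.

(** Arrows are removed at either end while the walk remains zero. A walk from which none can be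
    removed is a 2-chain, hence of length [D]. *)
Lemma zf_zat v s : walk v s -> zf s -> exists j, zat s j.
Proof.
have [n] := ubnP (size s); elim: n v s => // n IH v s sn wk z.
have s0 : s != [::].
  apply/eqP => s0; have := @pel_short _ _ _ _ pi_short v [::] isT isT.
  by rewrite -s0 (zf_pel v z) eqxx.
case: (boolP [exists k : 'I_(size s), zf (take k s)]) => [/existsP[k zk]|].
  have [|j jz] := IH v (take k s) _ (walk_take _ wk) zk.
    by rewrite size_take ltn_ord; have := ltn_ord k; lia.
  have jb : j + D <= k by case/andP: (jz) => + _; rewrite size_take ltn_ord.
  by exists j; move: jz; rewrite zat_take // => /andP[].
rewrite negb_exists => /forallP tk.
case: (boolP (zf (behead s))) => [zb|bh].
  rewrite -drop1 in zb.
  have [|j jz] := IH _ (drop 1 s) _ (walk_drop 1 wk) zb.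
    by rewrite size_drop; case: (s) s0 sn => //= ? ? _; lia.
  by exists (j + 1); apply: zat_drop.
have [|w [wv ws]] := minimal_zero wk s0 z _ bh.
  by move=> k ks; apply: (tk (Ordinal ks)).
exists 0; rewrite /zat drop0.
by have sD := clen w; rewrite ws /= mul1n in sD; rewrite sD leqnn take_oversize ?sD.
Qed.

Lemma short_nonzero v s : walk v s -> size s < D -> pel v s != 0%R.
Proof.
case: (s =P [::]) => [-> _ _|/eqP s0 wk sD]; first exact: pel_short.
by apply/eqP => /(zf_walk s0 wk)/(zf_zat wk)[j /andP[]]; lia.
Qed.

Lemma zat_walk v s : walk v s -> (forall j, ~~ zat s j) -> pel v s != 0%R.
Proof.
case: (s =P [::]) => [-> _ _|/eqP s0 wk nz]; first exact: pel_short.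
by apply/eqP => /(zf_walk s0 wk)/(zf_zat wk)[j]; rewrite (negPf (nz j)).
Qed.

(* Tails of lengths 1, D - 1, j. *)
Lemma chain3_ex v s j : walk v s -> size s = j + D -> 0 < j < D -> zat s 0 -> zat s j ->
  (forall i, 0 < i < j -> ~~ zat s i) -> exists w : chain 3, carrows w = s.
Proof.
move=> wk sj /andP[j0 jD] z0 zj nz.
have szD : size (take D s) = D by rewrite size_takel; lia.
have [||||w2 [w2v w2s]] := @minimal_zero v (take D s) (walk_take D wk).
- by rewrite -size_eq0 szD; lia.
- by move: z0; rewrite /zat drop0 => /andP[].
- move=> k; rewrite szD => kD; rewrite take_takel ?(ltnW kD) //.
  apply/negP => /(zf_pel v); apply/eqP/short_nonzero; first exact: walk_take.
  by rewrite size_takel; lia.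
- rewrite -drop1; have wd := walk_drop 1 (walk_take D wk).
  apply/negP => /(zf_pel (endp v (take 1 (take D s)))); apply/eqP/short_nonzero => //.
  by rewrite size_drop szD; lia.
have [w1 [u2 [_ _ w2E w2f w2l]]] := chain_step w2.
have u2s : narrows u2 = drop 1 (take D s).
  have w1n := clen w1; rewrite /= in w1n.
  by rewrite -w2s w2E drop_cat w1n ltnn subnn drop0.
have e2 : nend (clast w2) = endp v (take D s).
  by rewrite -cend_last -(chain_walk w2).2 w2v w2s.
have wd := walk_drop D wk.
have [u3 u3v u3s] : exists2 x : np, nstart x = endp v (take D s) & narrows x = drop D s.
  apply/npath_of/short_nonzero; first exact: wd.
  by rewrite size_drop; lia.
have u23 : narrows u2 ++ narrows u3 = drop 1 s.
  rewrite u2s u3s -[in RHS](cat_take_drop D s) drop_cat szD.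
  by case: ltnP => //; lia.
have wu : walk (nstart u2) (drop 1 s).
  rewrite -u23 walk_cat (pel_walk (npathP u2)) /= -/(endp _ _) -/(nend u2) -w2l e2 -u3v.
  exact: pel_walk (npathP u3).
have [|w [_ ws _]] := @chain_extend _ _ _ _ _ piP N pi_long pi_short 2 w2 u3.
  rewrite /nfollow e2 u3v eqxx u3s -size_eq0 size_drop sj addnK -lt0n j0 w2l /=.
  rewrite -size_eq0 u2s size_drop szD; case: eqP => [|_]; first by lia.
  rewrite -u2s -u3s u23; apply/andP; split.
    apply/eqP/zf_pel; apply: (@zat_zf _ (j - 1)); exact: drop_zat.
  have -> : narrows u2 ++ take j.-1 (narrows u3) = take (D + j - 2) (drop 1 s).
    rewrite -u23 take_cat u2s size_drop szD; case: ltnP; first by lia.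
    by move=> _; congr (_ ++ take _ _); lia.
  apply: zat_walk; first exact: walk_take.
  move=> i; apply/negP => zi.
  have iD : i + D <= D + j - 2.
    by move: zi => /andP[+ _]; rewrite size_take_min; lia.
  move: zi; rewrite zat_take // => /andP[/zat_drop zi _].
  by move: zi; apply/negP/nz; lia.
by exists w; rewrite ws w2s u3s cat_take_drop.
Qed.

(** The next zero factor after the one at 0 overlaps it, because [j < D], and forms a 3-chain with
    it. A 3-chain has length [D + A], so this factor starts at [A], and the argument is repeated
    from there. *)
Lemma zat_multiple v s j : walk v s -> zat s 0 -> zat s j -> j < D ->
  A %| j /\ forall i, i * A <= j -> zat s (i * A).
Proof.
have [n] := ubnP j; elim: n j v s => // n IH j v s jn wk z0 zj jD.
case: (posnP j) => [->|j0].
  by split=> // i; rewrite leqn0 muln_eq0; case: (i =P 0) => [-> //|_] /=; lia.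
have ex : exists i, (0 < i) && zat s i by exists j; rewrite j0.
case: (ex_minnP ex) => i /andP[i0 zi] imin.
have ij : i <= j by apply: imin; rewrite j0.
have bi := zat_bound zi; have bj := zat_bound zj.
have iA : i = A.
  have [|||||w ws] := @chain3_ex v (take (i + D) s) i (walk_take _ wk).
  - by rewrite size_takel.
  - by rewrite i0 /=; lia.
  - by rewrite zat_take ?z0 ?size_takel //; lia.
  - by rewrite zat_take // zi size_takel /=.
  - move=> k /andP[k0 ki]; rewrite zat_take; last by lia.
    by apply/negP => /andP[zk _]; have := imin k; rewrite k0 zk => /(_ isT); lia.
  have := clen w; rewrite ws size_takel // /= mul1n; lia.
subst i; have [||||dv mu] := IH (j - A) _ (drop A s) _ (walk_drop A wk).
- by lia.
- by have := drop_zat (leqnn A) zi; rewrite subnn.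
- exact: drop_zat.
- by lia.
split=> [|i iAj]; first by rewrite -(subnK ij) dvdn_addl.
case: i iAj => [|i] iAj; first by rewrite mul0n.
rewrite mulSn addnC; apply: zat_drop; apply: mu.
by rewrite mulSn in iAj; lia.
Qed.

Lemma zat_between v s i j : walk v s -> zat s i -> zat s j -> i <= j < i + D ->
  A %| i -> A %| j /\ forall k, i <= k * A <= j -> zat s (k * A).
Proof.
move=> wk zi zj /andP[ij jD] /dvdnP[m mE].
have z0 : zat (drop i s) 0 by have := drop_zat (leqnn i) zi; rewrite subnn.
have [|dv mu] := zat_multiple (walk_drop i wk) z0 (drop_zat ij zj); first by lia.
split=> [|k /andP[k1 k2]]; first by rewrite -(subnK ij) dvdn_addr // mE dvdn_mull.
have -> : k * A = (k - m) * A + i by rewrite mE mulnBl subnK // -mE.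
by apply/zat_drop/mu; rewrite mulnBl -mE; lia.
Qed.

Definition good (s : seq Ar) : Prop := forall j, j * A + D <= size s -> zat s (j * A).

Local Notation delta := (delta D A).

Lemma follow_zf (u y : np) : nfollow u y -> narrows u != [::] -> zf (narrows u ++ narrows y).
Proof.
move=> /and3P[/eqP uy yn H] un; rewrite (negPf un) in H.
have /andP[/eqP z _] := H; apply: (zf_walk _ _ z).
  by rewrite -size_eq0 size_cat addn_eq0 negb_and !size_eq0 un.
by rewrite walk_cat (pel_walk (npathP u)) -/(endp _ _) -/(nend u) uy (pel_walk (npathP y)).
Qed.

Lemma follow_nonempty (u y : np) : nfollow u y -> 0 < size (narrows y).
Proof. by case/and3P; rewrite lt0n size_eq0. Qed.

Lemma chain_prefix n (w : chain n) m : m <= n -> exists w' : chain m,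
  cstart w' = cstart w /\ carrows w' = take (delta m) (carrows w).
Proof.
elim: n w => [|n IH] w.
  by rewrite leqn0 => /eqP->; exists w; rewrite -[delta 0](clen w) take_size.
rewrite leq_eqVlt => /orP[/eqP->|mn]; first by exists w; rewrite -(clen w) take_size.
have [w0 [y [-> _ -> _ _]]] := chain_step w.
have [w' [wv ws]] := IH w0 mn; exists w'; split=> //; rewrite takel_cat //.
by rewrite -(clen w') ws size_take_min geq_minr.
Qed.

Lemma chain_last2 n (w : chain n.+2) :
  [/\ zf (drop (delta n) (carrows w)), ~~ zf (drop (delta n.+1) (carrows w))
    & delta n.+1 < delta n.+2].
Proof.
have [w1 [y [_ _ wE wy _]]] := chain_step w.
have [w0 [u [_ _ w1E wu ul]]] := chain_step w1.
have sw1 := clen w1; have sw0 := clen w0; have sw := clen w.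
split.
- rewrite wE w1E -catA drop_cat sw0 ltnn subnn drop0 -ul.
  by apply: follow_zf => //; rewrite ul -size_eq0 -lt0n (follow_nonempty wu).
- rewrite wE drop_cat sw1 ltnn subnn drop0; apply/negP => /(zf_pel (nstart y)) z.
  by have := npathP y; rewrite z eqxx.
by rewrite -sw -sw1 wE size_cat -{1}[size (carrows w1)]addn0 ltn_add2l (follow_nonempty wy).
Qed.

Lemma chain2_zat (w : chain 2) : zat (carrows w) 0.
Proof.
have [z _ _] := chain_last2 w; have sD : size (carrows w) = D by rewrite clen /= mul1n.
by rewrite /zat add0n sD leqnn drop0 take_oversize ?sD //; rewrite drop0 in z.
Qed.

Lemma chain_zat0 n (w : chain n) : 1 < n -> zat (carrows w) 0.
Proof.
move=> n1; have [w2 [_ ws]] := chain_prefix w n1; have := chain2_zat w2.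
by rewrite ws zat_take /= ?mul1n // => /andP[].
Qed.

(** The last two tails contain a zero factor, at a position below [D] because the last tail is
    nonzero. This positive position is a multiple of [A], and at most [A] by the total length
    [D + A]. *)
Lemma chain3_zat (w : chain 3) : A < D /\ zat (carrows w) A.
Proof.
have [wk _] := chain_walk w; have [z nz _] := chain_last2 w.
have sD : size (carrows w) = D + A by rewrite clen /= mul1n.
have [i zi] := zf_zat (walk_drop 1 wk) z.
have {}zi := zat_drop zi; have bi := zat_bound zi; rewrite sD in bi.
have iD : i + 1 < D.
  rewrite ltnNge; apply: contra nz => Di; apply: (@zat_zf _ (i + 1 - D)).
  by rewrite /= mul1n; apply: drop_zat.
have [] := zat_multiple wk (chain_zat0 w isT) zi iD.
move=> /dvdnP[k kE] _; have k1 : k = 1 by nia.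
by subst k; rewrite mul1n in kE; rewrite -kE.
Qed.

Lemma chain_lt n (w : chain n) : 2 < n -> A < D.
Proof. by move=> n1; have [w3 _] := chain_prefix w n1; have [] := chain3_zat w3. Qed.

Lemma chain_zatA n (w : chain n) : 2 < n -> zat (carrows w) A.
Proof.
move=> n1; have [w3 [_ ws]] := chain_prefix w n1; have [_] := chain3_zat w3.
have AD : A + D <= delta 3 by rewrite /= mul1n addnC.
by rewrite ws zat_take // => /andP[].
Qed.

(** From degree 4 on the last two tails have total length [D], so that together they are a zero
    factor. *)
Lemma chain_last_zat n (w : chain n.+4) : zat (carrows w) (delta n.+2).
Proof.
have e : delta n.+4 = delta n.+2 + D by apply: deltaD2.
have [z _ _] := chain_last2 w; rewrite /zat clen e leqnn.
by rewrite take_oversize // size_drop clen e addKn.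
Qed.

(** A 4-chain has zero factors at [A] and at [delta 2 = D]. They overlap, so their distance is a
    multiple of [A]. *)
Lemma chain_dvd n (w : chain n) : 3 < n -> A %| D.
Proof.
move=> n3; have AD := chain_lt w (ltnW n3).
have [w4 _] := chain_prefix w n3; have [wk _] := chain_walk w4.
have := chain_last_zat w4; rewrite /= mul1n => zD.
by have [||] // := zat_between wk (chain_zatA w4 isT) zD; lia.
Qed.

Lemma chain_good n (w : chain n.+2) : good (carrows w).
Proof.
elim: n w => [|n IH] w j; rewrite clen.
  rewrite /= mul1n => jD; have -> : j = 0 by nia.
  exact: chain_zat0.
case: n IH w => [|n] IH w.
  rewrite /= mul1n => jD; have : j <= 1 by nia.
  by case: j {jD} => [|[|]] // _; [apply: chain_zat0 | rewrite mul1n; apply: chain_zatA].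
move=> jD; have AD := chain_dvd w isT; have ltAD := chain_lt w isT; have [wk _] := chain_walk w.
have [w' [_ ws]] := chain_prefix w (leqnSn n.+3).
case: (leqP (j * A + D) (delta n.+3)) => [jD'|jD'].
  have := IH w' j; rewrite clen => /(_ jD'); rewrite ws zat_take //.
  by case/andP.
(* The positions left over lie between the last one inside the prefix [w'], which is
   [delta n.+3 - D], and the zero factor ending [w], at [delta n.+2]. These two overlap, and
   [zat_between] fills in the multiples of [A] between them. *)
have zp : zat (carrows w) (delta n.+3 - D).
  have dp : A %| delta n.+3 - D by rewrite dvdn_sub // delta_dvd.
  have := IH w' ((delta n.+3 - D) %/ A); rewrite divnK // subnK ?delta_ge // clen => /(_ (leqnn _)).
  by rewrite ws zat_take ?subnK ?delta_ge // => /andP[].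
have ze := chain_last_zat w; have D3 : D <= delta n.+3 by apply: delta_ge.
have e : delta n.+4 = delta n.+2 + D by apply: deltaD2.
have e' : delta n.+4 < delta n.+3 + D.
  by case: (boolP (odd n.+3)) => on; [rewrite (@deltaS_odd D A n.+3) | rewrite (@deltaS_even D A n.+3)] => //; lia.
have e'' : delta n.+3 <= delta n.+4.
  by case: (boolP (odd n.+3)) => on; [rewrite (@deltaS_odd D A n.+3) | rewrite (@deltaS_even D A n.+3)] => //; lia.
have [||_ H] := zat_between wk zp ze; first by lia.
  by rewrite dvdn_sub // delta_dvd.
by apply: H; lia.
Qed.

(** The path is cut at the lengths [delta i]. From degree 4 on the last two pieces form one of the
    prescribed zero factors of length [D]; since no walk shorter than [D] vanishes, the last piece
    is a minimal continuation, as [nfollow] demands. *)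
Lemma chain_of_good n v s : 1 < n -> walk v s -> size s = delta n -> good s ->
  (2 < n -> A < D) -> (3 < n -> A %| D) ->
  exists w : chain n, cstart w = v /\ carrows w = s.
Proof.
elim: n v s => [|n IH] v s //; case: n IH => [|[|n]] IH // _ wk sn gs AD dv.
- rewrite /= mul1n in sn; apply: (minimal_zero wk).
  + by rewrite -size_eq0 sn; lia.
  + have := gs 0; rewrite /zat sn leqnn drop0 take_oversize ?sn //=; exact.
  + move=> k; rewrite sn => kD; apply/negP => /(zf_pel v); apply/eqP/short_nonzero.
      exact: walk_take.
    by rewrite size_take_min; lia.
  + rewrite -drop1; apply/negP => /(zf_pel (endp v (take 1 s))); apply/eqP/short_nonzero.
      exact: walk_drop.
    by rewrite size_drop sn; lia.
have {}AD := AD isT.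
case: n IH sn dv => [|n] IH sn dv.
  rewrite /= mul1n in sn.
  have z0 : zat s 0 by have := gs 0; rewrite mul0n add0n sn; apply; lia.
  have zA : zat s A by have := gs 1; rewrite mul1n sn; apply; lia.
  have nz i : 0 < i < A -> ~~ zat s i.
    move=> /andP[i0 iA]; apply/negP => zi.
    have [dvi _] := zat_multiple wk z0 zi (ltn_trans iA AD).
    by have := dvdn_leq i0 dvi; lia.
  have [||w ws] := chain3_ex wk _ _ z0 zA nz.
  - by rewrite sn addnC.
  - by rewrite AD andbT; lia.
  exists w; split=> //; have [wk' _] := chain_walk w; rewrite ws in wk'.
  by apply: walk_start wk' wk; rewrite -size_eq0 sn; lia.
have {}dv := dv isT; have e : delta n.+4 = delta n.+2 + D by apply: deltaD2.
have e3 : delta n.+4 = delta n.+3 + (delta n.+4 - delta n.+3) /\ 0 < delta n.+4 - delta n.+3 < D.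
  by case: (boolP (odd n.+3)) => on; [rewrite (@deltaS_odd D A n.+3) | rewrite (@deltaS_even D A n.+3)] => //; lia.
have e2 : delta n.+2 <= delta n.+3.
  by case: (boolP (odd n.+2)) => on; [rewrite (@deltaS_odd D A n.+2) | rewrite (@deltaS_even D A n.+2)] => //; lia.
have st : size (take (delta n.+3) s) = delta n.+3 by rewrite size_takel // sn; lia.
have gt : good (take (delta n.+3) s).
  move=> j; rewrite st => jD; rewrite zat_take // st jD andbT; apply: gs.
  by rewrite sn; lia.
have [w0 [w0v w0s]] := IH _ _ isT (walk_take _ wk) st gt (fun _ => AD) (fun _ => dv).
have [w1 [u [_ _ w0E wu ul]]] := chain_step w0.
have us : narrows u = drop (delta n.+2) (take (delta n.+3) s).
  by rewrite -w0s w0E drop_cat clen ltnn subnn drop0.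
have eu : nend (clast w0) = endp v (take (delta n.+3) s).
  by rewrite -cend_last -(chain_walk w0).2 w0v w0s.
have [y yv ys] : exists2 y : np, nstart y = endp v (take (delta n.+3) s)
                                & narrows y = drop (delta n.+3) s.
  apply/npath_of/short_nonzero; first exact: walk_drop.
  by rewrite size_drop sn; lia.
have uy : narrows u ++ narrows y = drop (delta n.+2) s.
  rewrite us ys -[in RHS](cat_take_drop (delta n.+3) s) drop_cat st.
  case: ltnP => // h; have -> : delta n.+3 = delta n.+2 by lia.
  by rewrite subnn drop0 drop_oversize // size_takel ?sn //; lia.
have wuy : walk (nstart u) (drop (delta n.+2) s).
  rewrite -uy walk_cat (pel_walk (npathP u)) -/(endp _ _) -/(nend u) -ul eu -yv.
  exact: pel_walk (npathP y).
have sy : size (narrows y) = delta n.+4 - delta n.+3 by rewrite ys size_drop sn.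
have [|w [wv ws _]] := @chain_extend _ _ _ _ _ piP N pi_long pi_short _ w0 y.
  rewrite /nfollow eu yv eqxx -size_eq0 sy -lt0n ul.
  have un : narrows u != [::] by rewrite -size_eq0 -lt0n (follow_nonempty wu).
  rewrite (negPf un); case: e3 => e3 /andP[h0 h3]; rewrite h0 /= uy; apply/andP; split.
    apply/eqP/zf_pel; have dn : A %| delta n.+2 by apply: delta_dvd.
    have := gs (delta n.+2 %/ A); rewrite divnK // sn e leqnn => /(_ isT) /andP[_].
    by rewrite take_oversize // size_drop sn e addKn.
  have -> : narrows u ++ take (delta n.+4 - delta n.+3).-1 (narrows y) = take D.-1 (drop (delta n.+2) s).
    rewrite -uy take_cat us size_drop st; case: ltnP; first by lia.
    by move=> _; congr (_ ++ take _ _); lia.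
  by apply: short_nonzero; [apply: walk_take | rewrite size_take_min; lia].
by exists w; rewrite wv ws w0v w0s ys cat_take_drop.
Qed.

Lemma chain_inj n (w w' : chain n) : cstart w = cstart w' -> carrows w = carrows w' -> w = w'.
Proof.
elim: n w w' => [|n IH] w w'.
  by move=> vE _; apply: chain_ext => //; rewrite /cletters (tuple0 (val w).2) (tuple0 (val w').2).
have [w0 [y [wv wl wE wy _]]] := chain_step w; have [w0' [y' [wv' wl' wE' wy' _]]] := chain_step w'.
move=> vE; rewrite wE wE' => /eqP; rewrite eqseq_cat ?clen // => /andP[/eqP e1 /eqP e2].
have e0 : w0 = w0' by apply: IH => //; rewrite -wv -wv'.
apply: chain_ext => //; rewrite wl wl' e0; congr rcons; apply: npath_ext => //.
by case/and3P: wy => /eqP <- _ _; case/and3P: wy' => /eqP <- _ _; rewrite e0.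
Qed.

End StackedChains.

(** * The basis of the Ext algebra *)

Lemma deltaE D A n :
  delta D A n = (n./2 * D + odd n * (if n == 1 then 1 else A))%N.
Proof.
case: n => [|[|n]] //=.
by rewrite !negbK; case: (odd n); rewrite ?mul1n ?mul0n ?addn0.
Qed.

(** Two odd degrees are the critical case: one more [D] on the right has to absorb [2], [1 + A] or
    [2 * A]. *)
Lemma delta_superadd D A n i : (2 < D)%N -> (1 < A)%N ->
  ((2 < n + i)%N -> (A < D)%N) -> ((3 < n + i)%N -> (2 * A <= D)%N) ->
  (delta D A n + delta D A i <= delta D A (n + i))%N.
Proof.
move=> D2 A1 h3 h4; rewrite !deltaE halfD oddD.
have e (k : nat) : k = (odd k + k./2 * 2)%N by rewrite muln2 odd_double_half.
case: (boolP (odd n)) => on; case: (boolP (odd i)) => oi /=.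
- case: (n =P 1%N) => n1; case: (i =P 1%N) => i1; first by lia.
  + by have : (A < D)%N; [apply: h3; have := e i; rewrite oi; lia | lia].
  + by have : (A < D)%N; [apply: h3; have := e n; rewrite on; lia | lia].
  have := e n; have := e i; rewrite on oi => ei en.
  by have : (2 * A <= D)%N; [apply: h4; lia | lia].
- by case: (n =P 1%N) => n1; case: (n + i =P 1)%N => ni; lia.
- by case: (i =P 1%N) => n1; case: (n + i =P 1)%N => ni; lia.
lia.
Qed.

Section ExplicitLift.
Variables (K : fieldType) (Q : quiver) (rho : qpath Q -> Prop) (L : algType K).
Variable (pi : {lrmorphism path_algebra K Q -> L}).
Hypothesis piP : is_quotient (path_ideal K rho) pi.
Variable N : nat.
Hypothesis pi_long : forall p, (N <= plen p)%N -> pi (path_elt p) = 0.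
Hypothesis pi_short : forall p, (plen p <= 1)%N -> pi (path_elt p) <> 0.

Local Notation a := (npath_anick piP pi_long pi_short).
Local Notation chain := (chain piP pi_long pi_short).
Local Notation Ar := (arr Q).
Local Notation pel := (pel pi).
Local Notation np := (npath pi N).
Local Notation nel := (@nel _ _ _ pi N).

Variables D A : nat.
Hypothesis clen : forall n (w : chain n), size (carrows w) = delta D A n.
Hypothesis D_gt2 : (2 < D)%N.
Hypothesis A_gt1 : (1 < A)%N.
Hypothesis D_neq : D <> (2 * A)%N.
Local Notation delta := (delta D A).

(** Guarantees in [lift_gen_d] that the part [r c] of a longer chain already lies in its prefix
    [w0]. In degree at least 4, [A < D] and the divisibility of [D] by [A] give [2 * A <= D]. *)
Lemma chain_superadd n i (w : chain (n + i)) : (delta n + delta i <= delta (n + i))%N.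
Proof.
apply: delta_superadd => // h; first exact: (chain_lt D_gt2 clen A_gt1 D_neq w).
have := chain_dvd D_gt2 clen A_gt1 D_neq w h; have := chain_lt D_gt2 clen A_gt1 D_neq w (ltnW h).
by move=> AD /dvdnP[k kE]; move: AD D_neq; rewrite kE; case: k kE => [|[|[|k]]] kE; lia.
Qed.

Lemma chain_d n (w : chain n.+1) : exists (w0 : chain n) (y : np),
  [/\ cstart w = cstart w0, carrows w = carrows w0 ++ narrows y,
      nfollow (clast w0) y, clast w = y
    & amd (gen w : anick_mod a n.+1) = (gen w0 : anick_mod a n) <| nel y].
Proof.
have [w0 [y [wv ws wy wl wd]]] := chain_split w; exists w0, y; split=> //.
by rewrite /carrows /warrows ws map_rcons flatten_rcons.
Qed.

Section Lift.
Variables (n : nat) (r : chain n).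

(* The cocycle dual to [r] lifts to the chain map sending [w], which is [r c v] as a
   path, to [c] times [v]. *)
Definition factors i (w : chain (i + n)) (cv : chain i * np) : bool :=
  [&& cstart w == cstart r, carrows w == carrows r ++ carrows cv.1 ++ narrows cv.2,
      cstart cv.1 == cend r & nstart cv.2 == cend cv.1].

Lemma factors_uniq i (w : chain (i + n)) cv cv' :
  factors w cv -> factors w cv' -> cv = cv'.
Proof.
case: cv cv' => [c v] [c' v'] /and4P[_ /eqP wE /eqP /= cr /eqP vc].
move=> /and4P[_ /eqP wE' /eqP /= cr' /eqP vc'].
move: wE'; rewrite wE => /eqP; rewrite eqseq_cat // eqxx /= eqseq_cat ?clen //.
move=> /andP[/eqP e1 /eqP e2]; have cE : c = c'.
  by apply: (chain_inj clen) => //; rewrite cr cr'.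
by rewrite cE; congr pair; apply: npath_ext => //; rewrite vc vc' cE.
Qed.

Definition lift_gen i (w : chain (i + n)) : anick_mod a i :=
  if [pick cv | factors w cv] is Some (c, v) then gen c <| nel v else 0.

Lemma lift_genE i (w : chain (i + n)) c v : factors w (c, v) ->
  lift_gen w = gen c <| nel v.
Proof.
move=> f; rewrite /lift_gen; case: pickP => [cv fcv|/(_ (c, v))]; last by rewrite f.
by rewrite (factors_uniq fcv f).
Qed.

Lemma lift_gen0 i (w : chain (i + n)) : (forall cv, ~~ factors w cv) -> lift_gen w = 0.
Proof. by move=> nf; rewrite /lift_gen; case: pickP => // cv; rewrite (negPf (nf cv)). Qed.

Lemma factors_end i (w : chain (i + n)) c v : factors w (c, v) -> nend v = cend w.
Proof.
move=> /and4P[/eqP wr /eqP wE /eqP /= cr /eqP vc].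
by rewrite -(chain_walk w).2 wE wr !endp_cat (chain_walk r).2 -cr (chain_walk c).2 -vc.
Qed.

Lemma lift_gen_end i (w : chain (i + n)) : lift_gen w <| nel (ntriv N pi_short (cend w)) = lift_gen w.
Proof.
rewrite /lift_gen; case: pickP => [[c v] f|_]; last by rewrite scaler0.
rewrite actA -(factors_end f); congr (_ *: _).
by have := mul_bas_triv (npath_basis piP pi_long pi_short) (nend v) v; rewrite eqxx.
Qed.

Lemma nelM_eq (x y x' y' : np) : nend x = nstart y -> nend x' = nstart y' ->
  nstart x = nstart x' -> narrows x ++ narrows y = narrows x' ++ narrows y' ->
  nel x * nel y = nel x' * nel y'.
Proof. by rewrite /nel !pelM -!/(nend _) => -> -> -> ->; rewrite !eqxx. Qed.

(** If [w = r c' v'], then [w0] passes through [r c], where [c] is [c'] without its last letter, and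
    both sides are [gen c] times the same path. If only [w0 = r c v] factors, then [v u] is 0:
    otherwise [c] could be continued along [v u], and [w] would factor. *)
Lemma lift_gen_d i (w : chain (i.+1 + n)) (w0 : chain (i + n)) (u : np) :
  cstart w = cstart w0 -> carrows w = carrows w0 ++ narrows u -> nfollow (clast w0) u ->
  amd (lift_gen w : anick_mod a i.+1) = lift_gen w0 <| nel u.
Proof.
move=> wv wE wu; have w0u : cend w0 = nstart u by case/and3P: wu => /eqP.
case: (boolP [exists cv, factors w cv]) => [/existsP[[c' v'] f]|].
  rewrite (lift_genE f); have [c [x [cv cE cx cl cd]]] := chain_d c'.
  rewrite linearZ_LR /= cd actA; have /and4P[/eqP wr /eqP /= wE' /eqP c'r /eqP v'c] := f.
  have xv : nend x = nstart v' by rewrite v'c cend_last cl.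
  have cx' : nend (clast c) = nstart x by case/and3P: cx => /eqP.
  have le : (size (carrows r ++ carrows c) <= size (carrows w0))%N.
    by rewrite size_cat !clen addnC chain_superadd.
  have E : carrows w0 ++ narrows u = (carrows r ++ carrows c) ++ (narrows x ++ narrows v').
    by rewrite -wE wE' cE !catA.
  have E0 : carrows w0 = carrows r ++ carrows c ++ drop (size (carrows r ++ carrows c)) (carrows w0).
    rewrite catA -{1}(cat_take_drop (size (carrows r ++ carrows c)) (carrows w0)); congr (_ ++ _).
    by rewrite -(takel_cat (narrows u) le) E take_size_cat.
  have E1 : drop (size (carrows r ++ carrows c)) (carrows w0) ++ narrows u = narrows x ++ narrows v'.
    have := congr1 (drop (size (carrows r ++ carrows c))) E.
    by rewrite drop_cat; case: ltnP => h; rewrite drop_size_cat // => <-;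
      rewrite drop_oversize // (_ : _ - _ = 0)%N ?drop0 //; lia.
  case: (pel (nstart x) (narrows x ++ narrows v') =P 0) => [z|/eqP nz].
    rewrite {1}/nel pelM -/(nend x) xv eqxx z scale0r.
    case: (boolP [exists cv, factors w0 cv]) => [/existsP[[c1 v1] f1]|]; last first.
      by rewrite negb_exists => /forallP nf; rewrite lift_gen0 // scaler0.
    rewrite (lift_genE f1) actA; have /and4P[/eqP w0r /eqP /= w0E /eqP c1r /eqP v1c] := f1.
    move: E; rewrite w0E -!catA => /eqP; rewrite eqseq_cat // eqxx /= eqseq_cat ?clen //.
    move=> /andP[/eqP e1 /eqP e2]; have cc : c1 = c.
      by apply: (chain_inj clen) => //; rewrite c1r -cv c'r.
    rewrite /nel pelM -/(nend v1) (factors_end f1) w0u eqxx e2 v1c cc cend_last cx' z.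
    by rewrite scale0r.
  have [v vs ve] : exists2 v : np, nstart v = nstart x
      & narrows v = drop (size (carrows r ++ carrows c)) (carrows w0).
    by apply: (npath_of pi_long); rewrite -E1 in nz; apply: pel_catl nz.
  have f0 : factors w0 (c, v).
    by rewrite /factors /= -wv wr eqxx ve -E0 eqxx -cv c'r eqxx vs cend_last cx' eqxx.
  rewrite (lift_genE f0) actA; congr (_ *: _); apply: nelM_eq => //.
    by rewrite (factors_end f0).
  by rewrite ve E1.
rewrite negb_exists => /forallP nf; rewrite lift_gen0 // linear0.
case: (boolP [exists cv, factors w0 cv]) => [/existsP[[c v] f]|]; last first.
  by rewrite negb_exists => /forallP nf0; rewrite lift_gen0 // scaler0.
rewrite (lift_genE f) actA; have /and4P[/eqP w0r /eqP /= w0E /eqP cr /eqP vc] := f.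
have vu : nend v = nstart u by rewrite (factors_end f).
case: (pel (nstart v) (narrows v ++ narrows u) =P 0) => [z|/eqP nz].
  by rewrite /nel pelM -/(nend v) vu eqxx z scale0r.
have [z zs ze] := npath_of pi_long nz.
have cz : nend (clast c) = nstart z by rewrite zs vc.
suff ext : nextends (clast c) z.
  have [y [x' [cy yx _]]] := nextends_ex pi_long cz ext.
  have [c' [c'v c'E c'l]] := chain_extend cy.
  have [yx' _ _] := nmul_comp pi_long yx.
  have zE : narrows z = narrows y ++ narrows x'.
    by move: yx; rewrite /nmul yx' eqxx => /(mknpath_Some pi_long)[].
  have := nf (c', x'); rewrite /factors /= wv w0r eqxx wE w0E c'E -!catA -zE ze eqxx /=.
  by rewrite c'v cr eqxx cend_last c'l yx' eqxx.
rewrite /nextends; case: i w w0 wv wE wu w0u c v f w0r w0E cr vc vu nz z zs ze cz nf.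
  move=> w w0 _ _ wu _ c v _ _ _ _ _ _ _ z _ ze _ _.
  rewrite clast0 /= ze -size_eq0 size_cat addn_eq0 negb_and.
  by rewrite -[in X in _ || X]lt0n (follow_nonempty wu) orbT.
move=> i w w0 wv wE wu w0u c v f w0r w0E cr vc vu nz z zs ze cz nf.
have [c0 [x [c0v cE cx cl _]]] := chain_d c.
case: ifP => [/eqP x0|_]; first by have := follow_nonempty cx; rewrite -cl x0.
(* Here [c] ends with a letter [x], and by superadditivity [x v u] contains the last two tails of
   [w], whose product is 0. *)
apply/eqP; apply: zf_pel; rewrite ze cl.
have [zw _ _] := chain_last2 clen w.
have le : (size (carrows r ++ carrows c0) <= delta (i + n))%N.
  rewrite size_cat !clen addnC; have [w1 _] := chain_prefix clen w0 (leqnSn (i + n)).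
  exact: chain_superadd w1.
have -> : narrows x ++ narrows v ++ narrows u = drop (size (carrows r ++ carrows c0)) (carrows w).
  rewrite wE w0E cE.
  have -> : (carrows r ++ (carrows c0 ++ narrows x) ++ narrows v) ++ narrows u =
    (carrows r ++ carrows c0) ++ (narrows x ++ narrows v ++ narrows u) by rewrite !catA.
  by rewrite drop_size_cat.
rewrite -(cat_take_drop (delta (i + n) - size (carrows r ++ carrows c0))
            (drop (size (carrows r ++ carrows c0)) (carrows w))).
rewrite drop_drop subnK //; have := zf_cat (take (delta (i + n) - size (carrows r ++ carrows c0))
            (drop (size (carrows r ++ carrows c0)) (carrows w))) [::] zw.
by rewrite cats0.
Qed.

End Lift.
End ExplicitLift.

Lemma span_of_sums (K : fieldType) (B : lmodType K) (T : eqType) (f : T -> B) z :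
  sums (fun y => exists k x, y = k *: f x) z -> exists (s : seq T) (k : T -> K),
  uniq s /\ z = \sum_(x <- s) k x *: f x.
Proof.
move=> [r rH ->] {z}; elim: r rH => [|y r IH] rH.
  by exists [::], (fun _ => 0); rewrite !big_nil.
have [|s [k [us sE]]] := IH; first by move=> z zr; apply: rH; rewrite inE zr orbT.
have [c [x yE]] : exists k x, y = k *: f x by apply: rH; rewrite inE eqxx.
rewrite big_cons sE yE; case: (boolP (x \in s)) => xs.
  exists s, (fun z => (if z == x then c else 0) + k z); split=> //.
  under [RHS]eq_bigr => z _ do rewrite scalerDl.
  rewrite big_split /=; congr (_ + _); rewrite (bigD1_seq x) //= eqxx big1 ?addr0 // => z.
  by move=> /negPf->; rewrite scale0r.
exists (x :: s), (fun z => if z == x then c else k z); split; first by rewrite /= xs.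
rewrite big_cons eqxx; congr (_ + _); apply: eq_big_seq => z zs.
by case: eqP => // zx; rewrite zx (negPf xs) in zs.
Qed.

Section ExtBasis.
Variables (K : fieldType) (Q : quiver) (rho : qpath Q -> Prop) (L : algType K).
Variable (pi : {lrmorphism path_algebra K Q -> L}).
Hypothesis piP : is_quotient (path_ideal K rho) pi.
Variable N : nat.
Hypothesis pi_long : forall p, (N <= plen p)%N -> pi (path_elt p) = 0.
Hypothesis pi_short : forall p, (plen p <= 1)%N -> pi (path_elt p) <> 0.
Variables (S : lmodType L^c) (q : {linear L^c^o -> S}).
Hypothesis qP : is_degree0_module (length_grading pi) q.

Local Notation b := (npath_basis piP pi_long pi_short).
Local Notation a := (npath_anick piP pi_long pi_short).
Local Notation chain := (chain piP pi_long pi_short).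
Local Notation np := (npath pi N).
Local Notation nel := (@nel _ _ _ pi N).
Local Notation ntriv := (ntriv N pi_short).
Local Notation X := (chain_resolution piP pi_long pi_short qP).

Variables D A : nat.
Hypothesis clen : forall n (w : chain n), size (carrows w) = delta D A n.
Hypothesis D_gt2 : (2 < D)%N.
Hypothesis A_gt1 : (1 < A)%N.
Hypothesis D_neq : D <> (2 * A)%N.

Variables (P : resolution S) (E : algType K) (cls : forall n, {linear P n -> S} -> E).
Hypothesis extE : is_ext_algebra cls.

Variables (al : forall n, {linear P n -> X n}) (be : forall n, {linear X n -> P n}).
Hypothesis al_eps : forall x, res_eps X (al 0%N x) = res_eps P x.
Hypothesis al_d : forall n x, res_d X n (al n.+1 x) = al n (res_d P n x).
Hypothesis be_eps : forall x, res_eps P (be 0%N x) = res_eps X x.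
Hypothesis be_d : forall n x, res_d P n (be n.+1 x) = be n (res_d X n x).

Lemma cls_ext n (f g : {linear P n -> S}) : cocycle f -> cocycle g ->
  (forall x, f x = g x) -> cls f = cls g.
Proof.
move=> fc gc fg; rewrite (ext_linear extE (c := 0) fc gc) => [|x].
  by rewrite scale0r add0r.
by rewrite scale0r [X in X + _]scale0r add0r fg.
Qed.

Lemma q_actL (x y : L) : q x <| y = q (x * y).
Proof. exact: (esym (linearZ_LR q (y : L^c) x)). Qed.

Lemma S_act_nontriv (s : S) z : nontriv_elt b z -> s <| z = 0.
Proof.
have [y <-] := qP.1 s => z0; rewrite q_actL; apply/(q_ker piP pi_long pi_short qP) => v.
by rewrite bcoef_trivM z0 mulr0.
Qed.

Lemma hom_rad n (h : {linear X n -> S}) (x : anick_mod a n) : amrad x -> h x = 0.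
Proof.
move=> xr; rewrite (am_decomp x) linear_sum big1 // => w _.
by rewrite linearZ_LR; apply: S_act_nontriv.
Qed.

(** The differential of [X] has its coefficients in the radical, which annihilates [S]. All maps
    [X n -> S] are therefore cocycles, and no nonzero one is a coboundary. *)
Lemma hom_d n (h : {linear X n -> S}) x : h (res_d X n x) = 0.
Proof. exact/hom_rad/amrad_amd. Qed.

Definition Phi n (c : chain n -> K) : {linear X n -> S} :=
  amlin (fun w => q (nel (ntriv (cend w))) <| (c w)%:A).

Lemma PhiE n (c : chain n -> K) (x : anick_mod a n) :
  Phi c x = q (\sum_w c w *: amfun x w).
Proof.
rewrite linear_sum; apply: eq_bigr => w _.
rewrite q_actL q_actL; congr (q _).
by rewrite mulr_algr -scalerAl (amfun_end x w).
Qed.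

Lemma Phi_gen n (c : chain n -> K) w : Phi c (gen w) = q (c w *: nel (ntriv (cend w))).
Proof.
rewrite PhiE (bigD1 w) //= big1 => [|w' ww'].
  by rewrite addr0 amfun_gen eqxx.
by rewrite amfun_gen (negPf ww') scaler0.
Qed.

Lemma Phi_onto n (h : {linear X n -> S}) : exists c, forall x, h x = Phi c x.
Proof.
have ex (w : chain n) : exists k : K, h (gen w) = q (k *: nel (ntriv (cend w))).
  have [z zE] := qP.1 (h (gen w)); exists (bcoef b (ntriv (cend w)) z).
  rewrite -{1}(gen_end w) linearZ_LR -zE.
  rewrite (_ : _ *: _ = q ((z : L) * nel (ntriv (cend w)) : L)); last exact: (q_actL z _).
  pose u : L := (z : L) * nel (ntriv (cend w)).
  pose u' : L := bcoef b (ntriv (cend w)) z *: nel (ntriv (cend w)).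
  suff u0 : q (u - u' : L) = 0 by apply/eqP; rewrite -subr_eq0 -linearB; apply/eqP.
  apply/(q_ker piP pi_long pi_short qP) => v.
  have ce : bcoef b (btriv b v) (nel (ntriv (cend w))) = (btriv b v == ntriv (cend w))%:R.
    exact: (bcoef_bas b).
  have e1 : bcoef b (btriv b v) u = bcoef b (btriv b v) (z : L) * (btriv b v == ntriv (cend w))%:R.
    by rewrite -ce; apply: bcoef_trivM.
  have e2 : bcoef b (btriv b v) u' = bcoef b (ntriv (cend w)) z * (btriv b v == ntriv (cend w))%:R.
    by rewrite -ce; apply: linearZ.
  rewrite linearB [X in X - _]e1 [X in _ - X]e2.
  by case: eqP => [->|_]; rewrite ?mulr0 subrr.
exists (fun w => sval (cid (ex w))); apply: (@am_ext _ _ _ _ b a n S h (Phi _)) => w.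
by rewrite Phi_gen -(svalP (cid (ex w))).
Qed.

Lemma cocycle_al n (h : {linear X n -> S}) : cocycle (h \o al n : {linear P n -> S}).
Proof. by move=> x /=; rewrite -al_d hom_d. Qed.

Definition ecls n (c : {ffun chain n -> K^o}) : E := cls (Phi c \o al n).

Fact ecls_linear n : linear (@ecls n).
Proof.
move=> k c c'; apply: (ext_linear extE); try exact: cocycle_al.
move=> x /=; rewrite !PhiE; set y := al n x.
have -> : ((k *: 1 : L) : L^c) *: q (\sum_w c w *: amfun y w) =
          q ((\sum_w c w *: amfun y w) * (k *: 1)) by exact: q_actL.
rewrite mulr_algr -linearD /=; congr (q _); rewrite scaler_sumr -big_split.
by apply: eq_bigr => w _; rewrite !ffunE scalerDl scalerA.
Qed.

HB.instance Definition _ n :=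
  GRing.isLinear.Build K {ffun chain n -> K^o} E _ (@ecls n) (@ecls_linear n).

Lemma al_be n (x : anick_mod a n) : amrad ((al n (be n x) : anick_mod a n) - x).
Proof.
pose k m : {linear X m -> X m} := al m \o be m.
have ke x' : res_eps X (k 0%N x') = res_eps X x' by rewrite /= al_eps be_eps.
have kd m x' : res_d X m (k m.+1 x') = k m (res_d X m x') by rewrite /= al_d be_d.
exact: endo_lift_id ke kd n x.
Qed.

Lemma hom_al_be n (h : {linear X n -> S}) x : h (al n (be n x)) = h x.
Proof.
apply/eqP; rewrite -subr_eq0 -linearB; apply/eqP/hom_rad; exact: al_be.
Qed.

(** Pulled back along [be], the cocycle [Phi c \o al n] becomes [Phi c] again, whereas a coboundary
    becomes a coboundary on [X], which is 0. *)
Lemma ecls_inj n (c : {ffun chain n -> K^o}) : ecls c = 0 -> c = 0.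
Proof.
move=> /(ext_kernel extE (cocycle_al _)) cb.
have c0 x : Phi c x = 0.
  rewrite -hom_al_be; case: n c cb x => [|n] c cb x; first exact: cb.
  have [g gE] := cb; rewrite [LHS]gE be_d.
  exact: (hom_d (g \o be n)).
apply/ffunP => w; rewrite ffunE; have := c0 (gen w); rewrite Phi_gen.
move=> /(q_ker piP pi_long pi_short qP)/(_ (cend w)).
by rewrite linearZ /= (bcoef_bas b) eqxx mulr1.
Qed.

Lemma cocycle_be_al n (f : {linear P n -> S}) : cocycle f ->
  cls f = cls (f \o be n \o al n).
Proof.
move=> fc; pose g m : {linear P m -> P m} := idfun \- (be m \o al m).
have [x|m x|h [h0 hS]] := @null_homotopy _ _ P P g.
- by rewrite /g /= linearB /= be_eps al_eps subrr.
- by rewrite /g /= linearB /= be_d al_d.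
pose f' : {linear P n -> S} := f \o g n.
have f'c : cocycle f'.
  move=> x; rewrite /f' /g /= linearB /= fc -al_d -be_d.
  by rewrite [X in _ - X]fc subrr.
have fbc : cocycle (f \o be n \o al n : {linear P n -> S}).
  by move=> x /=; rewrite -al_d -be_d.
have cb : coboundary f'.
  rewrite /f'; clear f' f'c fbc; case: n f fc => [|n] f fc.
    by move=> x; rewrite /= -[LHS]/(f (g 0%N x)) -h0 fc.
  exists (f \o h n) => x; have := hS n x; rewrite /= => hx.
  have -> : x - be n.+1 (al n.+1 x) = res_d P n.+1 (h n.+1 x) + h n (res_d P n x).
    by rewrite hx addrNK.
  by rewrite linearD /= fc add0r.
have : cls f' = 0 by apply/(ext_kernel extE f'c).
rewrite (ext_linear extE (c := -1) fbc fc) => [|x]; last first.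
  by rewrite /f' /g /= linearB /= scaleN1r scaleN1r addrC.
by rewrite scaleN1r => /eqP; rewrite addrC subr_eq0 => /eqP.
Qed.

Lemma ext_degree_ecls n y : ext_degree cls n y -> exists c, y = ecls (n := n) c.
Proof.
move=> [f fc ->]; rewrite (cocycle_be_al fc).
have [c cE] := Phi_onto (f \o be n); exists [ffun w => c w].
apply: cls_ext => [x /=||x /=]; try exact: cocycle_al.
  by rewrite -al_d -be_d.
apply: (etrans (cE (al n x))); rewrite !PhiE; congr (q _).
by apply: eq_bigr => w _; rewrite ffunE.
Qed.

Lemma ecls_degree n c : ext_degree cls n (ecls (n := n) c).
Proof. by exists (Phi c \o al n) => //; apply: cocycle_al. Qed.

Definition echain := {n : nat & (chain n : choiceType)}.

Definition edelta n (w : chain n) : {ffun chain n -> K^o} := [ffun w' => (w' == w)%:R].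

Definition ebas (x : echain) : E := ecls (edelta (tagged x)).

Lemma ecls_sum n (c : {ffun chain n -> K^o}) :
  ecls c = \sum_w c w *: ebas (Tagged (fun n => chain n : choiceType) w).
Proof.
have {1}-> : c = \sum_w c w *: edelta w.
  apply/ffunP => w; rewrite sum_ffunE (bigD1 w) //= big1 => [|w' ww'].
    by rewrite addr0 !ffunE eqxx [_ *: _]mulr1.
  by rewrite !ffunE eq_sym (negPf ww') scaler0.
by rewrite linear_sum; apply: eq_bigr => w _; rewrite linearZ_LR.
Qed.

Lemma ebas_span z : exists (s : seq echain) (k : echain -> K),
  uniq s /\ z = \sum_(x <- s) k x *: ebas x.
Proof.
apply: span_of_sums; have [_ _ dec _] := ext_direct extE.
have [s [f [_ fd ->]]] := dec z; apply: sums_big => n _.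
have [c ->] := ext_degree_ecls (fd n); rewrite ecls_sum; apply: sums_big => w _.
by apply: sums_mem; exists (c w); eexists.
Qed.

(** The dual of [x] seen in degree [n], hence 0 if [x] has another degree. It avoids transporting
    chains along equalities of degrees. *)
Definition eemb n (x : echain) : {ffun chain n -> K^o} :=
  [ffun w => ((Tagged (fun n => chain n : choiceType) w : echain) == x)%:R].

Lemma eembE n x : ecls (eemb n x) = if n == tag x then ebas x else 0.
Proof.
case: x => m w /=; case: (n =P m) => [->|nm].
  by congr ecls; apply/ffunP => w'; rewrite !ffunE eq_Tagged.
rewrite -[RHS](linear0 (@ecls n)); congr ecls; apply/ffunP => w'; rewrite !ffunE.
by case: eqP => // /(congr1 tag).
Qed.

Lemma ebas_free (s : seq echain) (k : echain -> K) : uniq s ->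
  \sum_(x <- s) k x *: ebas x = 0 -> forall x, x \in s -> k x = 0.
Proof.
move=> us s0 x xs; have [c [cD _ cE _]] := homogeneous_components (ext_direct extE).
have c0 n : c n 0 = 0 by apply: (addrI (c n 0)); rewrite -cD !addr0.
have := congr1 (c (tag x)) s0; rewrite c0 (big_morph _ (cD (tag x)) (c0 (tag x))).
have -> : \sum_(y <- s) c (tag x) (k y *: ebas y) =
    ecls (\sum_(y <- s) k y *: eemb (tag x) y).
  rewrite linear_sum; apply: eq_bigr => y _; rewrite linearZ_LR /= eembE.
  have yd : ext_degree cls (tag y) (k y *: ebas y).
    by rewrite /ebas -linearZ_LR; apply: ecls_degree.
  by rewrite (cE _ _ _ yd); case: ifP => //; rewrite scaler0.
move=> /ecls_inj/ffunP/(_ (tagged x)); rewrite sum_ffunE (bigD1_seq x) //= big1 => [|y yx].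
  by rewrite !ffunE addr0; case: x {xs cE} => n w; rewrite eqxx /= => <-; rewrite [_ *: _]mulr1.
rewrite !ffunE; case: eqP => [e|_]; last exact: scaler0.
by rewrite -e in yx; case/eqP: yx; case: (x).
Qed.

(** The Yoneda product composes maps from right to left while paths are read from left to right: the
    product of [p] and [r] is the path [r] followed by [p]. *)
Definition ecomp m n (w : chain (m + n)) (r : chain n) (p : chain m) : bool :=
  [&& cstart w == cstart r, cstart p == cend r & carrows w == carrows r ++ carrows p].

Definition emul (p r : echain) : option echain :=
  omap (fun w => Tagged (fun n => chain n : choiceType) w)
    [pick w : chain (tag p + tag r) | ecomp w (tagged r) (tagged p)].

Lemma ecomp_uniq m n (w w' : chain (m + n)) r p : ecomp w r p -> ecomp w' r p -> w = w'.
Proof.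
move=> /and3P[/eqP wv _ /eqP wE] /and3P[/eqP wv' _ /eqP wE'].
by apply: (chain_inj clen); rewrite ?wv ?wE.
Qed.

Lemma factors_triv m n (w : chain (m + n)) r p v : nstart v = cend p ->
  narrows v = [::] -> factors r w (p, v) = ecomp w r p.
Proof. by move=> vp v0; rewrite /factors /ecomp /= v0 vp cats0 eqxx andbT [_ && (_ == _)]andbC. Qed.

Lemma ntriv_idem v : nel (ntriv v) * nel (ntriv v) = nel (ntriv v).
Proof. exact: (triv_idem b v). Qed.

Lemma eps_gen (c : chain 0) : ameps q (gen c) = q (nel (ntriv (cend c))).
Proof. exact: ameps_gen. Qed.

Section Product.
Variables (n : nat) (r : chain n).
Local Notation F := (fun i => amlin (lift_gen r (i := i))).

Lemma lift_on_gen i (w : chain (i + n)) : F i (gen w) = lift_gen r w.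
Proof. exact: etrans (amlin_gen _ _) (lift_gen_end r w). Qed.

Lemma lift_d i (x : anick_mod a (i.+1 + n)) : amd (F i.+1 x) = F i (amd x).
Proof.
have := @am_ext _ _ _ _ b a (i.+1 + n) (anick_mod a i) (@amd _ _ _ _ b a i \o F i.+1)
  (F i \o @amd _ _ _ _ b a (i + n)); apply => w.
have [w0 [u [wv wE wu wl wd]]] := @chain_d _ _ _ _ _ piP N pi_long pi_short (i + n)%N w.
apply: etrans (congr1 (@amd _ _ _ _ b a i) (@lift_on_gen i.+1 w)) _.
apply: etrans (lift_gen_d clen D_gt2 A_gt1 D_neq r wv wE wu) _.
apply: esym; rewrite [LHS](_ : _ = F i (gen w0 <| nel u)); last exact: (congr1 (F i) wd).
apply: etrans (amlin_act _ _ _) _.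
exact: (congr1 (fun m : anick_mod a i => m <| nel u) (lift_on_gen w0)).
Qed.

Lemma lift_eps (x : anick_mod a n) :
  ameps q (F 0%N x) = Phi (edelta r) x.
Proof.
have := @am_ext _ _ _ _ b a n S (ameps q \o F 0%N) (Phi (edelta r)); apply => w /=.
rewrite amlin_gen Phi_gen ffunE; case: (w =P r) => [->|wr]; last first.
  rewrite lift_gen0 ?scaler0 ?linear0 ?scale0r ?linear0 // => -[c v].
  apply/negP => /and4P[/eqP wv /eqP /= wE _ _]; apply: wr; apply: (chain_inj clen) => //.
  have sz : size (carrows (w : chain n)) = size (carrows r) by rewrite !clen.
  rewrite carrows0 cat0s in wE; move: sz; rewrite wE size_cat -[RHS]addn0.
  by move/addnI/size0nil->; rewrite cats0.
have [c [cv _ _]] := chain0_ex piP pi_long pi_short (cend r).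
have f : factors r (r : chain (0 + n)) (c, ntriv (cend r)).
  have cc : cend c = cend r by rewrite (cend_last c) clast0 cv.
  by rewrite /factors /= carrows0 cats0 !eqxx cv cc !eqxx.
have cc : cend c = cend r by rewrite (cend_last c) clast0 cv.
rewrite (lift_genE clen f) scale1r !linearZ_LR /= eps_gen cc.
apply: etrans (congr1 (fun s => s <| nel (ntriv (wend r))) (q_actL _ _)) _.
by apply: etrans (q_actL _ _) _; rewrite !ntriv_idem.
Qed.

(** For nontrivial [v] the value on [gen c <| nel v] is 0, because [q] kills the radical; only a
    factorization of [w] as exactly [r] followed by [p] contributes. *)
Lemma lift_phi m (p : chain m) (x : anick_mod a (m + n)) :
  Phi (edelta p) (F m x) = Phi (fun w => (ecomp w r p)%:R) x.
Proof.
have := @am_ext _ _ _ _ b a (m + n) S (Phi (edelta p) \o F m) (Phi (fun w => (ecomp w r p)%:R)).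
apply => w /=; rewrite amlin_gen Phi_gen lift_gen_end /lift_gen.
case: pickP => [[c v] f|nf]; last first.
  rewrite linear0 -(factors_triv w r (v := ntriv (cend p))) // nf scale0r linear0 //.
rewrite linearZ_LR /= Phi_gen ffunE q_actL; case: (c =P p) => [cp|cp]; last first.
  rewrite scale0r mul0r; case: (boolP (ecomp w r p)) => [h|_]; last by rewrite scale0r.
  rewrite -(factors_triv w r (v := ntriv (cend p))) // in h.
  by have [] := factors_uniq clen f h.
rewrite scale1r; have vc : nstart v = cend p by have /and4P[_ _ _ /eqP ->] := f; rewrite cp.
case: (narrows v =P [::]) => [v0|v1].
  rewrite -(factors_triv w r vc v0) -cp f scale1r (_ : v = ntriv (cend p)); last exact: npath_ext.
  by rewrite cp ntriv_idem -(factors_end f) /nend v0 vc.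
have -> : ecomp w r p = false.
  apply/negP => h; rewrite -(factors_triv w r (v := ntriv (cend p))) // in h.
  by have [_ e] := factors_uniq clen f h; rewrite e in v1.
rewrite scale0r linear0; apply/(q_ker piP pi_long pi_short qP) => v'.
have v0 : bcoef b (btriv b v') (nel v) = 0.
  by apply: (nontriv_bas (b := b)) => v'' e; rewrite e in v1.
by rewrite bcoef_trivM v0 mulr0.
Qed.

End Product.

Lemma ebasM p r : ebas p * ebas r = oapp ebas 0 (emul p r).
Proof.
case: p r => m p [n r]; rewrite /ebas /=.
(* The product is defined by lifts on [P], so the explicit lift on [X] is carried over by the two
   comparison maps. *)
pose F i : {linear P (i + n)%N -> P i} :=
  be i \o (amlin (lift_gen r (i := i)) : {linear X (i + n)%N -> X i}) \o al (i + n)%N.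
pose c : {ffun chain (m + n) -> K^o} := [ffun w => (ecomp w r p)%:R].
have -> : cls (Phi (edelta p) \o al m) * cls (Phi (edelta r) \o al n) = ecls c.
  apply: (ext_mul extE (F := F)); try exact: cocycle_al.
    split=> [x|i x]; rewrite /F /=.
      rewrite be_eps; exact: (lift_eps r (al n x)).
    by rewrite be_d -al_d; congr (be i _); apply/esym/lift_d.
  move=> x; rewrite /F /= (hom_al_be (Phi (edelta p))) (lift_phi r p) !PhiE.
  by congr (q _); apply: eq_bigr => w _; rewrite ffunE.
rewrite /emul /=; case: pickP => [w h|nw] /=.
  congr ecls; apply/ffunP => w'; rewrite !ffunE; congr ((nat_of_bool _)%:R).
  by apply/idP/eqP => [h'|->//]; apply: ecomp_uniq h' h.
rewrite -[RHS](linear0 (@ecls (m + n))); congr ecls; apply/ffunP => w; rewrite !ffunE.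
by rewrite nw.
Qed.

Definition czero v : chain 0 := sval (cid (chain0_ex piP pi_long pi_short v)).

Lemma czeroP v : cstart (czero v) = v.
Proof. by rewrite /czero; case: cid => w []. Qed.

Definition etriv v : echain := Tagged (fun n => chain n : choiceType) (czero v).

Lemma ebas_sum : \sum_v ebas (etriv v) = 1.
Proof.
rewrite -(ext_one extE); pose c : {ffun chain 0 -> K^o} := [ffun _ => 1].
have -> : cls (res_eps P) = ecls c.
  apply: cls_ext => [x||x]; [exact: (@res_cycle_d _ _ P 0 x) | exact: cocycle_al |].
  rewrite -al_eps; change (ameps q (al 0%N x) = Phi c (al 0%N x)).
  rewrite PhiE (amepsE q); congr (q _); apply: eq_bigr => w _.
  rewrite ffunE [RHS]scale1r; exact: amfun_end.
rewrite ecls_sum; rewrite (reindex_onto czero (@cstart _ _ _ _ _ _ _ _ _ 0)) /=.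
  by apply: eq_big => [v|v _]; rewrite ?czeroP ?eqxx // ffunE scale1r.
by move=> w _; apply: (chain_inj clen); rewrite ?czeroP ?carrows0.
Qed.

End ExtBasis.

(** * A linear resolution over the Ext algebra *)

Section BasisAssociativity.
Variables (K : fieldType) (B : algType K) (V : finType) (T : choiceType).
Variable b : path_basis B V T.

(** Associativity is inherited from the algebra, since basis elements are nonzero and distinct. *)
Lemma bmul_assocr x y z u w : bmul b x y = Some u -> bmul b u z = Some w ->
  exists2 v, bmul b y z = Some v & bmul b x v = Some w.
Proof.
move=> xy uz; have e : b x * (b y * b z) = b w.
  by rewrite mulrA (basM b x) xy (basM b u) uz.
case yz: (bmul b y z) => [v|]; last first.
  by move: e; rewrite (basM b y) yz mulr0 => /esym/eqP; rewrite (negPf (bas_neq0 b w)).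
exists v => //; move: e; rewrite (basM b y) yz (basM b x) /=.
case: (bmul b x v) => [w'|] /=; first by move/(@bas_inj _ _ _ _ b)->.
by move/esym/eqP; rewrite (negPf (bas_neq0 b w)).
Qed.

Lemma bmul_assocl x y z v w : bmul b y z = Some v -> bmul b x v = Some w ->
  exists2 u, bmul b x y = Some u & bmul b u z = Some w.
Proof.
move=> yz xv; have e : (b x * b y) * b z = b w.
  by rewrite -mulrA (basM b y) yz (basM b x) xv.
case xy: (bmul b x y) => [u|]; last first.
  by move: e; rewrite (basM b x) xy mul0r => /esym/eqP; rewrite (negPf (bas_neq0 b w)).
exists u => //; move: e; rewrite (basM b x) xy (basM b u) /=.
case: (bmul b u z) => [w'|] /=; first by move/(@bas_inj _ _ _ _ b)->.
by move/esym/eqP; rewrite (negPf (bas_neq0 b w)).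
Qed.

End BasisAssociativity.

(* The combinatorics of the Ext algebra: [edeg] is the cohomological degree,
   and every basis element factors through letters of degree at most 3. *)
Record ext_letters (K : fieldType) (B : algType K) (V : finType) (T : choiceType)
    (b : path_basis B V T) := ExtLetters {
  edeg : T -> nat;
  eltr : finType;
  elval : eltr -> T;
  edegD : forall x y z, bmul b x y = Some z -> edeg z = (edeg x + edeg y)%N;
  edeg_triv : forall v, edeg (btriv b v) = 0%N;
  edeg_eq0 : forall x, edeg x = 0%N -> x = btriv b (bsrc b x);
  elval_inj : injective elval;
  elval_deg : forall y, (edeg (elval y) <= 3)%N;
  elval_ex : forall x, (edeg x <= 3)%N -> exists y, elval y = x;
  edeg_mul : forall x y z, bmul b x y = Some z -> (0 < edeg x)%N -> (0 < edeg y)%N ->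
    [/\ (1 < edeg x)%N, (1 < edeg y)%N & ~~ (odd (edeg x) && odd (edeg y))];
  esplit : forall x, (3 < edeg x)%N ->
    exists r x', edeg r = 2 /\ bmul b r x' = Some x;
  esplit_inj : forall r r' x x' z, edeg r = 2 -> edeg r' = 2 ->
    bmul b r x = Some z -> bmul b r' x' = Some z -> r = r' /\ x = x';
  elocal : forall x y z u v, bmul b x z = Some u -> bmul b z y = Some v ->
    (0 < edeg x)%N -> (0 < edeg y)%N -> (1 < edeg z)%N ->
    ~~ (odd (edeg x) && odd (edeg y)) -> exists w, bmul b u y = Some w
}.

Section ExtAnick.
Variables (K : fieldType) (B : algType K) (V : finType) (T : choiceType).
Variables (b : path_basis B V T) (l : ext_letters b).

Local Notation deg := (edeg l).
Local Notation Y := (eltr l).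
Local Notation val := (@elval _ _ _ _ _ l).
Local Notation mul := (bmul b).

(** In a normal word all letters but the last have degree 2. Hence a nontrivial [x] continues [u] in
    normal form only if [u] has degree 2 and [u x] is nonzero. *)
Definition eext (u x : T) : bool :=
  (0 < deg x)%N && ~~ ((deg u == 2) && (mul u x != None)).

Definition efollow (u y : Y) : bool :=
  (btgt b (val u) == bsrc b (val y)) && eext (val u) (val y).

(** By [esplit_inj] there is at most one such pair, so [pick] makes no choice. A pair of degrees 3
    and 2 becomes one of degrees 2 and 3, so two consecutive pairs are never both corrected. *)
Definition ecorr (u y : Y) : option (Y * Y) :=
  [pick p : Y * Y | [&& deg (val u) == 3, deg (val y) == 2, deg (val p.1) == 2,
     deg (val p.2) == 3, mul (val u) (val y) != None &
     mul (val p.1) (val p.2) == mul (val u) (val y)]].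

Fact estart_ex v : exists y, val y = btriv b v.
Proof. by apply: elval_ex; rewrite edeg_triv. Qed.

Definition estart (v : V) : Y :=
  sval (cid (estart_ex v)).

Lemma estartE v : val (estart v) = btriv b v.
Proof. exact: svalP (cid (estart_ex v)). Qed.

Lemma ecorr_spec u y u1 y1 : ecorr u y = Some (u1, y1) ->
  [/\ deg (val u) = 3, deg (val y) = 2, deg (val u1) = 2, deg (val y1) = 3 &
      exists2 z, mul (val u) (val y) = Some z & mul (val u1) (val y1) = Some z].
Proof.
rewrite /ecorr; case: pickP => // p + [pE]; rewrite pE /=.
move=> /and5P[/eqP du /eqP dy /eqP du1 /eqP dy1 /andP[]].
case uy: (mul (val u) (val y)) => [z|] // _ /eqP u1y1; split=> //.
by exists z.
Qed.

Lemma eextF u x : deg u = 2 -> eext u x -> mul u x = None.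
Proof. by rewrite /eext => -> /andP[_]; rewrite eqxx negbK => /eqP. Qed.

Lemma NeextP u x : ~~ eext u x -> deg x = 0%N \/ deg u = 2 /\ exists z, mul u x = Some z.
Proof.
rewrite /eext negb_and negbK -eqn0Ngt => /orP[/eqP->|/andP[/eqP-> ]]; first by left.
by case: (mul u x) => [z|] // _; right; split=> //; exists z.
Qed.

Lemma mul_trivr x y : btgt b x = bsrc b y -> deg y = 0%N -> mul x y = Some x.
Proof. by move=> xy /edeg_eq0 ->; rewrite bmul_trivr xy eqxx. Qed.

(** If the product is nonzero, the degrees must be 3 and 2, by [edeg_mul] and since [y] does not
    continue a letter of degree 2 in normal form. Splitting the product, of degree 5, by [esplit]
    provides the correction. *)
Lemma ecorr_None x u y : efollow x u -> efollow u y -> ecorr u y = None ->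
  mul (val u) (val y) = None.
Proof.
move=> /andP[_ /andP[u0 _]] /andP[_ uy] cN; case E: (mul (val u) (val y)) => [z|] //.
have y0 : (0 < deg (val y))%N by case/andP: uy.
have [u1 y1 uyo] := edeg_mul E u0 y0; have dz := edegD l E.
have u3 := elval_deg u; have y3 := elval_deg y.
case: (deg (val u) =P 2) => [u2|nu2]; first by rewrite (eextF u2 uy) in E.
have du : deg (val u) = 3 by lia.
have dy : deg (val y) = 2 by move: uyo; rewrite du /= => oy; lia.
have [|r [x' [r2 rx]]] := @esplit _ _ _ _ _ l z; first by rewrite dz; lia.
have dx' : deg x' = 3 by have := edegD l rx; lia.
have [|r' rE] := @elval_ex _ _ _ _ _ l r; first by rewrite r2.
have [|t' tE] := @elval_ex _ _ _ _ _ l x'; first by rewrite dx'.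
move: cN; rewrite /ecorr; case: pickP => // /(_ (r', t')) /=.
by rewrite du dy rE tE r2 dx' E rx /= eqxx.
Qed.

Definition ext_anick : anick_data b.
Proof.
refine (@AnickData _ _ _ _ b Y val estart efollow ecorr (fun u x => eext (val u) x)
  estartE _ _ _ ecorr_None _ _ _ _ _ _ _ _).
- by move=> u y /andP[/eqP].
- by move=> u y v /andP[_ /andP[y0 _]] yv; rewrite yv edeg_triv in y0.
- move=> v y; case E: ecorr => [[u1 y1]|] //.
  by have [] := ecorr_spec E; rewrite estartE edeg_triv.
- move=> x u y u1 y1 /andP[/eqP xu exu] uy /ecorr_spec[du dy du1 dy1 [z uyz u1y1z]].
  have [_ zu _] := bmul_comp uyz; have [_ zu1 _] := bmul_comp u1y1z.
  split; rewrite ?uyz //.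
    (* If [x] has degree 2 and [x u1] is nonzero, then [elocal] makes [x u1 y1 = x u y] nonzero, and
       with it [x u], contrary to [efollow x u]. *)
    rewrite /efollow xu -zu zu1 eqxx /eext du1 /=; apply/negP => /andP[/eqP dx].
    case E: (mul (val x) (val u1)) => [v|] // _.
    have [w vw] : exists w, mul v (val y1) = Some w.
      by apply: (@elocal _ _ _ _ _ l _ _ _ _ _ E u1y1z); rewrite ?dx ?du1 ?dy1.
    have [z' ] := bmul_assocr E vw; rewrite u1y1z => -[<-] xz.
    have [u' xu' _] := bmul_assocl uyz xz.
    by rewrite (eextF dx exu) in xu'.
  (* Both [u2] and [y1] have degree 3, and a product of two odd degrees vanishes. *)
  move=> x2 u2 /ecorr_spec[_ _ _ du2 _].
  case E: mul => [z'|] //.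
  have p2 : (0 < deg (val u2))%N by rewrite du2.
  have p1 : (0 < deg (val y1))%N by rewrite dy1.
  by have [_ _] := edeg_mul E p2 p1; rewrite du2 dy1.
- move=> u y u1 y1 v _ /ecorr_spec[_ _ _ dy1 _] yv.
  by rewrite yv edeg_triv in dy1.
- move=> x u y x1 u1 xu /andP[_ uy] /ecorr_spec[dx du dx1 du1 [z xuz x1u1z]]; split.
    by case E: ecorr => [[u2 y2]|] //; have [] := ecorr_spec E; rewrite du.
  have y0 : (0 < deg (val y))%N by case/andP: uy.
  case E: (mul (val u1) (val y)) => [v|] //.
  have [w zw] : exists w, mul z (val y) = Some w.
    by apply: (@elocal _ _ _ _ _ l _ _ _ _ _ x1u1z E); rewrite ?dx1 ?du1.
  have [v' uyv _] := bmul_assocr xuz zw.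
  by rewrite (eextF du uy) in uyv.
(* The first letter is [x] itself up to degree 3, and beyond that the factor of degree 2 given by
   [esplit]. *)
- move=> u x ux eux; have x0 : (0 < deg x)%N by case/andP: eux.
  case: (leqP (deg x) 3) => dx.
    have [y yE] := elval_ex dx; exists y, (btriv b (btgt b x)); split.
    + by rewrite /efollow yE ux eqxx.
    + by rewrite yE bmul_trivr eqxx.
    by rewrite /eext edeg_triv.
  have [r [x' [dr rx]]] := esplit dx; have [|y yE] := @elval_ex _ _ _ _ _ l r; first by rewrite dr.
  have dx' : deg x = (2 + deg x')%N by rewrite (edegD l rx) dr.
  exists y, x'; rewrite yE; split=> //; last by rewrite /eext dr rx /= andbF.
  have [_ xr _] := bmul_comp rx; rewrite /efollow yE ux xr eqxx /eext dr /=.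
  apply/negP => /andP[/eqP du]; case E: (mul (val u) r) => [v|] // _.
  have [w vw] : exists w, mul v x' = Some w.
    by apply: (@elocal _ _ _ _ _ l _ _ _ _ _ E rx); rewrite ?du ?dr //; lia.
  have [x1] := bmul_assocr E vw; rewrite rx => -[<-] ux'.
  by rewrite (eextF du eux) in ux'.
- move=> u y x' /andP[/eqP uy euy] yx' /NeextP[dx'|[dy [x yx]]].
    by exists (val y) => //; apply: mul_trivr.
  exists x => //; have y0 : (0 < deg (val y))%N by rewrite dy.
  rewrite /eext (edegD l yx) addn_gt0 y0 /=; apply/negP => /andP[/eqP du].
  case E: (mul (val u) x) => [w|] // _; have [v uyv _] := bmul_assocl yx E.
  by rewrite (eextF du euy) in uyv.
(* A letter times a nontrivial normal remainder has degree above 3, and so is never a single letter.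
   Two such products are compared by [esplit_inj]. *)
- move=> u y x y1 x1 z uy uy1 nyx ny1x1 yx y1x1.
  have cyx : btgt b (val y) = bsrc b x by case: (bmul_comp yx).
  have cyx1 : btgt b (val y1) = bsrc b x1 by case: (bmul_comp y1x1).
  have big (v : Y) t t' : mul (val v) t = Some t' -> deg (val v) = 2 -> deg t <> 0%N -> (3 < deg t')%N.
    move=> vt dv /eqP; rewrite -lt0n => t0; have v0 : (0 < deg (val v))%N by rewrite dv.
    by have [_ t1 _] := edeg_mul vt v0 t0; rewrite (edegD l vt) dv.
  have y3 := elval_deg y; have y13 := elval_deg y1.
  case: (deg x =P 0%N) => [x0|x0]; case: (deg x1 =P 0%N) => [x10|x10].
  + move: yx y1x1; rewrite !mul_trivr // => -[<-] [/elval_inj e]; subst y1; split=> //.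
    by rewrite (edeg_eq0 x0) (edeg_eq0 x10) -cyx -cyx1.
  + have [//|[dy1 _]] := NeextP ny1x1; have := big _ _ _ y1x1 dy1 x10.
    by move: yx; rewrite mul_trivr // => -[<-]; lia.
  + have [//|[dy _]] := NeextP nyx; have := big _ _ _ yx dy x0.
    by move: y1x1; rewrite mul_trivr // => -[<-]; lia.
  have [//|[dy _]] := NeextP nyx; have [//|[dy1 _]] := NeextP ny1x1.
  by have [/elval_inj] := esplit_inj dy dy1 yx y1x1.
- move=> u y u1 y1 x z uy /ecorr_spec[du dy du1 dy1 [z0 uyz u1y1z]] yx _ y1x.
  rewrite /eext du1 eqxx negb_and negbK /=; apply/orP; right.
  case: (posnP (deg x)) => [x0|x0].
    have [y1x' _ _] := bmul_comp y1x.
    by move: y1x; rewrite mul_trivr // => -[<-]; rewrite u1y1z.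
  have [w zw] : exists w, mul z0 x = Some w.
    by apply: (@elocal _ _ _ _ _ l _ _ _ _ _ u1y1z y1x); rewrite ?du1 ?dy1.
  have [v] := bmul_assocr u1y1z zw; rewrite y1x => -[<-] -> //.
move=> x; rewrite estartE => /NeextP[/edeg_eq0//|[]]; by rewrite edeg_triv.
Defined.

End ExtAnick.

Lemma direct_sum_coordinates (V W : zmodType) (I : Type) (T : eqType)
    (c : I -> V -> W) (d : I -> T) (M := fun t v => forall i, d i <> t -> c i v = 0) :
  (forall i x y, c i (x + y) = c i x + c i y) ->
  (forall x, (forall i, c i x = 0) -> x = 0) ->
  (forall x, sums (fun y => exists t, M t y) x) -> direct_sum M.
Proof.
move=> cD csep csum.
have c0 i : c i 0 = 0 by apply: (addrI (c i 0)); rewrite -cD !addr0.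
have cN i x : c i (- x) = - c i x by apply: (addrI (c i x)); rewrite -cD !subrr c0.
have MD t x y : M t x -> M t y -> M t (x + y).
  by move=> tx ty i it; rewrite cD tx // ty // addr0.
have M0 t : M t 0 by move=> i _; rewrite c0.
split=> [//|t x y tx ty i it|x|s f us fM s0 t ts].
- by rewrite cD cN tx // ty // subr0.
- elim/sums_ind: {x}(csum x) => [|x y [s [f [us fM ->]]] [r [g [ur gM ->]]]|x [t tx]].
  + by exists [::], (fun _ => 0); rewrite big_nil.
  + exists (undup (s ++ r)), (fun t => (if t \in s then f t else 0) + (if t \in r then g t else 0)).
    split; first exact: undup_uniq.
      by move=> t; apply: MD; case: ifP => _ //; apply: M0.
    have ext (p : seq T) (h : T -> V) : uniq p -> {subset p <= s ++ r} ->
        \sum_(i <- p) h i = \sum_(i <- undup (s ++ r)) (if i \in p then h i else 0).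
      move=> up pp; rewrite -big_mkcond -big_filter; apply: perm_big; apply: uniq_perm => //.
        by rewrite filter_uniq ?undup_uniq.
      move=> i; rewrite mem_filter mem_undup; case ip: (i \in p) => //=.
      by rewrite (pp i ip).
    rewrite big_split /= -!ext // => i ir; rewrite mem_cat ir ?orbT //.
  by exists [:: t], (fun u => if u == t then x else 0); rewrite big_seq1 eqxx;
    split=> // u; case: eqP => [->|_].
apply: csep => i; case: (d i =P t) => [it|nt]; last exact: fM nt.
have cs : c i (\sum_(u <- s) f u) = c i (f t).
  rewrite (big_morph (c i) (cD i) (c0 i)) (bigD1_seq t) //= big1 ?addr0 // => u ut.
  by apply: fM; rewrite it => tu; rewrite tu eqxx in ut.
by rewrite -cs s0 c0.
Qed.

(** * Koszulity from a resolution by letters of weight one *)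

Section WeightedBasis.
Variables (K : fieldType) (B : algType K) (V : finType) (T : choiceType).
Variables (b : path_basis B V T) (wt : T -> nat).
Hypothesis wtD : forall x y z, bmul b x y = Some z -> wt z = (wt x + wt y)%N.
Hypothesis wt_triv : forall v, wt (btriv b v) = 0%N.
Hypothesis wt_eq0 : forall x, wt x = 0%N -> x = btriv b (bsrc b x).

Definition wgr (n : nat) (z : B) : Prop := forall x, wt x <> n -> bcoef b x z = 0.

Lemma bcoef_mul0 x (y z : B) :
  (forall x1 x2, bmul b x1 x2 = Some x -> bcoef b x1 y = 0 \/ bcoef b x2 z = 0) ->
  bcoef b x (y * z) = 0.
Proof.
move=> H; have [s sE] := bas_span b y; have [r rE] := bas_span b z.
rewrite sE mulr_suml linear_sum big1 // => x1 _.
rewrite {1}rE mulr_sumr linear_sum big1 // => x2 _.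
rewrite -scalerAl -scalerAr !linearZ /= basM.
case E: bmul => [u|] /=; last by rewrite linear0 !mulr0.
rewrite bcoef_bas; case: eqP => [xu|_]; last by rewrite !mulr0.
by rewrite -xu in E; case: (H _ _ E) => ->; rewrite ?mul0r ?mulr0.
Qed.

Lemma wgr_bas x : wgr (wt x) (b x).
Proof. by move=> y yx; rewrite bcoef_bas; case: eqP => // e; rewrite e in yx. Qed.

Lemma wgrZ n (c : K) z : wgr n z -> wgr n (c *: z).
Proof. by move=> zn x xn; rewrite linearZ /= zn // mulr0. Qed.

Lemma wgr_algebra : graded_algebra wgr.
Proof.
split.
- apply: direct_sum_coordinates => [x y z|z|z]; first exact: linearD.
    exact: bas_eq0.
  have [s ->] := bas_span b z; apply: sums_big => x _.
  by apply: sums_mem; exists (wt x); apply/wgrZ/wgr_bas.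
- exact: wgrZ.
- move=> x x0; rewrite -(bas_sum b) linear_sum big1 // => v _.
  by rewrite bcoef_bas; case: eqP => // xv; rewrite xv wt_triv in x0.
move=> m n y z ym zn x xmn; apply: bcoef_mul0 => x1 x2 /wtD x12.
case: (wt x1 =P m) => [x1m|/ym]; last by left.
case: (wt x2 =P n) => [x2n|/zn]; last by right.
by case: xmn; rewrite x12 x1m x2n.
Qed.

Lemma wgr_positiveP z : positive_part wgr z <-> forall v, bcoef b (btriv b v) z = 0.
Proof.
split.
  elim/sums_ind: z / => [|x y hx hy|x [n n0 xn]] v.
  - by rewrite linear0.
  - by rewrite linearD /= hx hy addr0.
  by apply: xn; rewrite wt_triv => n1; rewrite -n1 in n0.
move=> z0; have [s ->] := bas_span b z; apply: sums_big => x _.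
case: (posnP (wt x)) => [/wt_eq0 x0|xp].
  by rewrite x0 z0 scale0r; apply: sums0.
by apply: sums_mem; exists (wt x) => //; apply/wgrZ/wgr_bas.
Qed.

Lemma wgr0_finite_product : is_finite_product (wgr 0).
Proof.
pose phi (f : {ffun 'I_#|V| -> K^o}) : B := \sum_v (f (enum_rank v) : K) *: b (btriv b v).
have phiE f v : bcoef b (btriv b v) (phi f) = f (enum_rank v).
  rewrite linear_sum (bigD1 v) //= big1 => [|w wv].
    by rewrite addr0 linearZ /= bcoef_bas eqxx mulr1.
  rewrite linearZ /= bcoef_bas; case: eqP => [/btriv_inj vw|_]; last by rewrite mulr0.
  by rewrite vw eqxx in wv.
have phi_lin : linear phi.
  move=> c f g; rewrite /phi scaler_sumr -big_split; apply: eq_bigr => v _ /=.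
  by rewrite !ffunE scalerDl scalerA.
exists #|V|, (mk_linear phi_lin); split.
- move=> f g /= fg; apply/ffunP => i; rewrite -(enum_valK i).
  by rewrite -!phiE fg.
- move=> z; split=> [z0|[f <-] x x0 /=].
    exists [ffun i => bcoef b (btriv b (enum_val i)) z] => /=; apply/esym/eqP; rewrite -subr_eq0.
    apply/eqP/(bas_eq0 (b := b)) => x; rewrite linearB /=.
    case: (wt x =P 0%N) => [/wt_eq0->|x0]; first by rewrite phiE ffunE enum_rankK subrr.
    rewrite z0 // linear_sum big1 ?subrr // => v _; rewrite linearZ /= bcoef_bas.
    case: eqP => [xv|_]; last by rewrite mulr0.
    by rewrite xv wt_triv in x0.
  rewrite /phi linear_sum big1 // => v _; rewrite linearZ /= bcoef_bas.
  case: eqP => [xv|_]; last by rewrite mulr0.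
  by rewrite xv wt_triv in x0.
- rewrite -(bas_sum b); apply: eq_bigr => v _; by rewrite ffunE scale1r.
move=> f g /=; rewrite /phi mulr_suml; apply: eq_bigr => v _.
rewrite mulr_sumr (bigD1 v) //= big1 => [|w wv].
  by rewrite addr0 -scalerAl -scalerAr triv_idem scalerA ffunE.
by rewrite -scalerAl -scalerAr mul_triv_bas bsrc_triv eq_sym (negPf wv) !scaler0.
Qed.

(** A concrete model of [B] modulo its positive part, on which [B] acts through the characters at
    the vertices. *)
Definition degree0_module : Type := {ffun V -> K}.
HB.instance Definition _ := GRing.Zmodule.on degree0_module.

Definition degree0_act (c : B^c) (s : degree0_module) : degree0_module :=
  [ffun v => s v * bcoef b (btriv b v) c].

Fact degree0_actA c d s : degree0_act c (degree0_act d s) = degree0_act (c * d) s.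
Proof. by apply/ffunP => v; rewrite !ffunE bcoef_trivM mulrA. Qed.

Fact degree0_act1 : left_id 1 degree0_act.
Proof.
move=> s; apply/ffunP => v; rewrite ffunE -[1 : B^c]/(1 : B) -(bas_sum b) linear_sum.
rewrite (bigD1 v) //= big1 => [|w wv]; first by rewrite addr0 bcoef_bas eqxx mulr1.
by rewrite bcoef_bas; case: eqP => // /btriv_inj e; rewrite e eqxx in wv.
Qed.

Fact degree0_actDr : right_distributive degree0_act +%R.
Proof. by move=> c s t; apply/ffunP => v; rewrite !ffunE mulrDl. Qed.

Fact degree0_actDl s : {morph degree0_act^~ s : c d / c + d}.
Proof. by move=> c d; apply/ffunP => v; rewrite !ffunE linearD mulrDr. Qed.

HB.instance Definition _ := GRing.Zmodule_isLmodule.Build B^c degree0_module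
  degree0_actA degree0_act1 degree0_actDr degree0_actDl.

Definition degree0_proj (z : B^c^o) : degree0_module := [ffun v => bcoef b (btriv b v) z].

Fact degree0_proj_linear : linear degree0_proj.
Proof.
move=> c y z; apply/ffunP => v; rewrite !ffunE [LHS]linearD; congr (_ + _).
exact: (bcoef_trivM b v y c).
Qed.

HB.instance Definition _ :=
  GRing.isLinear.Build B^c B^c^o degree0_module _ degree0_proj degree0_proj_linear.

Lemma degree0_surj s : exists z, degree0_proj z = s.
Proof.
exists (\sum_v s v *: b (btriv b v) : B); apply/ffunP => v; rewrite ffunE linear_sum.
rewrite (bigD1 v) //= big1 => [|w wv].
  by rewrite addr0 linearZ /= bcoef_bas eqxx mulr1.
rewrite linearZ /= bcoef_bas; case: eqP => [/btriv_inj vw|_]; last by rewrite mulr0.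
by rewrite vw eqxx in wv.
Qed.

Lemma degree0_ker z : degree0_proj z = 0 <-> forall v, bcoef b (btriv b v) z = 0.
Proof.
split=> [/ffunP z0 v|z0]; first by have := z0 v; rewrite !ffunE.
by apply/ffunP => v; rewrite !ffunE z0.
Qed.

Section Koszul.
Variable a : anick_data b.
Hypothesis wt_follow : forall u y : ltr a, follow u y -> wt (lval y) = 1%N.
Hypothesis wt_corr : forall u y u1 y1 : ltr a, follow u y ->
  corr u y = Some (u1, y1) -> wt (lval y1) = 1%N.
Local Notation X := (anick_resolution a degree0_surj degree0_ker).

(** [[w] x] is given degree [n] plus the weight of [x], as each of the [n] letters of [w] has weight
    1. *)
Definition word_gr n (i : int) (f : anick_mod a n) : Prop :=
  forall wx : word a n * T, (n + wt wx.2)%:Z <> i -> amcoef wx.1 wx.2 f = 0.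

Lemma word_grD n i (f g : anick_mod a n) : word_gr i f -> word_gr i g -> word_gr i (f + g).
Proof. by move=> fi gi wx h; rewrite amcoefD fi // gi // addr0. Qed.

Lemma word_gr_gen n (w : word a n) : word_gr n%:Z (gen w).
Proof.
move=> [w' x] /= nx; rewrite /amcoef amfun_gen; case: (w' =P w) => _; last exact: linear0.
rewrite bcoef_bas; case: eqP => // xv; rewrite xv wt_triv addn0 in nx.
by [].
Qed.

Lemma word_gr_act n i j (f : anick_mod a n) z : word_gr i f -> wgr j z ->
  word_gr (i + j%:Z) (f <| z).
Proof.
move=> fi zj [w x] /= nx; rewrite /amcoef amfun_act; apply: bcoef_mul0 => x1 x2 /wtD x12.
case: (wt x2 =P j) => [x2j|/zj]; last by right.
left; apply: (fi (w, x1)) => /= h; apply: nx.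
by rewrite x12 x2j addnA PoszD h.
Qed.

Lemma word_gr_direct n : direct_sum (@word_gr n).
Proof.
apply: (@direct_sum_coordinates _ _ _ _ (fun wx : word a n * T => amcoef wx.1 wx.2)
  (fun wx => (n + wt wx.2)%:Z)).
- by move=> wx f g; apply: amcoefD.
- by move=> f f0; apply: amcoef_eq0 => w x; apply: (f0 (w, x)).
move=> f; rewrite (am_decomp f); apply: sums_big => w _.
have [s ->] := bas_span b (amfun f w).
rewrite [_ *: _]scaler_suml; apply: sums_big => x _; apply: sums_mem.
exists (n%:Z + (wt x)%:Z); apply: word_gr_act; first exact: word_gr_gen.
exact/wgrZ/wgr_bas.
Qed.

Lemma word_gr0 n i : word_gr i (0 : anick_mod a n).
Proof. by move=> wx _; apply: amcoef0. Qed.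

Lemma gens_word_gr n v s : word_gr n%:Z (gens n v s : anick_mod a n).
Proof.
by rewrite /gens; case: mkword => [w|] /=; [apply: word_gr_gen | apply: word_gr0].
Qed.

Lemma amd_gen_split n (w : word a n.+1) : exists2 r : seq (anick_mod a n * T),
  amd (gen w) = \sum_(p <- r) p.1 <| b p.2 &
  forall p, p \in r -> word_gr n%:Z p.1 /\ wt p.2 = 1%N.
Proof.
have [w0 [y [_ _ wy wl ->]]] := word_split w; case E: corr => [[u1 y1]|]; last first.
  exists [:: (gen w0, lval y)]; first by rewrite big_seq1 [X in _ - X]scaler0 subr0.
  by move=> p; rewrite inE => /eqP-> /=; split; [apply: word_gr_gen | apply: wt_follow wy].
set g := gens _ _ _.
have w1 := wt_corr wy E.
(* The correction comes multiplied by the idempotent at the end of [w], which either fixes or kills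
   it, whence the conditional. *)
exists [:: (gen w0, lval y); (if btgt b (lval y1) == wend w then - g else 0, lval y1)].
  rewrite big_cons big_seq1 /=; congr (_ + _); rewrite actA mul_bas_triv.
  by case: ifP => _; rewrite ?scalerN // [X in - X]scale0r oppr0 scaler0.
move=> p; rewrite !inE => /orP[] /eqP-> /=; split=> //; first exact: word_gr_gen.
  exact: wt_follow wy.
case: ifP => _; last exact: word_gr0.
move=> wx nx; rewrite -sub0r amcoefB amcoef0 sub0r.
by rewrite (@gens_word_gr _ _ _ wx nx) oppr0.
Qed.

(** In each term of a boundary the word loses one letter and the coefficient gains a factor of
    weight exactly 1. The resolution is therefore homogeneous and minimal, with generators in degree
    [n]. *)
Lemma koszul_anick : koszul wgr.
Proof.
split; [exact: wgr_algebra | exact: wgr0_finite_product |].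
exists degree0_module, degree0_proj, X, word_gr; split.
- split; first exact: degree0_surj.
  by move=> z; rewrite [degree0_proj z = 0]degree0_ker wgr_positiveP.
- split.
  + move=> n; split; first exact: word_gr_direct.
    by move=> i j m z mi zj; apply: word_gr_act.
  + move=> n i x xi; rewrite (am_decomp x) linear_sum.
    elim/big_ind: _ => [||w _]; [exact: word_gr0 | exact: word_grD |].
    have [s sE] := bas_span b (amfun x w); rewrite sE.
    rewrite [_ *: _]scaler_suml linear_sum.
    elim/big_ind: _ => [||y _]; [exact: word_gr0 | exact: word_grD |].
    have xw := xi (w, y); rewrite /amcoef /= in xw.
    case: ((n.+1 + wt y)%:Z =P i) => [yi|/xw->]; last first.
      by rewrite scale0r [_ *: gen w]scale0r linear0; apply: word_gr0.
    rewrite linearZ_LR /=; have [r -> rP] := amd_gen_split w.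
    rewrite scaler_sumr big_seq; elim/big_ind: _ => [||p pr]; [exact: word_gr0 | exact: word_grD |].
    have [p1 p2] := rP p pr; rewrite -yi.
    have -> : (n.+1 + wt y)%:Z = n%:Z + 1%:Z + (wt y)%:Z.
      by rewrite -!PoszD addn1.
    apply: word_gr_act; last exact/wgrZ/wgr_bas.
    by apply: word_gr_act => //; rewrite -p2; apply: wgr_bas.
  + move=> i x xi; case: (i =P 0) => [|i0]; first by left.
    right; rewrite [LHS]amepsE; apply/degree0_ker => v.
    rewrite linear_sum big1 // => w _; rewrite bcoef_triv_mul; case: ifP => // _.
    by apply: (xi (w, btriv b v)); rewrite /= wt_triv => e; apply: i0.
  move=> n x; rewrite (am_decomp x) linear_sum; apply: sums_big => w _.
  rewrite linearZ_LR /=; have [r -> rP] := amd_gen_split w.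
  rewrite scaler_sumr big_seq; apply: sums_big => p /rP[_ p2]; apply: sums_mem.
  exists p.1, (b p.2 * amfun x w); split; last by rewrite actA.
  apply/wgr_positiveP => v; rewrite bcoef_trivM bcoef_bas; case: eqP => [vp|_]; last exact: mul0r.
  by rewrite -vp wt_triv in p2.
move=> n x; rewrite (am_decomp x); apply: sums_big => w _; apply: sums_mem.
by exists (gen w), (amfun x w); split=> //; apply: word_gr_gen.
Qed.

End Koszul.
End WeightedBasis.

(** Two odd degrees would force [D = 2], [D = 1 + A] or [D = 2 * A], according to how many of them
    are 1, and degree 1 with an even degree would force [A = 1]. The case [D = 1 + A] occurs in
    total degree at least 4 only, where [A] divides [D], so that [A] would divide 1. *)
Lemma delta_add_eq D A m n : (2 < D)%N -> (1 < A)%N -> D <> (2 * A)%N ->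
  ((2 < m + n)%N -> (A < D)%N) -> ((3 < m + n)%N -> (A %| D)%N) ->
  (0 < m)%N -> (0 < n)%N -> delta D A (m + n) = (delta D A m + delta D A n)%N ->
  [/\ (1 < m)%N, (1 < n)%N & ~~ (odd m && odd n)].
Proof.
move=> D2 A1 DA h3 h4 m0 n0; rewrite !deltaE halfD oddD.
have e (k : nat) : k = (odd k + k./2 * 2)%N by rewrite muln2 odd_double_half.
have em := e m; have en := e n.
case: (boolP (odd m)) em => om; case: (boolP (odd n)) en => on /= en em.
- case: (m =P 1%N) => m1; case: (n =P 1%N) => n1; try by lia.
  + move=> H; have [k kD] : exists k, D = (k * A)%N by apply/dvdnP/h4; lia.
    exfalso; have DD : D = (1 + A)%N by lia.
    by move: DD; rewrite kD; case: k {kD} => [|[|k]]; lia.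
  move=> H; have [k kD] : exists k, D = (k * A)%N by apply/dvdnP/h4; lia.
  exfalso; have DD : D = (1 + A)%N by lia.
  by move: DD; rewrite kD; case: k {kD} => [|[|k]]; lia.
- case: (m =P 1%N) => m1; case: (m + n =P 1)%N => mn H; split=> //; lia.
- case: (n =P 1%N) => n1; case: (m + n =P 1)%N => mn H; split=> //; lia.
by move=> _; split=> //; lia.
Qed.

Lemma delta_add D A m n : (1 < m)%N -> (1 < n)%N -> ~~ (odd m && odd n) ->
  delta D A (m + n) = (delta D A m + delta D A n)%N.
Proof.
move=> m1 n1; rewrite !deltaE halfD oddD.
have -> : (m == 1)%N = false by lia.
have -> : (n == 1)%N = false by lia.
have -> : (m + n == 1)%N = false by lia.
by case: (odd m); case: (odd n) => //= _; lia.
Qed.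

(** * Factorization and overlap of chains *)

Section ExtBasisCombinatorics.
Variables (K : fieldType) (Q : quiver) (rho : qpath Q -> Prop) (L : algType K).
Variable (pi : {lrmorphism path_algebra K Q -> L}).
Hypothesis piP : is_quotient (path_ideal K rho) pi.
Variable N : nat.
Hypothesis pi_long : forall p, (N <= plen p)%N -> pi (path_elt p) = 0.
Hypothesis pi_short : forall p, (plen p <= 1)%N -> pi (path_elt p) <> 0.

Local Notation chain := (chain piP pi_long pi_short).
Local Notation ech := (echain piP pi_long pi_short).

Variables D A : nat.
Hypothesis clen : forall n (w : chain n), size (carrows w) = delta D A n.
Hypothesis D_gt2 : (2 < D)%N.
Hypothesis A_gt1 : (1 < A)%N.
Hypothesis D_neq : D <> (2 * A)%N.
Local Notation delta := (delta D A).

Definition edg (x : ech) : nat := tag x.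
Definition est (x : ech) : vert Q := cstart (tagged x).
Definition een (x : ech) : vert Q := cend (tagged x).
Definition ear (x : ech) : seq (arr Q) := carrows (tagged x).

Lemma size_ear x : size (ear x) = delta (edg x). Proof. exact: clen. Qed.

Lemma een_endp x : een x = endp (est x) (ear x).
Proof. by rewrite /est /ear (chain_walk (tagged x)).2. Qed.

Lemma ear_walk x : walk (est x) (ear x).
Proof. exact: (chain_walk (tagged x)).1. Qed.

Lemma echain_ext (x y : ech) : edg x = edg y -> est x = est y -> ear x = ear y -> x = y.
Proof.
case: x y => [n w] [m w']; rewrite /edg /est /ear /= => nm; subst m => sE aE.
by congr existT; apply: (chain_inj clen).
Qed.

Lemma emulP (p r z : ech) : emul p r = Some z ->
  [/\ edg z = (edg p + edg r)%N, est z = est r, est p = een r & ear z = ear r ++ ear p].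
Proof.
rewrite /emul; case: pickP => // w /and3P[/eqP wv /eqP pr /eqP wE] [<-].
by split.
Qed.

Lemma emul_ex (p r z : ech) : edg z = (edg p + edg r)%N -> est z = est r ->
  est p = een r -> ear z = ear r ++ ear p -> emul p r = Some z.
Proof.
case: z => k w; rewrite /edg /est /ear /=; move=> kE; subst k => sE pr aE.
have h : ecomp w (tagged r) (tagged p).
  by apply/and3P; split; apply/eqP.
rewrite /emul; case: pickP => [w' h'|/(_ w)]; last by rewrite h.
by rewrite (ecomp_uniq clen h' h).
Qed.

Lemma echain_lt x : (2 < edg x)%N -> (A < D)%N.
Proof. exact: (chain_lt D_gt2 clen A_gt1 D_neq (tagged x)). Qed.

Lemma echain_dvd x : (3 < edg x)%N -> (A %| D)%N.
Proof. exact: (chain_dvd D_gt2 clen A_gt1 D_neq (tagged x)). Qed.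

Lemma echain_good x : (1 < edg x)%N -> good pi D A (ear x).
Proof.
case: x => [[|[|n]] w] //= _; exact: (@chain_good _ _ _ _ _ piP N pi_long pi_short D D_gt2 A clen A_gt1 D_neq n w).
Qed.

Lemma echain_of_good n v s : (1 < n)%N -> walk v s -> size s = delta n ->
  good pi D A s -> ((2 < n)%N -> (A < D)%N) -> ((3 < n)%N -> (A %| D)%N) ->
  exists x : ech, [/\ edg x = n, est x = v & ear x = s].
Proof.
move=> n1 wk sn gs h3 h4.
have [w [wv ws]] := chain_of_good D_gt2 clen A_gt1 D_neq n1 wk sn gs h3 h4.
by exists (existT _ n w).
Qed.

Lemma edg_mul x y z : emul x y = Some z -> (0 < edg x)%N -> (0 < edg y)%N ->
  [/\ (1 < edg x)%N, (1 < edg y)%N & ~~ (odd (edg x) && odd (edg y))].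
Proof.
move=> /emulP[zn _ _ zE] x0 y0; apply: (@delta_add_eq D A) => //; rewrite -?zn.
- exact: echain_lt.
- exact: echain_dvd.
by rewrite -!size_ear zE size_cat addnC.
Qed.

Lemma good_take k s : good pi D A s -> good pi D A (take k s).
Proof.
move=> gs j jk; have jk' : (j * A + D <= k)%N by apply: leq_trans jk _; rewrite size_take_min geq_minl.
rewrite (zat_take pi D_gt2) // jk andbT; apply: gs; apply: leq_trans jk _.
by rewrite size_take_min geq_minr.
Qed.

Lemma good_drop k s : (A %| k)%N -> good pi D A s -> good pi D A (drop k s).
Proof.
move=> /dvdnP[m ->] gs j; rewrite size_drop => jk.
have z : zat pi D s ((j + m) * A) by apply: gs; rewrite mulnDl; lia.
have le : (m * A <= (j + m) * A)%N by rewrite leq_mul2r leq_addl orbT.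
by have := drop_zat D_gt2 le z; rewrite mulnDl addnK.
Qed.

(** Products reverse the order of paths, so [r] consists of the last [D] arrows. They begin at
    [delta n.+2], a multiple of [A], whence both pieces inherit the zero factors that make them
    chains. *)
Lemma e_split x : (3 < edg x)%N -> exists r x', edg r = 2 /\ emul r x' = Some x.
Proof.
move=> x3; have AD := echain_dvd x3; have ltAD := echain_lt (ltnW x3).
have [n nE] : exists n, edg x = n.+4 by exists (edg x - 4)%N; lia.
have gx := echain_good (ltnW (ltnW x3)); have wx := ear_walk x; have sx := size_ear x.
have dE : delta n.+4 = (delta n.+2 + D)%N by apply: deltaD2.
rewrite nE dE in sx.
have st : size (take (delta n.+2) (ear x)) = delta n.+2 by rewrite size_takel // sx leq_addr.
have [|||x' [x'n x'v x's]] := echain_of_good _ (walk_take (delta n.+2) wx) st (good_take gx); rewrite // => //.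
have sd : size (drop (delta n.+2) (ear x)) = delta 2 by rewrite size_drop sx addKn /= mul1n.
have dv : (A %| delta n.+2)%N by apply: delta_dvd.
have [|||r [rn rv rs]] := echain_of_good _ (walk_drop (delta n.+2) wx) sd (good_drop dv gx); rewrite // => //.
exists r, x'; split=> //; apply: emul_ex.
- by rewrite nE rn x'n.
- by [].
- by rewrite een_endp rv x'v x's.
by rewrite x's rs cat_take_drop.
Qed.

Lemma e_split_inj r r' x x' z : edg r = 2 -> edg r' = 2 ->
  emul r x = Some z -> emul r' x' = Some z -> r = r' /\ x = x'.
Proof.
move=> r2 r2' /emulP[zn zv rx zE] /emulP[zn' zv' rx' zE'].
have xx : edg x = edg x' by move: zn; rewrite zn' r2 r2' => /addnI.
move: zE; rewrite zE' => /eqP; rewrite eqseq_cat ?size_ear ?xx // => /andP[/eqP e1 /eqP e2].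
have xE : x = x' by apply: echain_ext => //; rewrite -zv -zv'.
by split=> //; apply: echain_ext; rewrite ?r2 ?r2' // rx rx' xE.
Qed.

(** The path in question is [y], then [z], then [x]. Since [z] has length at least [D], a factor of
    length [D] that is not within [y z] lies within [z x]; and since the length of [y] is a multiple
    of [A], the prescribed positions of [z x] are prescribed positions of the whole path. *)
Lemma e_local x y z u v : emul x z = Some u -> emul z y = Some v ->
  (0 < edg x)%N -> (0 < edg y)%N -> (1 < edg z)%N -> ~~ (odd (edg x) && odd (edg y)) ->
  exists w, emul u y = Some w.
Proof.
move=> xz zy x0 y0 z1 oxy; have z0 := ltnW z1.
have [x1 _ oxz] := edg_mul xz x0 z0; have [_ y1 ozy] := edg_mul zy z0 y0.
have [un uv xv uE] := emulP xz; have [vn vv zv vE] := emulP zy.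
have u4 : (3 < edg u)%N by rewrite un; lia.
have AD := echain_dvd u4; have ltAD := echain_lt (ltnW u4).
have gu := echain_good (ltnW (ltnW u4)).
have gv : good pi D A (ear v) by apply: echain_good; rewrite vn; lia.
have oo : ~~ (odd (edg u) && odd (edg y)).
  rewrite un oddD; move: oxy oxz ozy.
  by case: (odd (edg x)); case: (odd (edg y)); case: (odd (edg z)).
have sw : size (ear y ++ ear u) = delta (edg u + edg y).
  by rewrite size_cat !size_ear (delta_add _ _ _ y1 oo) ?(ltnW (ltnW u4)) // addnC.
have ww : walk (est y) (ear y ++ ear u).
  by rewrite walk_cat ear_walk /= -/(endp _ _) -een_endp -zv -uv ear_walk.
have vu : ear y ++ ear u = ear v ++ ear x by rewrite uE vE catA.
have gw : good pi D A (ear y ++ ear u).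
  move=> j; rewrite size_cat => jw.
  case: (leqP (j * A + D) (size (ear v))) => jv.
    have zt := zat_take pi D_gt2 (ear y ++ ear u) jv.
    have tk : take (size (ear v)) (ear y ++ ear u) = ear v by rewrite vu take_size_cat.
    by move: (gv j jv); rewrite -{1}tk zt => /andP[].
  have dz : (D <= size (ear z))%N by rewrite size_ear delta_ge.
  have [m mE] : exists m, size (ear y) = (m * A)%N.
    by apply/dvdnP; rewrite size_ear delta_dvd.
  have jy : (size (ear y) <= j * A)%N by move: jv; rewrite vE size_cat; lia.
  have mj : (m <= j)%N by move: jy; rewrite mE leq_mul2r; lia.
  rewrite -(subnK jy); apply: (zat_drop D_gt2); rewrite drop_size_cat // mE -mulnBl.
  by apply: gu; rewrite mulnBl -mE; lia.
have [|||w [wn wv ws]] := echain_of_good _ ww sw gw; rewrite // => //; first by lia.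
exists w; apply: emul_ex => //.
by rewrite uv zv.
Qed.

End ExtBasisCombinatorics.

(** The hat-degree of [Ext^n]; degree 1 is the only exception to halving. *)
Definition hdeg (n : nat) : nat := if n == 1%N then 1%N else n./2.

(** * The hat-degree grading and its Koszulity *)

Section ExtKoszul.
Variables (K : fieldType) (Q : quiver) (rho : qpath Q -> Prop) (L : algType K).
Variable (pi : {lrmorphism path_algebra K Q -> L}).
Hypothesis piP : is_quotient (path_ideal K rho) pi.
Variable N : nat.
Hypothesis pi_long : forall p, (N <= plen p)%N -> pi (path_elt p) = 0.
Hypothesis pi_short : forall p, (plen p <= 1)%N -> pi (path_elt p) <> 0.
Variables (S : lmodType L^c) (q : {linear L^c^o -> S}).
Hypothesis qP : is_degree0_module (length_grading pi) q.

Local Notation chain := (chain piP pi_long pi_short).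
Local Notation ech := (echain piP pi_long pi_short).
Local Notation X := (chain_resolution piP pi_long pi_short qP).

Variables D A : nat.
Hypothesis clen : forall n (w : chain n), size (carrows w) = delta D A n.
Hypothesis D_gt2 : (2 < D)%N.
Hypothesis A_gt1 : (1 < A)%N.
Hypothesis D_neq : D <> (2 * A)%N.

Variables (P : resolution S) (E : algType K) (cls : forall n, {linear P n -> S} -> E).
Hypothesis extE : is_ext_algebra cls.

Variables (al : forall n, {linear P n -> X n}) (be : forall n, {linear X n -> P n}).
Hypothesis al_eps : forall x, res_eps X (al 0%N x) = res_eps P x.
Hypothesis al_d : forall n x, res_d X n (al n.+1 x) = al n (res_d P n x).
Hypothesis be_eps : forall x, res_eps P (be 0%N x) = res_eps X x.
Hypothesis be_d : forall n x, res_d P n (be n.+1 x) = be n (res_d X n x).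

Local Notation ebas := (ebas cls al).
Local Notation etriv := (etriv piP pi_long pi_short).

Lemma etriv_data v : [/\ edg (etriv v) = 0%N, est (etriv v) = v, een (etriv v) = v & ear (etriv v) = [::]].
Proof.
have e : est (etriv v) = v by apply: czeroP.
have a0 : ear (etriv v) = [::] by apply: carrows0.
by split=> //; rewrite een_endp e a0.
Qed.

Lemma edg0_triv x : edg x = 0%N -> x = etriv (est x).
Proof.
have [t1 t2 _ t3] := etriv_data (est x); move=> x0; apply: (echain_ext clen).
- by rewrite t1.
- by rewrite t2.
by apply/eqP; rewrite t3 -size_eq0 (size_ear clen) x0.
Qed.

Lemma emul_trivl v x : emul (etriv v) x = if v == een x then Some x else None.
Proof.
have [t1 t2 t3 t4] := etriv_data v; case: eqP => vx.
  by apply: (emul_ex clen); rewrite ?t1 ?t2 ?t4 ?cats0.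
by case E': emul => [z|] //; have [_ _] := emulP E'; rewrite t2.
Qed.

Lemma emul_trivr x v : emul x (etriv v) = if est x == v then Some x else None.
Proof.
have [t1 t2 t3 t4] := etriv_data v; case: eqP => vx.
  by apply: (emul_ex clen); rewrite ?t1 ?t2 ?t3 ?t4 ?addn0.
by case E': emul => [z|] //; have [_ _] := emulP E'; rewrite t3.
Qed.

Lemma emul_comp (x y z : ech) : emul x y = Some z ->
  [/\ est x = een y, een z = een x & est z = est y].
Proof.
move=> /emulP[_ zs xy zE]; split=> //.
by rewrite !een_endp zs zE endp_cat -een_endp -xy.
Qed.

Lemma emul_eq_triv x y v : emul x y = Some (etriv v) -> x = etriv v /\ y = etriv v.
Proof.
move=> /emulP[]; have [t1 t2 t3 t4] := etriv_data v; rewrite t1 t2.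
move=> /esym/eqP; rewrite addn_eq0 => /andP[/eqP x0 /eqP y0] yv xy _.
have yE : y = etriv v by rewrite (edg0_triv y0) -yv.
by split=> //; rewrite (edg0_triv x0) xy yE t3.
Qed.

Variable coef : ech -> {scalar E}.
Hypothesis coefE : forall x y, coef x (ebas y) = (x == y)%:R.
Hypothesis coefS : forall z, exists s : seq ech, z = \sum_(x <- s) coef x z *: ebas x.

(** The source of a basis element is the end of its path and the target is the start, because
    products concatenate paths in reverse order. *)
Definition ext_basis : path_basis E (vert Q) ech :=
  PathBasis (fun v => let: And4 _ _ e _ := etriv_data v in e)
    (fun v => let: And4 _ e _ _ := etriv_data v in e)
    emul_trivl emul_trivr emul_comp emul_eq_triv
    (ebasM clen D_gt2 A_gt1 D_neq extE al_eps al_d be_eps be_d)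
    (ebas_sum clen extE al_eps al_d) coefE coefS.

Definition short_chain := {n : 'I_4 & (chain n : finType)}.

Definition short_val (y : short_chain) : ech :=
  Tagged (fun n => chain n : choiceType) (tagged y).

Lemma short_val_inj : injective short_val.
Proof.
move=> [m w] [n w'] e; have mn : m = n by apply/val_inj/(congr1 tag e).
by subst n; move/eqP: e; rewrite /short_val eq_Tagged => /eqP /= ->.
Qed.

Lemma short_val_ex x : (edg x <= 3)%N -> exists y, short_val y = x.
Proof. by case: x => n w n3; exists (existT _ (Ordinal (n3 : (n < 4)%N)) w). Qed.

Definition ext_basis_letters : ext_letters ext_basis.
Proof.
apply: (@ExtLetters _ _ _ _ ext_basis (@edg _ _ _ _ _ _ _ _ _) short_chain short_val).
- by move=> x y z /emulP[].
- by move=> v; have [] := etriv_data v.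
- move=> x x0; have := edg0_triv x0 => xE; rewrite xE; have [_ t2 t3 _] := etriv_data (est x).
  by congr etriv; apply: esym.
- exact: short_val_inj.
- by move=> y; apply: leq_ord.
- exact: short_val_ex.
- exact: (edg_mul clen D_gt2 A_gt1 D_neq).
- exact: (e_split clen D_gt2 A_gt1 D_neq).
- exact: (e_split_inj clen).
exact: (e_local clen D_gt2 A_gt1 D_neq).
Defined.

Definition hat_weight (x : ech) := hdeg (edg x).

(** Halving is additive unless both degrees are odd, and the exceptional degree 1 does not occur in
    a nonzero product of positive degrees. *)
Lemma hat_weightD x y z : emul x y = Some z ->
  hat_weight z = (hat_weight x + hat_weight y)%N.
Proof.
move=> xyz; have [zn _ _ _] := emulP xyz; rewrite /hat_weight zn.
case: (posnP (edg x)) => [->|x0]; first by rewrite add0n.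
case: (posnP (edg y)) => [->|y0]; first by rewrite !addn0.
have [x1 y1 oxy] := edg_mul clen D_gt2 A_gt1 D_neq xyz x0 y0.
by rewrite /hdeg !gtn_eqF ?ltn_addr // halfD (negPf oxy).
Qed.

Lemma hat_weight_triv v : hat_weight (etriv v) = 0%N.
Proof. by rewrite /hat_weight; have [-> _ _ _] := etriv_data v. Qed.

Lemma hat_weight_eq0 x : hat_weight x = 0%N -> x = etriv (een x).
Proof.
rewrite /hat_weight /hdeg; case: eqP => // x1 x0; have e : edg x = 0%N by lia.
have := edg0_triv e => xE; rewrite {1}xE; congr etriv.
by rewrite [in RHS]xE; have [_ _ ->] := etriv_data (est x).
Qed.

Lemma coefZ_ebas x u c : coef x (c *: ebas u) = if x == u then c else 0.
Proof.
apply: (etrans (linearZ_LR (coef x) c _)); rewrite /= coefE; case: eqP => _; first exact: mulr1.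
exact: mulr0.
Qed.

Lemma coef_ext_degree n z : ext_degree cls n z <-> forall x, edg x <> n -> coef x z = 0.
Proof.
split=> [/(ext_degree_ecls extE al_eps al_d be_eps be_d)[c ->] x xn|z0].
  rewrite (ecls_sum extE al_d) linear_sum big1 // => w _; rewrite coefZ_ebas.
  by case: eqP => [xw|_]; first by rewrite xw in xn.
have [E0 EB _ _] := ext_direct extE.
have ED u v : ext_degree cls n u -> ext_degree cls n v -> ext_degree cls n (u + v).
  by move=> un vn; rewrite -[v]opprK -[- v]sub0r; apply: (EB) => //; apply: EB.
have [s ->] := coefS z; elim/big_ind: _ => // x _.
case: (edg x =P n) => [<-|/z0->]; last by rewrite scale0r.
by rewrite /ebas -linearZ_LR; apply: ecls_degree.
Qed.

Lemma ext_component n z : exists2 y, ext_degree cls n y &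
  forall x, coef x y = if edg x == n then coef x z else 0.
Proof.
have [s sE] := coefS z; pose y := \sum_(x <- s | edg x == n) coef x z *: ebas x.
have yE x : coef x y = if edg x == n then coef x z else 0.
  rewrite /y linear_sum; case: ifP => xn.
    rewrite [in RHS]sE linear_sum big_mkcond; apply: eq_bigr => u _.
    rewrite coefZ_ebas; case: (x =P u) => [<-|_]; first by rewrite xn.
    by rewrite if_same.
  rewrite big1 // => u un; rewrite coefZ_ebas.
  by case: eqP => [xu|_]; first by rewrite xu un in xn.
by exists y => //; apply/coef_ext_degree => x xn; rewrite yE; case: eqP.
Qed.

Lemma hat_gradingP n z : hat_grading (ext_degree cls) n z <-> wgr ext_basis hat_weight n z.
Proof.
have hE x : hat_weight x = hdeg (edg x) by [].
have cD x u v : coef x (u + v) = coef x u + coef x v by apply: linearD.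
have sep u v : (forall x, coef x u = coef x v) -> u = v.
  move=> uv; apply/eqP; rewrite -subr_eq0; apply/eqP/(bas_eq0 (b := ext_basis)) => x.
  by rewrite [LHS]linearB uv; apply: subrr.
case: n => [|[|n]] /=.
- apply: (iff_trans (coef_ext_degree 0 z)); split=> h x xn; apply: h => x0; apply: xn.
    by rewrite hE x0.
  by move: x0; rewrite hE /hdeg; case: eqP => //; lia.
- split=> [[x1 [x2 [x3 [/coef_ext_degree h1 /coef_ext_degree h2 /coef_ext_degree h3 ->]]]] x xn|h].
    have := xn; rewrite hE => xh; apply: etrans (cD _ _ _) _; rewrite cD.
    by rewrite h1 ?h2 ?h3 ?addr0 // => xe; rewrite xe in xh.
  have [x1 h1 e1] := ext_component 1 z; have [x2 h2 e2] := ext_component 2 z.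
  have [x3 h3 e3] := ext_component 3 z; exists x1, x2, x3; split=> //.
  apply: sep => x; rewrite !cD e1 e2 e3.
  have hx := h x; rewrite hE in hx; move: hx.
  case: (edg x) => [|[|[|[|k]]]] /= hx; rewrite ?addr0 ?add0r //; apply: hx; rewrite /hdeg //=; lia.
split=> [[x1 [x2 [/coef_ext_degree h1 /coef_ext_degree h2 ->]]] x xn|h].
  have := xn; rewrite hE /hdeg => xh; apply: etrans (cD _ _ _) _.
  by rewrite h1 ?h2 ?addr0 // => xe; apply: xh; rewrite xe; case: eqP; lia.
have [x1 h1 e1] := ext_component n.+2.*2 z; have [x2 h2 e2] := ext_component n.+2.*2.+1 z.
exists x1, x2; split=> //; apply: sep => x; rewrite !cD e1 e2.
have hx := h x; rewrite hE /hdeg in hx.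
case: (edg x =P n.+2.*2) => e0; case: (edg x =P n.+2.*2.+1) => e1'; rewrite ?addr0 ?add0r //; first lia.
by apply: hx; case: eqP; lia.
Qed.

Lemma koszul_hat : koszul (hat_grading (ext_degree cls)).
Proof.
have -> : hat_grading (ext_degree cls) = wgr ext_basis hat_weight.
  by apply/funext => n; apply/funext => z; apply/propext/hat_gradingP.
have w3 (y : short_chain) : (0 < edg (short_val y))%N -> hat_weight (short_val y) = 1%N.
  by rewrite /hat_weight /hdeg; have := leq_ord (tag y); rewrite /edg /=; case: eqP => //; lia.
apply: (@koszul_anick _ _ _ _ ext_basis hat_weight hat_weightD hat_weight_triv hat_weight_eq0
  (ext_anick ext_basis_letters)).
- by move=> u y /andP[_ /andP[y0 _]]; apply: w3.
move=> u y u1 y1 _ /ecorr_spec[_ _ _ dy _]; apply: w3.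
by rewrite [X in (_ < X)%N]dy.
Qed.

End ExtKoszul.

Theorem theorem5p7 (K : fieldType) (Q : quiver) (rho : qpath Q -> Prop)
    (L : algType K) (pi : {lrmorphism path_algebra K Q -> L})
    (S : lmodType L^c) (q : {linear L^c^o -> S})
    (P : resolution S) (P_ : forall n, int -> P n -> Prop)
    (E : algType K) (cls : forall n, {linear P n -> S} -> E)
    (D A : nat) :
  admissible (path_ideal K rho) ->
  is_quotient (path_ideal K rho) pi ->
  is_degree0_module (length_grading pi) q ->
  minimal_graded (length_grading pi) (concentrated0 S) P_ ->
  stacked P_ D A ->
  is_ext_algebra cls ->
  (2 < D)%N -> (1 < A)%N -> D <> (2 * A)%N ->
  koszul (hat_grading (ext_degree cls)).
Proof.
move=> adm piP qP PG st extE D2 A1 DA; have [N pi_long] := admissible_long adm piP.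
have pi_short := admissible_short adm piP.
pose X := chain_resolution piP pi_long pi_short qP.
have [al [al_eps al_d]] := comparison_map P X.
have [be [be_eps be_d]] := comparison_map X P.
have clen n (w : chain piP pi_long pi_short n) : size (carrows w) = delta D A n.
  exact: (wlen_stacked qP PG w st).
have [coef [coefE coefS]] := coordinate_functions
  (ebas_span extE al_eps al_d be_eps be_d) (ebas_free extE al_eps al_d be_eps be_d).
exact: (koszul_hat clen D2 A1 DA extE al_eps al_d be_eps be_d coefE coefS).
Qed.
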